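(* Let $\mathcal{C}=\{G_1,\dots,G_m\}$ be a set of blocks with hooks $h_1,\dots,h_m$ and probabilities $p_1,\dots,p_m$, and let $\mathcal{G}_0,\mathcal{G}_1,\mathcal{G}_2,\dots$ be a sequence of hooking networks grown from $\mathcal{C}$ using linear preferential attachment with parameters $\chi$ and $\rho$. Let $r$ be a positive integer and let $k_1<k_2<\dots<k_r$ be the first (smallest) $r$ essential degrees. Let $\mathcal{X}_n=(X_{n,1},\dots,X_{n,r})$, where $X_{n,i}$ is the number of vertices of degree $k_i$ in $\mathcal{G}_n$. With $w_k=\chi k+\rho$, define, for positive integers $k$, $$f(k)=\sum_{i=1}^m p_i\,\bigl|\{v\in V(G_i)\setminus\{h_i\}:\deg(v)=k\}\bigr|,\qquad g(k)=\sum_{i:\ \deg(h_i)=k}p_i,$$ $$\lambda_1=\sum_{k\ge1}\bigl(w_kf(k)+\chi k\,g(k)\bigr),$$ and define $\nu=(\nu_1,\dots,\nu_r)$ by $\nu_1=f(k_1)/(\lambda_1+w_{k_1})$ and, recursively for $i=2,\dots,r$, $$\nu_i=\frac{1}{\lambda_1+w_{k_i}}\Bigl(f(k_i)+\sum_{j=1}^{i-1}w_{k_j}\,g(k_i-k_j)\,\nu_j\Bigr).$$ Then, as $n\to\infty$, $$n^{-1/2}\bigl(\mathcal{X}_n-n\lambda_1\nu\bigr)\xrightarrow{d}\mathcal{N}(0,\Sigma)$$ for some covariance matrix $\Sigma$.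
   Context: Parameters: $\chi\ge0$ and $\rho\in\mathbb{R}$ are real numbers with $\chi+\rho>0$; $w_k:=\chi k+\rho$ for positive integers $k$. Blocks: $\mathcal{C}=\{G_1,\dots,G_m\}$ is a finite set of finite connected graphs (self-loops and multiple edges allowed), each with at least 2 vertices, and each with a distinguished vertex $h_i\in V(G_i)$ called its hook. Each block $G_i$ is assigned a probability $p_i>0$, with $p_1+\dots+p_m=1$. Degrees count edges with multiplicity, a loop contributing 2. Hooking networks: $\mathcal{G}_0$ is a copy of one of the blocks (chosen arbitrarily, deterministically or at random); the vertex of $\mathcal{G}_0$ corresponding to the hook of that block is called the master hook. For $n\ge1$, given $\mathcal{G}_{n-1}$, a vertex $v$ of $\mathcal{G}_{n-1}$ (the latch) is chosen with probability $\dfrac{\chi\deg(v)+\rho}{\sum_{u\in V(\mathcal{G}_{n-1})}(\chi\deg(u)+\rho)}$; then, independently of the latch and of the past, a block is chosen, $G_i$ being chosen with probability $p_i$. $\mathcal{G}_n$ is obtained by attaching a new copy of $G_i$ to $\mathcal{G}_{n-1}$ by fusing (identifying) the hook $h_i$ of the copy with $v$; so the degree of $v$ increases by $\deg(h_i)$ and the other vertices of the copy are added with their degrees in $G_i$. Essential degrees: a positive integer $k$ is an essential degree if with positive probability there is some $n$ such that $\mathcal{G}_n$ has at least two vertices of degree $k$; otherwise $k$ is a nonessential degree. $\mathcal{N}(0,\Sigma)$ is the (possibly degenerate) multivariate normal distribution with mean $0$ and covariance matrix $\Sigma$. *)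

(* Defs.v *)
From HB Require Import structures.
From mathcomp Require Import all_boot all_order all_algebra.
From mathcomp Require Import all_classical all_reals all_analysis.

Set Implicit Arguments.
Unset Strict Implicit.
Unset Printing Implicit Defensive.

Import Order.TTheory GRing.Theory Num.Theory.
Import numFieldNormedType.Exports.

Local Open Scope classical_set_scope.
Local Open Scope ring_scope.

(* Finite multigraphs on the vertex set 'I_nvert: each edge is listed once, as
   a pair whose order carries no meaning; repetitions in the list are multiple
   edges and pairs (x, x) are loops. *)
Record mgraph := MGraph {
  nvert : nat;
  edges : seq ('I_nvert * 'I_nvert) }.

Definition deg (G : mgraph) (v : 'I_(nvert G)) : nat :=
  (\sum_(e <- edges G) ((e.1 == v) + (e.2 == v)))%N.

Definition adjacent (G : mgraph) : rel 'I_(nvert G) :=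
  fun x y => ((x, y) \in edges G) || ((y, x) \in edges G).

Definition connected_graph (G : mgraph) : Prop :=
  forall x y : 'I_(nvert G), connect (@adjacent G) x y.

Definition nb_deg (G : mgraph) (k : nat) : nat :=
  #|[set v : 'I_(nvert G) | deg v == k]%SET|.

Record block := Block {
  block_graph :> mgraph;
  hook : 'I_(nvert block_graph);
  block_nvert : (2 <= nvert block_graph)%N;
  block_connected : connected_graph block_graph }.

(* Name, in the fused graph, of the vertex x of a copy of B attached at v: the
   hook becomes v, and the other vertices are numbered after those of G. *)
Definition fuse (G : mgraph) (v : 'I_(nvert G)) (B : block)
    (x : 'I_(nvert B)) : 'I_(nvert G + (nvert B).-1) :=
  if unlift (hook B) x is Some y then rshift (nvert G) y else lshift _ v.

Definition attach (G : mgraph) (v : 'I_(nvert G)) (B : block) : mgraph :=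
  MGraph ([seq (lshift (nvert B).-1 e.1, lshift (nvert B).-1 e.2)
            | e <- edges G]
          ++ [seq (fuse v e.1, fuse v e.2) | e <- edges B]).

(* Network after n steps, starting from the block i0, the latch and the block
   of step j.+1 being a j and c j.  Latches are natural numbers because the
   vertex set varies; a latch that is not a vertex leaves the network
   unchanged, which has probability 0 under [hooking_process]. *)
Fixpoint network (m : nat) (B : 'I_m -> block) (i0 : 'I_m) (a : nat -> nat)
    (c : nat -> 'I_m) (n : nat) : mgraph :=
  if n is n'.+1 then
    let G := network B i0 a c n' in
    if insub (a n') is Some v then @attach G v (B (c n')) else G
  else B i0.

Section Model.
Context {R : realType}.
Variables (chi rho : R).

Definition weight (k : nat) : R := chi * k%:R + rho.

Definition latch_prob (G : mgraph) (v : nat) : R :=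
  if insub v is Some u then
    weight (@deg G u) / \sum_(x < nvert G) weight (deg x)
  else 0.

Variables (m : nat) (B : 'I_m -> block) (p : 'I_m -> R).

Definition f_deg (k : nat) : R :=
  \sum_(i < m) p i *
    #|[set v : 'I_(nvert (B i)) | (v != hook (B i)) && (deg v == k)]%SET|%:R.

Definition g_deg (k : nat) : R := \sum_(i < m | deg (hook (B i)) == k) p i.

Definition lambda1 : R :=
  limn (fun N => \sum_(1 <= k < N)
                   (weight k * f_deg k + chi * k%:R * g_deg k)).

Context {d : measure_display} {T : measurableType d}.
Variables (P : probability T R).
Variables (b0 : T -> 'I_m) (latch : nat -> T -> nat) (blk : nat -> T -> 'I_m).

Definition past (i0 : 'I_m) (a : nat -> nat) (c : nat -> 'I_m) (n : nat) :
    set T :=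
  [set w | b0 w = i0 /\
           forall j, (j < n)%N -> latch j w = a j /\ blk j w = c j].

(* The law of the initial block b0 is arbitrary. *)
Record hooking_process : Prop := HookingProcess {
  measurable_start : forall i, measurable (b0 @^-1` [set i]);
  measurable_latch : forall n v, measurable (latch n @^-1` [set v]);
  measurable_blk : forall n i, measurable (blk n @^-1` [set i]);
  latch_law : forall i0 a c n v,
    P (past i0 a c n `&` [set w | latch n w = v]) =
    (P (past i0 a c n) * (latch_prob (network B i0 a c n) v)%:E)%E;
  block_law : forall i0 a c n v i,
    P (past i0 a c n `&` [set w | latch n w = v] `&` [set w | blk n w = i]) =
    (P (past i0 a c n `&` [set w | latch n w = v]) * (p i)%:E)%E }.

Definition hooking_network (n : nat) (w : T) : mgraph :=
  network B (b0 w) (latch ^~ w) (blk ^~ w) n.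

Definition essential (k : nat) : Prop :=
  (0 < k)%N /\
  (0 < P [set w | exists n, (2 <= nb_deg (hooking_network n w) k)%N])%E.

End Model.

Section Normal.
Context {R : realType}.

Definition borel_rV (r : nat) := g_sigma_algebraType (@open 'rV[R]_r).

(* The library's [normal_prob m s] is not a Dirac mass when s = 0. *)
Definition normal0 (s2 : R) (A : set R) : \bar R :=
  if s2 == 0 then \d_(0 : R) A else normal_prob 0 (Num.sqrt s2) A.

Definition covariance_matrix (r : nat) (S : 'M[R]_r) : Prop :=
  S^T = S /\ forall t : 'cV[R]_r, 0 <= (t^T *m S *m t) 0 0.

(* mu is N(0, S): each linear form t is N(0, t^T S t) under mu. *)
Definition is_mvnormal (r : nat) (S : 'M[R]_r)
    (mu : probability (borel_rV r) R) : Prop :=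
  forall (t : 'cV[R]_r) (A : set R), measurable A ->
    mu [set x : 'rV[R]_r | A ((x *m t) 0 0)] =
    normal0 ((t^T *m S *m t) 0 0) A.

Definition cvg_in_distribution (d : measure_display) (T : measurableType d)
    (P : probability T R) (r : nat) (Y : nat -> T -> 'rV[R]_r)
    (mu : probability (borel_rV r) R) : Prop :=
  forall h : 'rV[R]_r -> R, continuous h ->
    (exists M : R, forall x, `|h x| <= M) ->
    (fun n => \int[P]_w h (Y n w)) @ \oo --> \int[mu]_x h x.

End Normal.

(* Main.v *)
Require Import Defs.
From HB Require Import structures.
From mathcomp Require Import all_boot all_order all_algebra.
From mathcomp Require Import all_classical all_reals all_analysis.
From mathcomp Require Import measurable_realfun ring lra.

Set Implicit Arguments.
Unset Strict Implicit.
Unset Printing Implicit Defensive.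

Import Order.TTheory GRing.Theory Num.Theory.
Import numFieldNormedType.Exports.

Local Open Scope classical_set_scope.
Local Open Scope ring_scope.

(** The proof analyses one Markov chain, the growing network, through a
    vector V of centred degree counts, and proves a central limit theorem
    for V by following its characteristic function backwards in time.

    Drift. Let W be the total weight of the network. Hooking a block
    increases W by an amount that depends on the block only and has mean
    lambda1 ([lambda1E]), so W grows like n lambda1. Let N_i be the number
    of vertices of degree k_i. A degree below k_r that is not one of the k_i
    is nonessential and is carried by at most one vertex; hence, up to an
    error O(1/W), the conditional mean of a functional of one step that
    treats all large degrees of the latch alike is an affine function of the
    ratios N_j / W ([kernel_targets]). The recursion for nu says that N = W
    nu is an equilibrium of the mean drift ([nu_balance]), so N - W nu has
    conditional drift A (N - W nu) / W + O(1/n) with A lower triangular and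
    diagonal entries - w_(k_i). Together with W - n lambda1 these deviations
    form the vector V; its increments are bounded and their conditional
    covariance tends to a matrix Q ([V_urn_drift]). Rescaling the
    coordinates by powers of a small eps makes A diagonally dominant by rows
    and by columns ([drift_mx_dominant]).

    Central limit theorem. Dominance gives E |V_n|^2 = O(n) ([mean_sqnorm]).
    Fix s and let u_n = s / sqrt n, u_k = u_(k+1) (1 + A / (lambda1 (k +
    kappa))). A second order expansion shows that one step multiplies E cos
    (u_k V_k + b) by 1 - u Q u^T / 2, up to an error O(|u| / k)
    ([mean_one_step]). This factor is compensated by exp ((k + kappa) u Sig
    u^T / 2), where Sig solves the Lyapunov equation Sig - (A Sig + Sig A^T)
    / lambda1 = Q ([lyapunov_exists], [corrected_step]). The errors add up
    to O(n^(-1/2) sum 1/k), which tends to 0, and V_0 is bounded; therefore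
    E cos (s V_n / sqrt n + b) tends to cos b exp (- s Sig s^T / 2)
    ([clt_cos_exists]).

    Weak convergence. Convergence of trigonometric means and tightness imply
    convergence for bounded continuous functions, by Bernstein polynomials
    in sin (x_i / L) ([trig_weak_limit]). The limit is the law of a linear
    image of independent standard normals, whose linear forms are identified
    by their characteristic functions ([mvnormal_exists]). The counts of the
    theorem are a linear image of V, because N - n lambda1 nu = (N - W nu) +
    (W - n lambda1) nu.

    Expectations enter the central limit theorem only as positive linear
    functionals: the law of the n-th network is an iterate of the hooking
    kernel ([net_meanE]). *)

(** * Means as positive linear functionals *)

Section Mean.
Context {R : realType} {X : Type}.

(** Expectations and transition kernels alike. The set D carries the law:
    monotonicity may use membership in D, which takes the place of almost
    sure statements. *)
Record is_mean (D : X -> Prop) (E : (X -> R) -> R) : Prop := IsMean {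
  meanD : forall f g, E (fun x => f x + g x) = E f + E g;
  meanZ : forall a f, E (fun x => a * f x) = a * E f;
  mean1 : E (fun=> 1) = 1;
  mean_le : forall f g, (forall x, D x -> f x <= g x) -> E f <= E g }.

Variables (D : X -> Prop) (E : (X -> R) -> R).
Hypothesis HE : is_mean D E.

Lemma mean_eq f g : (forall x, D x -> f x = g x) -> E f = E g.
Proof.
by move=> fg; apply/le_anti/andP; split; apply: (mean_le HE) => x /fg ->.
Qed.

Lemma mean_cst a : E (fun=> a) = a.
Proof.
rewrite (@mean_eq _ (fun x => a * (fun=> 1) x)); last by move=> x _; rewrite mulr1.
by rewrite (meanZ HE) (mean1 HE) mulr1.
Qed.

Lemma meanN f : E (fun x => - f x) = - E f.
Proof.
rewrite (@mean_eq _ (fun x => -1 * f x)); last by move=> x _; rewrite mulN1r.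
by rewrite (meanZ HE) mulN1r.
Qed.

Lemma meanB f g : E (fun x => f x - g x) = E f - E g.
Proof. by rewrite (meanD HE) meanN. Qed.

Lemma mean_sum I (r : seq I) (F : I -> X -> R) :
  E (fun x => \sum_(i <- r) F i x) = \sum_(i <- r) E (F i).
Proof.
elim: r => [|i r IH].
  rewrite big_nil -[RHS](mean_cst 0); apply: mean_eq => x _.
  by rewrite big_nil.
rewrite big_cons -IH -(meanD HE); apply: mean_eq => x _.
by rewrite big_cons.
Qed.

Lemma mean_norm f : `|E f| <= E (fun x => `|f x|).
Proof.
rewrite ler_norml -meanN; apply/andP; split; apply: (mean_le HE) => x _.
  by rewrite lerNl -normrN ler_norm.
exact: ler_norm.
Qed.

Lemma mean_dist f g h : (forall x, D x -> `|f x - g x| <= h x) ->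
  `|E f - E g| <= E h.
Proof.
move=> fgh; rewrite -meanB; apply: le_trans (mean_norm _) _.
exact: (mean_le HE).
Qed.

Lemma mean_ub f a : (forall x, D x -> f x <= a) -> E f <= a.
Proof. by move=> fa; rewrite -(mean_cst a); apply: (mean_le HE). Qed.

Lemma mean_norm_ub f a : (forall x, D x -> `|f x| <= a) -> `|E f| <= a.
Proof.
by move=> fa; apply: le_trans (mean_norm _) _; apply: mean_ub.
Qed.

End Mean.

(** * Taylor bounds for the cosine and the exponential *)

Section Taylor.
Context {R : realType}.
Implicit Types x d z : R.

Lemma derive_ge0_ge0 (f g : R -> R) x :
  (forall y : R, is_derive y 1 f (g y)) -> f 0 = 0 ->
  (forall y, 0 <= y -> 0 <= g y) -> 0 <= x -> 0 <= f x.
Proof.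
move=> df f0 g0; rewrite le_eqVlt => /predU1P[<-|x0]; first by rewrite f0.
have [|y /itvP yx fE] := @MVT _ f g 0 x x0 (fun y _ => df y).
  apply: derivable_within_continuous => y _.
  exact: (@ex_derive _ _ _ _ _ _ _ (df y)).
by move: fE; rewrite f0 !subr0 => ->; rewrite mulr_ge0 ?g0 ?yx ?ltW.
Qed.

(** Each of the next four bounds follows from the previous one, which is the
    inequality between the derivatives. *)
Lemma sin_le x : 0 <= x -> sin x <= x.
Proof.
move=> x0; rewrite -subr_ge0.
apply: (@derive_ge0_ge0 (fun y => y - sin y) (fun y => 1 - cos y) x _ _ _ x0).
- by rewrite sin0 subr0.
- by move=> y _; rewrite subr_ge0 cos_le1.
Qed.

Lemma cos_ge x : 0 <= x -> 1 - x ^+ 2 / 2 <= cos x.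
Proof.
move=> x0; rewrite -subr_ge0.
apply: (@derive_ge0_ge0 (fun y => cos y - (1 - y ^+ 2 / 2))
  (fun y => y - sin y) x _ _ _ x0).
- move=> y; apply: is_derive_eq; rewrite /GRing.scale/=; by field.
- by rewrite cos0 expr0n/=; ring.
- by move=> y y0; rewrite subr_ge0 sin_le.
Qed.

Lemma sin_ge x : 0 <= x -> x - x ^+ 3 / 6 <= sin x.
Proof.
move=> x0; rewrite -subr_ge0.
apply: (@derive_ge0_ge0 (fun y => sin y - (y - y ^+ 3 / 6))
  (fun y => cos y - (1 - y ^+ 2 / 2)) x _ _ _ x0).
- move=> y; apply: is_derive_eq; rewrite /GRing.scale/=; by field.
- by rewrite sin0 expr0n/=; ring.
- by move=> y y0; rewrite subr_ge0 cos_ge.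
Qed.

Lemma cos_le x : 0 <= x -> cos x <= 1 - x ^+ 2 / 2 + x ^+ 4 / 24.
Proof.
move=> x0; rewrite -subr_ge0.
apply: (@derive_ge0_ge0 (fun y => 1 - y ^+ 2 / 2 + y ^+ 4 / 24 - cos y)
  (fun y => sin y - (y - y ^+ 3 / 6)) x _ _ _ x0).
- move=> y; apply: is_derive_eq; rewrite /GRing.scale/=; by field.
- by rewrite cos0 expr0n/= expr0n/=; ring.
- by move=> y y0; rewrite subr_ge0 sin_ge.
Qed.

Lemma sin_taylor d : `|sin d - d| <= `|d| ^+ 3 / 2.
Proof.
wlog d0 : d / 0 <= d.
  move=> H; have [|d0] := leP 0 d; first exact: H.
  have /H : 0 <= - d by rewrite oppr_ge0 ltW.
  by rewrite sinN -opprD !normrN.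
have := sin_le d0; have := sin_ge d0; rewrite (ger0_norm d0) ler_norml.
have : 0 <= d ^+ 3 by rewrite exprn_ge0.
by move=> *; apply/andP; split; lra.
Qed.

Lemma cos_taylor d : `|cos d - (1 - d ^+ 2 / 2)| <= `|d| ^+ 3 / 2.
Proof.
wlog d0 : d / 0 <= d.
  move=> H; have [|d0] := leP 0 d; first exact: H.
  have /H : 0 <= - d by rewrite oppr_ge0 ltW.
  by rewrite cosN sqrrN normrN.
have c1 := cos_ge d0; have c2 := cos_le d0; have c3 := cos_le1 d.
rewrite (ger0_norm d0) ger0_norm; last lra.
have [d1|d1] := leP d 1.
  have : d ^+ 4 <= d ^+ 3 by rewrite exprS ler_piMl// exprn_ge0.
  have : 0 <= d ^+ 3 by rewrite exprn_ge0.
  by move=> *; lra.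
have : d ^+ 2 <= d ^+ 3 by rewrite [leRHS]exprS ler_peMl ?exprn_ge0// ltW.
by move=> *; lra.
Qed.

Lemma cosD_taylor x d :
  `|cos (x + d) - (cos x - d * sin x - d ^+ 2 / 2 * cos x)| <= `|d| ^+ 3.
Proof.
have -> : cos (x + d) - (cos x - d * sin x - d ^+ 2 / 2 * cos x) =
  cos x * (cos d - (1 - d ^+ 2 / 2)) - sin x * (sin d - d).
  by rewrite cosD; ring.
apply: le_trans (ler_normB _ _) _; rewrite !normrM.
have -> : `|d| ^+ 3 = `|d| ^+ 3 / 2 + `|d| ^+ 3 / 2 by field.
apply: lerD.
  by rewrite -[leRHS]mul1r ler_pM// ?cos_max// cos_taylor.
by rewrite -[leRHS]mul1r ler_pM// ?sin_max// sin_taylor.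
Qed.

Lemma cos_lip x y : `|cos x - cos y| <= `|x - y|.
Proof.
wlog yx : x y / y <= x.
  move=> H; have [|xy] := leP y x; first exact: H.
  by rewrite distrC (distrC x); apply/H/ltW.
move: yx; rewrite le_eqVlt => /predU1P[->|yx]; first by rewrite !subrr.
have [|z _ ->] := @MVT _ cos (fun z => - sin z) y x yx (fun z _ => is_derive_cos z).
  apply: derivable_within_continuous => z _; exact: derivable_cos.
by rewrite normrM ler_piMl// normrN sin_max.
Qed.

Lemma expR_taylor z : `|z| <= 1 / 2 -> `|expR z - (1 + z)| <= 2 * z ^+ 2.
Proof.
rewrite ler_norml => /andP[z1 z2].
rewrite ger0_norm ?subr_ge0 ?expR_ge1Dx//.
have e1 : expR z * (1 - z) <= 1.
  rewrite -[leRHS](expRxMexpNx_1 z) ler_pM2l ?expR_gt0//.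
  exact: expR_ge1Dx.
have z0 : 0 < 1 - z by lra.
have : expR z <= (1 - z)^-1 by rewrite -[leRHS]mul1r ler_pdivlMr.
move=> /le_trans h; rewrite lerBlDr; apply: h.
rewrite -[leLHS]mul1r ler_pdivrMr//.
have := sqr_ge0 z; nra.
Qed.

End Taylor.

(** * Diagonally dominant matrices *)

Section EntrySum.
Context {R : realType} {m n : nat}.
Implicit Types (M : 'M[R]_(m, n)) (u : 'rV[R]_m) (v : 'cV[R]_n).

Definition sum_norm M : R := \sum_i \sum_j `|M i j|.

Lemma sum_norm_ge0 M : 0 <= sum_norm M.
Proof. by apply: sumr_ge0 => i _; apply: sumr_ge0 => j _. Qed.

Lemma bilinearE u M v : (u *m M *m v) 0 0 = \sum_i \sum_j u 0 i * M i j * v j 0.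
Proof.
rewrite mxE exchange_big/=; apply: eq_bigr => j _.
by rewrite mxE mulr_suml.
Qed.

Lemma bilinear_norm u M v a b : (forall i, `|u 0 i| <= a) ->
  (forall i, `|v i 0| <= b) -> `|(u *m M *m v) 0 0| <= a * b * sum_norm M.
Proof.
move=> ua vb; rewrite bilinearE mulr_sumr.
apply: le_trans (ler_norm_sum _ _ _) _; apply: ler_sum => i _.
rewrite mulr_sumr; apply: le_trans (ler_norm_sum _ _ _) _.
apply: ler_sum => j _; rewrite !normrM mulrAC.
by apply: ler_wpM2r => //; apply: ler_pM.
Qed.

End EntrySum.

Section Dominant.
Context {R : realType} {q : nat}.
Implicit Types (A M : 'M[R]_q) (u : 'rV[R]_q) (v : 'cV[R]_q).

(** Dominance by columns makes u -> u (1 + A / c) a contraction for the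
    largest entry, dominance by rows gives uniqueness in the Lyapunov
    equation, and both together make A negative semidefinite. *)
Definition dominant A : Prop :=
  (forall i, \sum_(j | j != i) `|A i j| <= - A i i) /\
  (forall j, \sum_(i | i != j) `|A i j| <= - A j j).

(** By 2 |x y| <= x^2 + y^2, the off-diagonal terms of row i and of column i
    each cost at most half of - A i i v_i^2. *)
Lemma dominant_le0 A v : dominant A -> \sum_i v i 0 * (A *m v) i 0 <= 0.
Proof.
move=> [dr dc].
have -> : \sum_i v i 0 * (A *m v) i 0 =
    \sum_i A i i * v i 0 ^+ 2 +
    \sum_i \sum_(j | j != i) A i j * (v i 0 * v j 0).
  rewrite -big_split/=; apply: eq_bigr => i _.
  rewrite mxE mulr_sumr (bigD1 i)//=; congr (_ + _); first by rewrite expr2; ring.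
  by apply: eq_bigr => j _; ring.
have H : \sum_i \sum_(j | j != i) A i j * (v i 0 * v j 0) <=
    \sum_i \sum_(j | j != i) (`|A i j| * (v i 0 ^+ 2 / 2) + `|A i j| * (v j 0 ^+ 2 / 2)).
  apply: ler_sum => i _; apply: ler_sum => j _.
  rewrite -mulrDr; apply: le_trans (ler_norm _) _; rewrite normrM.
  apply: ler_wpM2l => //; rewrite ler_norml.
  have := sqr_ge0 (v i 0 - v j 0); have := sqr_ge0 (v i 0 + v j 0).
  by rewrite sqrrD sqrrB => h1 h2; apply/andP; split; lra.
apply: le_trans (lerD (lexx _) H) _.
under [X in _ + X]eq_bigr do rewrite big_split/=.
rewrite big_split/= [X in _ + (_ + X)](exchange_big_dep predT)//=.
rewrite -!big_split/=; apply: sumr_le0 => i _.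
rewrite -!mulr_suml.
have := dr i; have := dc i; have := sqr_ge0 (v i 0).
under [X in _ + (_ + X * _)]eq_bigl do rewrite eq_sym.
set a := \sum_(j | j != i) _; set b := \sum_(j | j != i) _ => h0 h1 h2.
nra.
Qed.

(** As 1 + A j j / c >= 0, the new entry j is a combination of the entries
    of u whose coefficients have absolute values adding up to at most 1. *)
Lemma dominant_transport A u t c : dominant A -> 0 < c ->
  (forall j, - A j j <= c) -> (forall i, `|u 0 i| <= t) ->
  forall j, `|(u + c^-1 *: (u *m A)) 0 j| <= t.
Proof.
move=> [_ dc] c0 Ac ut j.
rewrite !mxE (bigD1 j)//= mulrDr addrA.
have -> : u 0 j + c^-1 * (u 0 j * A j j) = u 0 j * (1 + A j j / c) by ring.
have p0 : 0 <= 1 + A j j / c.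
  by rewrite -(@ler_pM2r _ c)// mul0r mulrDl divfK ?gt_eqF// mul1r; have := Ac j; lra.
have t0 : 0 <= t by apply: le_trans (ut j).
apply: le_trans (ler_normD _ _) _.
have h1 : `|u 0 j * (1 + A j j / c)| <= t * (1 + A j j / c).
  by rewrite normrM (ger0_norm p0) ler_wpM2r.
have h2 : `|c^-1 * \sum_(i | i != j) u 0 i * A i j| <= c^-1 * (t * - A j j).
  rewrite normrM gtr0_norm ?invr_gt0// ler_pM2l ?invr_gt0//.
  apply: le_trans (ler_norm_sum _ _ _) _.
  apply: (@le_trans _ _ (\sum_(i | i != j) t * `|A i j|)).
    by apply: ler_sum => i _; rewrite normrM ler_wpM2r.
  by rewrite -mulr_sumr ler_wpM2l.
apply: le_trans (lerD h1 h2) _.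
rewrite le_eqVlt; apply/orP; left; apply/eqP; ring.
Qed.

Lemma bigmax_ord_exists (T : finType) (F : T -> R) (x0 : T) :
  exists x, forall y, F y <= F x.
Proof.
exists [arg max_(x > x0) F x]%O.
by case: arg_maxP => //= x _ h y; apply: h.
Qed.

(** Maximum principle: at an entry (i, j) of largest modulus the
    off-diagonal terms are at most - A i i - A j j times that modulus, and
    the identity leaves an excess lam. *)
Lemma lyapunov_inj A lam M : dominant A -> 0 < lam ->
  M - lam^-1 *: (A *m M + M *m A^T) = 0 -> M = 0.
Proof.
move=> [dr _] l0 M0; apply/matrixP => a b; rewrite mxE.
have [[i j] maxM] := bigmax_ord_exists (fun p => `|M p.1 p.2|) (a, b).
rewrite /= in maxM.
suff Mij : `|M i j| <= 0.
  have := maxM (a, b) => /= h; apply/eqP; rewrite -normr_le0.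
  exact: le_trans h Mij.
set m := `|M i j|.
have := congr1 (fun N : 'M[R]_q => N i j) M0; rewrite !mxE.
rewrite (bigD1 i)//= [X in _ + _ + X](bigD1 j)//= !mxE.
set s1 := \sum_(l | l != i) _; set s2 := \sum_(l | l != j) _ => E0.
have b1 : `|s1| <= m * - A i i.
  apply: le_trans (ler_norm_sum _ _ _) _.
  apply: (@le_trans _ _ (\sum_(l | l != i) m * `|A i l|)).
    apply: ler_sum => l _; rewrite normrM mulrC ler_wpM2r//.
    exact: (maxM (l, j)).
  by rewrite -mulr_sumr ler_wpM2l// normr_ge0.
have b2 : `|s2| <= m * - A j j.
  apply: le_trans (ler_norm_sum _ _ _) _.
  apply: (@le_trans _ _ (\sum_(l | l != j) m * `|A j l|)).
    apply: ler_sum => l _; rewrite normrM mxE ler_wpM2r//.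
    exact: (maxM (i, l)).
  by rewrite -mulr_sumr ler_wpM2l// normr_ge0.
have E1 : M i j * (lam - A i i - A j j) = s1 + s2.
  have : lam * (M i j + - (lam^-1 * (A i i * M i j + s1 + (M i j * A j j + s2)))) = 0.
    by rewrite E0 mulr0.
  rewrite mulrDr mulrN mulVKf ?gt_eqF// => h; lra.
have ai : 0 <= - A i i by apply: le_trans (dr i); apply: sumr_ge0.
have aj : 0 <= - A j j by apply: le_trans (dr j); apply: sumr_ge0.
have : m * (lam - A i i - A j j) <= m * - A i i + m * - A j j.
  have p : 0 <= lam - A i i - A j j by lra.
  rewrite -(ger0_norm p) -normrM E1.
  by apply: le_trans (ler_normD _ _) _; apply: lerD.
move=> h; rewrite -(@pmulr_lle0 _ lam)//; lra.
Qed.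

(** The Lyapunov operator is an injective endomorphism of a space of finite
    dimension, hence onto. It commutes with transposition, so injectivity
    also makes the solution symmetric. *)
Lemma lyapunov_exists A lam (Q : 'M[R]_q) : dominant A -> 0 < lam -> Q^T = Q ->
  exists2 M : 'M[R]_q, M^T = M & M - lam^-1 *: (A *m M + M *m A^T) = Q.
Proof.
move=> dA l0 QT.
pose f (M : 'M[R]_q) := M - lam^-1 *: (A *m M + M *m A^T).
have lf : linear f.
  move=> a M N; rewrite /f !mulmxDr !mulmxDl -!scalemxAr -!scalemxAl.
  apply/matrixP => i j; rewrite !mxE; ring.
pose fl : {linear 'M[R]_q -> 'M[R]_q} :=
  HB.pack f (GRing.isLinear.Build _ _ _ _ f lf).
have fE M : fl M = f M by [].
have kf : kermx (lin_mx fl) = 0.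
  apply/row_matrixP => i; rewrite row0.
  have : row i (kermx (lin_mx fl)) *m lin_mx fl = 0.
    by apply/sub_kermxP; exact: row_sub.
  rewrite -[row i _]vec_mxK mul_vec_lin => /(canRL mxvecK).
  by rewrite linear0 fE => /(lyapunov_inj dA l0) ->; rewrite linear0.
have uf : lin_mx fl \in unitmx by rewrite -row_free_unit -kermx_eq0 kf.
pose M := vec_mx (mxvec Q *m invmx (lin_mx fl)).
have fM : f M = Q.
  have : mxvec M *m lin_mx fl = mxvec Q by rewrite vec_mxK mulmxKV.
  by rewrite mul_vec_lin => /(can_inj mxvecK).
exists M => //; apply/eqP; rewrite -subr_eq0; apply/eqP.
apply: (lyapunov_inj dA l0).
have fMT : f M^T = Q.
  have tr N : (f N)^T = N^T - lam^-1 *: (N^T *m A^T + A *m N^T).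
    by rewrite /f raddfB/= linearZ/= raddfD/= !trmx_mul trmxK.
  by rewrite -QT -fM tr /f [in RHS](addrC (M^T *m _)).
by have := linearB fl M^T M; rewrite !fE fMT fM subrr.
Qed.

End Dominant.

(** * Harmonic sums *)

Section Harmonic.
Context {R : realType}.

(** Any bound o(sqrt n) serves below. The increment of the fourth root from
    n to n + 1 is at least 1 / (4 (n + 1)^(3/4)). *)
Lemma harmonic_le_root4 n :
  \sum_(k < n) (k.+1%:R : R)^-1 <= 4 * Num.sqrt (Num.sqrt n%:R).
Proof.
elim: n => [|n IH]; first by rewrite big_ord0 !sqrtr0 mulr0.
rewrite big_ord_recr/=; apply: le_trans (lerD IH (lexx _)) _.
set s := Num.sqrt (Num.sqrt n%:R); set r := Num.sqrt (Num.sqrt n.+1%:R).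
have s0 : 0 <= s by exact: sqrtr_ge0.
have r4 : r ^+ 4 = n.+1%:R :> R.
  by rewrite (exprM r 2 2) !sqr_sqrtr.
have s4 : s ^+ 4 = n%:R :> R by rewrite (exprM s 2 2) !sqr_sqrtr.
have sr : s <= r by rewrite !ler_wsqrtr// ler_nat.
have r1 : 1 <= r.
  by rewrite -[leLHS]sqrtr1 -[in leLHS](@sqrtr1 R) !ler_wsqrtr// ler1n.
have rp : 0 < r by rewrite (lt_le_trans ltr01).
rewrite -r4 -lerBrDl -mulrBr.
rewrite -[leLHS]mul1r ler_pdivrMr ?exprn_gt0//.
have e1 : r ^+ 4 - s ^+ 4 = 1 by rewrite r4 s4 mulrSr; ring.
have : r ^+ 4 - s ^+ 4 <= 4 * (r - s) * r ^+ 3.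
  rewrite (_ : r ^+ 4 - s ^+ 4 = (r - s) * (r ^+ 3 + r ^+ 2 * s + r * s ^+ 2 + s ^+ 3)); last by ring.
  have -> : 4 * (r - s) * r ^+ 3 = (r - s) * (4 * r ^+ 3) by ring.
  rewrite ler_wpM2l ?subr_ge0//.
  have h1 : r ^+ 2 * s <= r ^+ 3.
    by rewrite [leRHS]exprSr ler_wpM2l ?exprn_ge0 ?(ltW rp).
  have h2 : r * s ^+ 2 <= r ^+ 3.
    by rewrite [leRHS]exprS ler_wpM2l ?(ltW rp)// lerXn2r ?nnegrE ?(ltW rp).
  have h3 : s ^+ 3 <= r ^+ 3 by rewrite lerXn2r ?nnegrE ?(ltW rp).
  lra.
rewrite e1 => h; apply: le_trans h _.
by rewrite ler_wpM2l ?mulr_ge0 ?subr_ge0// ler_weXn2l.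
Qed.

Lemma cvg_invsqrt : (fun n => (Num.sqrt n%:R)^-1 : R) @ \oo --> (0 : R).
Proof.
rewrite gtr0_cvgV0; last by near=> n; rewrite sqrtr_gt0 ltr0n; near: n; exact: nbhs_infty_gt.
apply/cvgryPge => M; near=> n.
apply: (@le_trans _ _ (Num.sqrt (M ^+ 2))); first by rewrite sqrtr_sqr ler_norm.
rewrite ler_wsqrtr//; near: n; exact: nbhs_infty_ger.
Unshelve. all: by end_near.
Qed.

Lemma cvg_harmonic_sqrt :
  (fun n => (Num.sqrt n%:R)^-1 * \sum_(k < n) (k.+1%:R : R)^-1) @ \oo --> (0 : R).
Proof.
have sc : Num.sqrt x @[x --> (0:R)] --> (0:R).
  by rewrite -[X in _ --> X](@sqrtr0 R); exact: sqrt_continuous.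
have c1 : (fun n => 4 * Num.sqrt ((Num.sqrt n%:R)^-1) : R) @ \oo --> (0 : R).
  rewrite -[X in _ --> X](mulr0 4); apply: cvgM; first exact: cvg_cst.
  exact: (cvg_comp _ _ cvg_invsqrt sc).
apply: (squeeze_cvgr _ (cvg_cst 0) c1); near=> n.
have n0 : 0 < Num.sqrt n%:R :> R.
  by rewrite sqrtr_gt0 ltr0n; near: n; exact: nbhs_infty_gt.
apply/andP; split; first by rewrite mulr_ge0// ?invr_ge0 ?(ltW n0)// sumr_ge0.
apply: le_trans (ler_wpM2l _ (harmonic_le_root4 n)) _; first by rewrite invr_ge0 ltW.
rewrite mulrCA ler_wpM2l// sqrtrV ?(ltW n0)//.
set s := Num.sqrt (Num.sqrt n%:R).
have s0 : 0 < s by rewrite sqrtr_gt0.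
rewrite -[X in X^-1 * _](sqr_sqrtr (ltW n0)) -/s.
by rewrite expr2 invfM -mulrA mulVf ?gt_eqF// mulr1.
Unshelve. all: by end_near.
Qed.

End Harmonic.

(** * A central limit theorem for chains with linear drift *)

Lemma sum_cst (R : realType) n (c : R) : \sum_(i < n) c = n%:R * c.
Proof. by rewrite sumr_const card_ord -[LHS]mulr_natl. Qed.

Section Chain.
Context {R : realType} {X : Type} {q : nat}.
Variables (Rch : nat -> X -> Prop) (tr : X -> X -> Prop).
Variables (E : nat -> (X -> R) -> R) (K : X -> (X -> R) -> R).
Variables (V : nat -> X -> 'cV[R]_q) (S : X -> R) (A Q : 'M[R]_q) (lam C : R).

(** E k is the law at time k and K x the transition kernel from the state x;
    they are carried by Rch k and by tr x. *)
Record markov_chain : Prop := MarkovChain {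
  ch_mean : forall k, is_mean (Rch k) (E k);
  ch_kernel : forall k x, Rch k x -> is_mean (tr x) (K x);
  ch_step : forall k F, E k.+1 F = E k (fun x => K x F) }.

Definition l1 k x : R := \sum_i `|V k x i 0|.

(** S is a total weight that grows like lam k, and the increments of V are
    those of an urn: bounded, with conditional mean A V / S and conditional
    covariance Q, up to errors that vanish like 1 / k. A single constant C
    bounds all errors. *)
Record urn_drift : Prop := UrnDrift {
  ud_C : 0 <= C;
  ud_lam : 0 < lam;
  ud_dominant : dominant A;
  ud_sym : Q^T = Q;
  ud_bound : forall k x i, Rch k x -> `|V k x i 0| <= C * k.+1%:R;
  ud_incr : forall k x y i, Rch k x -> tr x y ->
    `|V k.+1 y i 0 - V k x i 0| <= C;
  ud_drift : forall k x i, Rch k x ->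
    `|K x (fun y => V k.+1 y i 0 - V k x i 0) - (A *m V k x) i 0 / S x|
      <= C / k.+1%:R;
  ud_cov : forall k x i j, Rch k x ->
    `|K x (fun y => (V k.+1 y i 0 - V k x i 0) * (V k.+1 y j 0 - V k x j 0))
      - Q i j| <= C * (1 + l1 k x) / k.+1%:R;
  ud_total_ge : forall k x, Rch k x -> k.+1%:R <= C * S x;
  ud_total : forall k x, Rch k x ->
    `|S x - lam * k%:R| <= C * (1 + l1 k x) }.

Hypotheses (hch : markov_chain) (hud : urn_drift).

Let C0 : 0 <= C. Proof. by case: hud. Qed.
Let lam0 : 0 < lam. Proof. by case: hud. Qed.
Let z0 k : 0 < k.+1%:R :> R. Proof. by rewrite ltr0n. Qed.
Let z1 k : 1 <= k.+1%:R :> R. Proof. by rewrite ler1n. Qed.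

Lemma l1_ge0 k x : 0 <= l1 k x. Proof. exact: sumr_ge0. Qed.

Lemma l1_le k x : Rch k x -> l1 k x <= q%:R * C * k.+1%:R.
Proof.
move=> rx; rewrite /l1.
apply: (@le_trans _ _ (\sum_(i < q) C * k.+1%:R)).
  by apply: ler_sum => i _; apply: (ud_bound hud).
by rewrite sum_cst mulrA.
Qed.

Lemma total_gt0 k x : Rch k x -> 0 < S x.
Proof.
move=> rx; have h := lt_le_trans (z0 k) (ud_total_ge hud rx).
by rewrite ltNge; apply/negP => /(mulr_ge0_le0 C0); rewrite leNgt h.
Qed.

Lemma total_inv k x : Rch k x -> (S x)^-1 <= C / k.+1%:R.
Proof.
move=> rx; rewrite ler_pdivlMr// mulrC ler_pdivrMr ?(total_gt0 rx)//.
exact: ud_total_ge.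
Qed.

Definition sqnorm k x : R := \sum_i V k x i 0 ^+ 2.

Lemma l1_sqnorm k x : l1 k x ^+ 2 <= q%:R * sqnorm k x.
Proof.
rewrite expr2 {1}/l1 mulr_suml.
apply: (@le_trans _ _
  (\sum_i \sum_j (V k x i 0 ^+ 2 / 2 + V k x j 0 ^+ 2 / 2))).
  apply: ler_sum => i _; rewrite mulr_sumr; apply: ler_sum => j _.
  rewrite -(real_normK (num_real (V k x i 0))) -(real_normK (num_real (V k x j 0))).
  have := sqr_ge0 (`|V k x i 0| - `|V k x j 0|); rewrite sqrrB; lra.
under eq_bigr do rewrite big_split/= sum_cst.
rewrite big_split/= sum_cst -mulr_sumr -!mulr_suml -/(sqnorm k x); lra.
Qed.

(** The main term 2 V . (A V) / S of the drift is nonpositive by dominance;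
    the O(1 / k) error of the drift is multiplied by V = O(k). *)
Lemma kernel_sqnorm k x : Rch k x ->
  K x (fun y => sqnorm k.+1 y) <= sqnorm k x + 3 * q%:R * C ^+ 2.
Proof.
move=> rx; have hK := ch_kernel hch rx.
pose d i y := V k.+1 y i 0 - V k x i 0.
rewrite (mean_eq hK (g := fun y => \sum_i (V k x i 0 ^+ 2 +
  (2 * V k x i 0 * d i y + d i y * d i y)))); last first.
  by move=> y _; apply: eq_bigr => i _; rewrite /d; ring.
rewrite (mean_sum hK).
have H i : K x (fun y => V k x i 0 ^+ 2 + (2 * V k x i 0 * d i y + d i y * d i y))
   <= V k x i 0 ^+ 2 + (2 * (V k x i 0 * (A *m V k x) i 0) / S x + 3 * C ^+ 2).
  rewrite (meanD hK) (mean_cst hK) lerD2l (meanD hK) (meanZ hK).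
  have h1 : K x (fun y => d i y * d i y) <= C ^+ 2.
    apply: (mean_ub hK) => y xy; rewrite -expr2 -(real_normK (num_real (d i y))).
    by rewrite lerXn2r ?nnegrE//; apply: (ud_incr hud).
  have h2 := ud_drift hud i rx; rewrite -/(d i) in h2.
  set a := K x (d i) in h2 *; set b := (A *m V k x) i 0 / S x in h2.
  have h3 : `|V k x i 0 * (a - b)| <= C ^+ 2.
    rewrite normrM; apply: (@le_trans _ _ ((C * k.+1%:R) * (C / k.+1%:R))).
      by apply: ler_pM => //; apply: (ud_bound hud).
    by rewrite mulrACA divff ?gt_eqF// mulr1 expr2.
  have := ler_norm (V k x i 0 * (a - b)).
  rewrite -mulrA -[_ * _ / S x]mulrA -[V k x i 0 * _ / S x]mulrA -/b => h4; lra.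
apply: (le_trans (ler_sum _ (fun i _ => H i))).
rewrite !big_split/= -/(sqnorm k x) lerD2l.
rewrite -mulr_suml -mulr_sumr sum_cst.
have := dominant_le0 (V k x) (ud_dominant hud).
set s := \sum_i _ => s0.
have : 2 * s / S x <= 0.
  by rewrite pmulr_lle0 ?invr_gt0 ?(total_gt0 rx)// pmulr_rle0.
by move=> h; lra.
Qed.

Lemma mean_sqnorm k : E k (fun x => sqnorm k x) <= 3 * q%:R * C ^+ 2 * k.+1%:R.
Proof.
elim: k => [|k IH].
  apply: (mean_ub (ch_mean hch 0)) => x rx; rewrite mulr1.
  apply: (@le_trans _ _ (\sum_(i < q) C ^+ 2)).
    apply: ler_sum => i _; rewrite -(real_normK (num_real _)).
    rewrite lerXn2r ?nnegrE//.
    by apply: le_trans (ud_bound hud i rx) _; rewrite mulr1.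
  rewrite sum_cst.
  have : 0 <= q%:R * C ^+ 2 by rewrite mulr_ge0// sqr_ge0.
  by lra.
rewrite (ch_step hch).
apply: (@le_trans _ _ (E k (fun x => sqnorm k x + 3 * q%:R * C ^+ 2))).
  by apply: (mean_le (ch_mean hch k)) => x rx; exact: kernel_sqnorm.
rewrite (meanD (ch_mean hch k)) (mean_cst (ch_mean hch k)).
have -> : k.+2%:R = k.+1%:R + 1 :> R by rewrite mulrSr.
by rewrite mulrDr mulr1 lerD2r.
Qed.

Definition moment_const : R := q%:R * (3 * q%:R * C ^+ 2).

Lemma moment_const_ge0 : 0 <= moment_const.
Proof. by rewrite /moment_const !mulr_ge0// sqr_ge0. Qed.

Lemma mean_l1sq k : E k (fun x => l1 k x ^+ 2) <= moment_const * k.+1%:R.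
Proof.
apply: (@le_trans _ _ (E k (fun x => q%:R * sqnorm k x))).
  by apply: (mean_le (ch_mean hch k)) => x _; exact: l1_sqnorm.
by rewrite (meanZ (ch_mean hch k)) /moment_const -[leRHS]mulrA ler_wpM2l// mean_sqnorm.
Qed.

(** The linearised total weight is lam (k + kappa). The shift makes - A j j
    <= clock k already for k = 0, as [dominant_transport] requires. *)
Definition kappa : R := 1 + (\sum_j - A j j) / lam.
Definition clock (k : nat) : R := lam * (k%:R + kappa).

Lemma diag_le0 j : 0 <= - A j j.
Proof. by apply: le_trans ((ud_dominant hud).1 j); exact: sumr_ge0. Qed.

Lemma kappa_ge1 : 1 <= kappa.
Proof.
by rewrite /kappa lerDl divr_ge0 ?(ltW lam0)// sumr_ge0// => j _; exact: diag_le0.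
Qed.

Lemma clock_ge k : lam * k.+1%:R <= clock k.
Proof. by rewrite ler_pM2l// mulrSr lerD2l kappa_ge1. Qed.

Lemma clock_gt0 k : 0 < clock k.
Proof. by apply: lt_le_trans (clock_ge k); rewrite mulr_gt0. Qed.

Lemma clock_inv k : (clock k)^-1 <= (lam * k.+1%:R)^-1.
Proof. by rewrite lef_pV2 ?posrE ?clock_gt0 ?mulr_gt0// clock_ge. Qed.

Lemma clock_diag k j : - A j j <= clock k.
Proof.
apply: (@le_trans _ _ (lam * (\sum_j - A j j) / lam)).
  rewrite mulrAC divff ?gt_eqF// mul1r (bigD1 j)//= lerDl.
  by apply: sumr_ge0 => i _; exact: diag_le0.
rewrite -mulrA ler_pM2l// /kappa; have := ler0n R k; lra.
Qed.

(** The transpose of the linearised drift: in mean and to first order, u . V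
    at time k + 1 is back k u . V at time k. *)
Definition back k (u : 'rV[R]_q) : 'rV[R]_q := u + (clock k)^-1 *: (u *m A).
Definition obs (u : 'rV[R]_q) k x : R := (u *m V k x) 0 0.
Definition quad (M : 'M[R]_q) (u : 'rV[R]_q) : R := (u *m M *m u^T) 0 0.

Lemma back_le k (u : 'rV[R]_q) t : (forall i, `|u 0 i| <= t) -> forall i, `|back k u 0 i| <= t.
Proof.
apply: dominant_transport; [exact: ud_dominant|exact: clock_gt0|exact: clock_diag].
Qed.

Lemma l1_dot (u : 'rV[R]_q) t (F : 'I_q -> R) b : (forall i, `|u 0 i| <= t) ->
  0 <= b -> (forall i, `|F i| <= b) -> `|\sum_i u 0 i * F i| <= t * (q%:R * b).
Proof.
move=> ut b0 Fb; apply: le_trans (ler_norm_sum _ _ _) _.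
apply: (@le_trans _ _ (\sum_(i < q) t * b)).
  by apply: ler_sum => i _; rewrite normrM ler_pM.
by rewrite sum_cst mulrCA.
Qed.

Lemma V_l1 k x i : `|V k x i 0| <= l1 k x.
Proof. by rewrite /l1 (bigD1 i)//= lerDl sumr_ge0. Qed.

Lemma uAV_le (u : 'rV[R]_q) t k x : (forall i, `|u 0 i| <= t) ->
  `|(u *m A *m V k x) 0 0| <= t * (l1 k x * sum_norm A).
Proof. by move=> ut; rewrite mulrA; apply: bilinear_norm => // i; exact: V_l1. Qed.

Let a1 := sum_norm A.
(** Constants of the expansion of one step: [cdelta] bounds the compensated
    increment, [cdrift1] belongs to its conditional mean and [cvar] to its
    conditional variance. *)
Definition cdelta : R := q%:R * C + a1 * (q%:R * C) / lam.
Definition cdrift1 : R := a1 * (C + lam * kappa) * C / lam.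
Definition cvar : R := q%:R * (q%:R * C) + 2 * (a1 / lam * (q%:R * C)) + (a1 / lam) * (a1 * (q%:R * C) / lam).

Let a1_ge0 : 0 <= a1. Proof. exact: sum_norm_ge0. Qed.
Let qC0 : 0 <= q%:R * C. Proof. by rewrite mulr_ge0. Qed.
Let a1lam : 0 <= a1 / lam. Proof. by rewrite divr_ge0// ltW. Qed.

(** One step along a row vector u with entries at most t. The increment of u
    . V is incr, and comp is its linearised conditional mean, so that incr -
    comp is nearly centred. *)
Section OneStep.
Variables (k : nat) (x : X) (u : 'rV[R]_q) (t b : R).
Hypotheses (rx : Rch k x) (t0 : 0 <= t) (ut : forall i, `|u 0 i| <= t).
Let hK := ch_kernel hch rx.
Let z : R := k.+1%:R.
Let n := l1 k x.
Let comp : R := (u *m A *m V k x) 0 0 / clock k.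
Let d i y : R := V k.+1 y i 0 - V k x i 0.
Let incr y : R := \sum_i u 0 i * d i y.
Let n0 : 0 <= n. Proof. exact: l1_ge0. Qed.
Let zp : 0 < z. Proof. exact: z0. Qed.
Let zi : 0 < z^-1. Proof. by rewrite invr_gt0. Qed.

Lemma comp_le : `|comp| <= t * (a1 / lam) * (n / z).
Proof.
rewrite /comp normrM normfV (gtr0_norm (clock_gt0 k)).
apply: (@le_trans _ _ (t * (n * a1) * (lam * z)^-1)).
  by apply: ler_pM; rewrite ?invr_ge0 ?(ltW (clock_gt0 k)) ?uAV_le ?clock_inv.
by rewrite invfM le_eqVlt; apply/orP; left; apply/eqP; ring.
Qed.

Lemma comp_le2 : `|comp| <= t * (a1 * (q%:R * C) / lam).
Proof.
apply: le_trans comp_le _; rewrite -mulrA ler_wpM2l//.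
rewrite [leRHS]mulrAC ler_wpM2l//.
by rewrite ler_pdivrMr//; exact: l1_le.
Qed.

Lemma incr_le y : tr x y -> `|incr y| <= t * (q%:R * C).
Proof. by move=> xy; apply: l1_dot => // i; apply: (ud_incr hud). Qed.

Lemma obs_step y : obs u k.+1 y = obs (back k u) k x + (incr y - comp).
Proof.
rewrite /obs /back mulmxDl -scalemxAl [in RHS]mxE [X in _ = _ + X + _]mxE /comp.
have -> : incr y = (u *m V k.+1 y) 0 0 - (u *m V k x) 0 0.
  by rewrite !mxE -sumrB; apply: eq_bigr => i _; rewrite mulrBr.
by ring.
Qed.

Lemma kernel_incr : K x incr = \sum_i u 0 i * K x (d i).
Proof.
rewrite (mean_sum hK); apply: eq_bigr => i _; exact: (meanZ hK).
Qed.

Lemma kernel_incr_le : `|K x incr| <= t * (q%:R * C).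
Proof. by apply: (mean_norm_ub hK) => y xy; apply: incr_le. Qed.

Lemma inv_total_clock :
  `|(S x)^-1 - (clock k)^-1| <= (C + lam * kappa) * C / lam * ((1 + n) / z ^+ 2).
Proof.
have S0 := total_gt0 rx; have c0 := clock_gt0 k.
have -> : (S x)^-1 - (clock k)^-1 = (clock k - S x) * ((S x)^-1 * (clock k)^-1).
  by field; rewrite !gt_eqF.
rewrite normrM [X in _ * X]ger0_norm ?mulr_ge0 ?invr_ge0 ?(ltW S0) ?(ltW c0)//.
apply: (@le_trans _ _ (((C + lam * kappa) * (1 + n)) * ((C / z) * (lam * z)^-1))).
  apply: ler_pM => //.
  - by rewrite mulr_ge0 ?invr_ge0 ?(ltW S0) ?(ltW c0).
  - have -> : clock k - S x = - (S x - lam * k%:R) + lam * kappa.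
      by rewrite /clock; ring.
    apply: le_trans (ler_normD _ _) _; rewrite normrN.
    have kp : 0 <= lam * kappa.
      by rewrite mulr_ge0 ?(ltW lam0)// (le_trans _ kappa_ge1).
    rewrite (ger0_norm kp) mulrDl lerD//; first exact: (ud_total hud).
    by rewrite ler_peMr// lerDl.
  - by apply: ler_pM; rewrite ?invr_ge0 ?(ltW S0) ?(ltW c0) ?clock_inv ?total_inv.
rewrite le_eqVlt; apply/orP; left; apply/eqP; field.
by rewrite !gt_eqF.
Qed.

Lemma kernel_drift : `|K x (fun y => incr y - comp)| <=
  cdrift1 * (t * (n * (1 + n)) / z ^+ 2) + q%:R * C * (t / z).
Proof.
rewrite (meanB hK) (mean_cst hK) kernel_incr.
have -> : \sum_i u 0 i * K x (d i) - comp =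
   \sum_i u 0 i * (K x (d i) - (A *m V k x) i 0 / S x) +
   (u *m A *m V k x) 0 0 * ((S x)^-1 - (clock k)^-1).
  rewrite mulrBr -/comp addrA; congr (_ - _).
  rewrite -mulmxA [X in _ + X * _]mxE mulr_suml -big_split/=.
  by apply: eq_bigr => i _; ring.
apply: le_trans (ler_normD _ _) _; rewrite addrC; apply: lerD; last first.
  rewrite [leRHS](_ : _ = t * (q%:R * (C / z))); last by ring.
  apply: l1_dot => //; first by rewrite divr_ge0// ltW.
  by move=> i; apply: (ud_drift hud).
rewrite normrM; apply: (@le_trans _ _ ((t * (n * a1)) * ((C + lam * kappa) * C / lam * ((1 + n) / z ^+ 2)))).
  by apply: ler_pM => //; [exact: uAV_le|exact: inv_total_clock].
rewrite /cdrift1 le_eqVlt; apply/orP; left; apply/eqP; ring.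
Qed.

Lemma kernel_square :
  `|K x (fun y => (incr y - comp) ^+ 2) - quad Q u| <= cvar * (t ^+ 2 * (1 + n) / z).
Proof.
rewrite (mean_eq hK (g := fun y => incr y * incr y + (- 2 * comp * incr y + comp ^+ 2))); last first.
  by move=> y _; ring.
rewrite (meanD hK) (meanD hK) (meanZ hK) (mean_cst hK).
have -> : K x (fun y => incr y * incr y) =
    \sum_i u 0 i * \sum_j u 0 j * K x (fun y => d i y * d j y).
  rewrite (mean_eq hK (g := fun y => \sum_i u 0 i * \sum_j u 0 j * (d i y * d j y))).
    rewrite (mean_sum hK); apply: eq_bigr => i _; rewrite (meanZ hK); congr (_ * _).
    by rewrite (mean_sum hK); apply: eq_bigr => j _; rewrite (meanZ hK).
  move=> y _; rewrite mulr_suml; apply: eq_bigr => i _; rewrite -mulrA; congr (_ * _).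
  by rewrite mulr_sumr; apply: eq_bigr => j _; ring.
have -> : quad Q u = \sum_i u 0 i * \sum_j u 0 j * Q i j.
  rewrite /quad bilinearE; apply: eq_bigr => i _; rewrite mulr_sumr.
  by apply: eq_bigr => j _; rewrite mxE; ring.
rewrite addrAC -sumrB.
under eq_bigr do rewrite -mulrBr -sumrB.
under eq_bigr do under eq_bigr do rewrite -mulrBr.
have p1 : 0 <= (1 + n) / z by rewrite divr_ge0 ?addr_ge0// ltW.
have h1 : `|\sum_i u 0 i * \sum_j u 0 j * (K x (fun y => d i y * d j y) - Q i j)|
   <= t * (q%:R * (t * (q%:R * (C * ((1 + n) / z))))).
  have p2 : 0 <= C * ((1 + n) / z) by rewrite mulr_ge0.
  apply: l1_dot => //; first by rewrite mulr_ge0// mulr_ge0.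
  move=> i; apply: l1_dot => //.
  by move=> j; rewrite mulrA; exact: (ud_cov hud).
have h2 : `|- 2 * comp * K x incr| <= 2 * (t * (a1 / lam) * (n / z)) * (t * (q%:R * C)).
  rewrite normrM [X in X * _]normrM normrN (ger0_norm (ler0n _ 2)).
  apply: ler_pM; rewrite ?mulr_ge0//; last exact: kernel_incr_le.
  by apply: ler_wpM2l => //; exact: comp_le.
have h3 : `|comp ^+ 2| <= (t * (a1 / lam) * (n / z)) * (t * (a1 * (q%:R * C) / lam)).
  by rewrite normrX expr2; apply: ler_pM; rewrite ?comp_le ?comp_le2.
apply: le_trans (ler_normD _ _) _; apply: le_trans (lerD h1 (ler_normD _ _)) _.
apply: le_trans (lerD (lexx _) (lerD h2 h3)) _.
rewrite /cvar [leLHS](_ : _ = q%:R * (q%:R * C) * (t ^+ 2 * (1 + n) / z) +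
  (2 * (a1 / lam * (q%:R * C)) + (a1 / lam) * (a1 * (q%:R * C) / lam)) * (t ^+ 2 * n / z)); last by ring.
rewrite -addrA [leRHS]mulrDl lerD2l ler_wpM2l//.
  rewrite addr_ge0// !mulr_ge0// ?invr_ge0 ?(ltW lam0)//.
by rewrite ler_pM2r// ler_wpM2l ?sqr_ge0// lerDr.
Qed.

(** Second order expansion of the cosine at the transported argument: the
    first order term is the mean of the compensated increment, which is
    small, and the second order term is quad Q u. *)
Lemma one_step : `|K x (fun y => cos (obs u k.+1 y + b)) -
    (1 - quad Q u / 2) * cos (obs (back k u) k x + b)| <=
  cdrift1 * (t * (n * (1 + n)) / z ^+ 2) + q%:R * C * (t / z) +
  cvar * (t ^+ 2 * (1 + n) / z) + (cdelta * t) ^+ 3.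
Proof.
set o := obs (back k u) k x + b.
have h1 : `|K x (fun y => cos (obs u k.+1 y + b)) -
   K x (fun y => cos o + (- sin o * (incr y - comp) + - (cos o / 2) * (incr y - comp) ^+ 2))|
   <= (cdelta * t) ^+ 3.
  rewrite -(mean_cst hK ((cdelta * t) ^+ 3)); apply: (mean_dist hK) => y xy.
  rewrite obs_step addrAC -/o.
  rewrite [X in `|_ - X|](_ : _ = cos o - (incr y - comp) * sin o - (incr y - comp) ^+ 2 / 2 * cos o); last by ring.
  apply: le_trans (cosD_taylor _ _) _.
  rewrite lerXn2r ?nnegrE ?mulr_ge0 ?addr_ge0 ?divr_ge0 ?mulr_ge0 ?(ltW lam0)//.
  apply: le_trans (ler_normB _ _) _; rewrite /cdelta mulrDl mulrC.
  by apply: lerD; [exact: incr_le|rewrite mulrC comp_le2].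
rewrite (meanD hK) (meanD hK) (mean_cst hK) !(meanZ hK) in h1.
set k1 := K x (fun y => incr y - comp) in h1.
set k2 := K x (fun y => (incr y - comp) ^+ 2) in h1.
have h2 : `|cos o + (- sin o * k1 + - (cos o / 2) * k2) - (1 - quad Q u / 2) * cos o| <=
   `|k1| + `|k2 - quad Q u|.
  rewrite [X in `|X|](_ : _ = - sin o * k1 + - (cos o / 2) * (k2 - quad Q u)); last by field.
  apply: le_trans (ler_normD _ _) _; rewrite !normrM !normrN; apply: lerD.
    by rewrite ler_piMl// sin_max.
  rewrite ler_piMl// normrM; have := cos_max o.
  by rewrite (ger0_norm (_ : 0 <= 2^-1)) ?invr_ge0//; lra.
have := kernel_drift; have := kernel_square; rewrite -/k1 -/k2 => h3 h4.
apply: le_trans (ler_distD (cos o + (- sin o * k1 + - (cos o / 2) * k2)) _ _) _.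
by rewrite addrC lerD// (le_trans h2)// lerD.
Qed.

End OneStep.

(** For t = O(k^(-1/2)) all errors of [one_step] have mean O(t / k), since E
    |V_k|^2 = O(k). *)
Lemma mean_one_step T : 0 <= T -> exists2 c : R, 0 <= c &
  forall k (u : 'rV[R]_q) t b, 0 <= t -> (forall i, `|u 0 i| <= t) ->
    t ^+ 2 * k.+1%:R <= T ->
  `|E k.+1 (fun y => cos (obs u k.+1 y + b)) -
    (1 - quad Q u / 2) * E k (fun x => cos (obs (back k u) k x + b))| <=
  c * (t / k.+1%:R).
Proof.
move=> T0.
have al0 : 0 <= cdrift1.
  rewrite /cdrift1 !mulr_ge0 ?invr_ge0 ?(ltW lam0)// addr_ge0// mulr_ge0 ?(ltW lam0)//.
  exact: le_trans kappa_ge1.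
have ga0 : 0 <= cvar.
  by rewrite /cvar !addr_ge0// !mulr_ge0// ?invr_ge0 ?(ltW lam0).
have de0 : 0 <= cdelta.
  by rewrite /cdelta addr_ge0// divr_ge0 ?(ltW lam0)// mulr_ge0.
exists (cdrift1 + q%:R * C + cvar * (2 + T) + cdelta ^+ 3 * T +
        2 * cdrift1 * moment_const + cvar * moment_const * T).
  have cV0 := moment_const_ge0; have T2 : 0 <= 2 + T by exact: addr_ge0.
  have h1 : 0 <= cvar * (2 + T) by exact: mulr_ge0.
  have h2 : 0 <= cdelta ^+ 3 * T by rewrite mulr_ge0// exprn_ge0.
  have h3 : 0 <= cdrift1 * moment_const by exact: mulr_ge0.
  have h4 : 0 <= cvar * moment_const by exact: mulr_ge0.
  have h5 : 0 <= cvar * moment_const * T by exact: mulr_ge0.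
  by have := qC0; rewrite -(mulrA 2); lra.
move=> k u t b t0 ut tT.
set z : R := k.+1%:R.
have zp : 0 < z by exact: z0.
have zu : z^-1 <= 1 by rewrite invf_le1// z1.
have zi : 0 < z^-1 by rewrite invr_gt0.
have hE := ch_mean hch k.
rewrite (ch_step hch) -(meanZ hE).
pose c0 := cdrift1 * (t / z ^+ 2) + q%:R * C * (t / z) +
  cvar * ((t ^+ 2 + t) / z) + (cdelta * t) ^+ 3.
pose c1 := 2 * cdrift1 * (t / z ^+ 2) + cvar * (t ^+ 3 / z).
have z20 : 0 <= t / z ^+ 2 by rewrite divr_ge0// sqr_ge0.
have c1_0 : 0 <= c1.
  have h1 : 0 <= cvar * (t ^+ 3 / z).
    by apply: mulr_ge0 => //; rewrite divr_ge0 ?exprn_ge0// ltW.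
  have h2 : 0 <= cdrift1 * (t / z ^+ 2) by exact: mulr_ge0.
  by rewrite /c1 -(mulrA 2) addr_ge0// mulr_ge0.
apply: (@le_trans _ _ (E k (fun x => c0 + c1 * l1 k x ^+ 2))).
  apply: (mean_dist hE) => x rx.
  apply: le_trans (one_step b rx t0 ut) _; rewrite -/z.
  set n := l1 k x.
  have n0 : 0 <= n by exact: l1_ge0.
  have h1 : t * (n * (1 + n)) / z ^+ 2 <= t / z ^+ 2 + 2 * (t / z ^+ 2) * n ^+ 2.
    rewrite mulrAC -mulrA; have := sqr_ge0 (1 - n).
    set w := t / z ^+ 2 in z20 *.
    by rewrite [t * _]mulrA -/w => h; have := sqr_ge0 n; nra.
  have h2 : t ^+ 2 * (1 + n) / z <= (t ^+ 2 + t) / z + t ^+ 3 / z * n ^+ 2.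
    rewrite [leRHS](_ : _ = (t ^+ 2 + t + t ^+ 3 * n ^+ 2) / z); last by ring.
    rewrite ler_pM2r//.
    have : 0 <= t * (1 - t * n) ^+ 2 by rewrite mulr_ge0// sqr_ge0.
    have : 0 <= t * (t * n) ^+ 2 by rewrite mulr_ge0// sqr_ge0.
    by move=> h h'; lra.
  have h3 := ler_wpM2l al0 h1; have h4 := ler_wpM2l ga0 h2.
  rewrite /c0 /c1 [leRHS](_ : _ =
    cdrift1 * (t / z ^+ 2 + 2 * (t / z ^+ 2) * n ^+ 2) + q%:R * C * (t / z) +
    cvar * ((t ^+ 2 + t) / z + t ^+ 3 / z * n ^+ 2) + (cdelta * t) ^+ 3); last by ring.
  by rewrite lerD2r lerD// lerD2r.
rewrite (meanD hE) (mean_cst hE) (meanZ hE).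
have h5 : c1 * E k (fun x => l1 k x ^+ 2) <= c1 * (moment_const * z).
  by rewrite ler_wpM2l// mean_l1sq.
apply: le_trans (lerD (lexx _) h5) _.
have t2 : t ^+ 2 <= T / z by rewrite ler_pdivlMr.
have t2T : t ^+ 2 <= T.
  by apply: le_trans t2 _; rewrite ler_pdivrMr// ler_peMr// z1.
have b1 : t / z ^+ 2 <= t / z.
  by rewrite ler_wpM2l// expr2 invfM ler_piMl// ltW.
have b2 : (t ^+ 2 + t) / z <= (2 + T) * (t / z).
  rewrite mulrA ler_pM2r//; have [t1|/ltW t1] := leP t 1.
    have : t ^+ 2 <= t by rewrite expr2 ler_piMl.
    have : 0 <= T * t by exact: mulr_ge0.
    by lra.
  have : t ^+ 2 <= T * t by rewrite (le_trans t2T)// ler_peMr.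
  by lra.
have b3 : t ^+ 3 <= T * (t / z).
  by rewrite exprS (_ : T * (t / z) = t * (T / z)) ?ler_wpM2l//; ring.
have b3z : c1 * (moment_const * z) = 2 * cdrift1 * moment_const * (t / z) + cvar * moment_const * t ^+ 3.
  by rewrite /c1; field; rewrite gt_eqF.
rewrite b3z /c0.
have g1 := ler_wpM2l al0 b1; have g2 := ler_wpM2l ga0 b2.
have g3 : (cdelta * t) ^+ 3 <= cdelta ^+ 3 * (T * (t / z)).
  by rewrite exprMn ler_wpM2l// exprn_ge0.
have g4 : cvar * moment_const * t ^+ 3 <= cvar * moment_const * (T * (t / z)).
  by rewrite ler_wpM2l// mulr_ge0// moment_const_ge0.
move: g1 g2 g3 g4; set d3 := (cdelta * t) ^+ 3; set w2 := t / z ^+ 2.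
set w3 := (t ^+ 2 + t) / z; set w := t / z; set t3 := t ^+ 3.
move=> {}b1 {}b2 {}b3 g4.
have : cdrift1 * moment_const * w2 <= cdrift1 * moment_const * w.
  by rewrite [leLHS]mulrAC [leRHS]mulrAC ler_wpM2r// moment_const_ge0.
by clearbody d3 w2 w3 w t3; lra.
Qed.

Lemma quadD M N (u : 'rV[R]_q) : quad (M + N) u = quad M u + quad N u.
Proof. by rewrite /quad mulmxDr mulmxDl mxE. Qed.

Lemma quadZ a M (u : 'rV[R]_q) : quad (a *: M) u = a * quad M u.
Proof. by rewrite /quad -scalemxAr -scalemxAl mxE. Qed.

Lemma quadN M (u : 'rV[R]_q) : quad (- M) u = - quad M u.
Proof. by rewrite -scaleN1r quadZ mulN1r. Qed.

Lemma quad_norm M (u : 'rV[R]_q) t : (forall i, `|u 0 i| <= t) ->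
  `|quad M u| <= t ^+ 2 * sum_norm M.
Proof. by move=> ut; apply: bilinear_norm => // i; rewrite mxE. Qed.

Lemma quad_scale M a (u : 'rV[R]_q) : quad M (a *: u) = a ^+ 2 * quad M u.
Proof.
by rewrite /quad linearZ/= -!scalemxAl -scalemxAr !mxE mulrA expr2.
Qed.

(** The Lyapunov equation in integrated form: from time k to k + 1 the
    exponent (k + kappa) quad Sig u gains quad Q u along the backward flow,
    up to O(|u|^2 / k). *)
Lemma quad_back Sig k (u : 'rV[R]_q) :
  Sig - lam^-1 *: (A *m Sig + Sig *m A^T) = Q ->
  (k.+1%:R + kappa) * quad Sig u = (k%:R + kappa) * quad Sig (back k u) +
    (quad Q u - quad (A *m Sig *m A^T) u / (lam ^+ 2 * (k%:R + kappa))).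
Proof.
move=> <-; have kk : 0 < k%:R + kappa.
  by rewrite ltr_wpDl// (lt_le_trans ltr01 kappa_ge1).
have -> : quad Sig (back k u) = quad Sig u +
    (clock k)^-1 * (quad (A *m Sig) u + quad (Sig *m A^T) u) +
    (clock k)^-1 ^+ 2 * quad (A *m Sig *m A^T) u.
  rewrite /quad /back linearD/= linearZ/= trmx_mul.
  rewrite !mulmxDl !mulmxDr -!scalemxAl -!scalemxAr.
  rewrite !mulmxA; set o1 := u *m Sig *m u^T; set o2 := u *m Sig *m A^T *m u^T.
  set o3 := u *m A *m Sig *m u^T; set o4 := _ *m A^T *m u^T.
  by rewrite !mxE; ring.
rewrite quadD quadN quadZ quadD /clock mulrSr; field.
by rewrite !gt_eqF.
Qed.

Lemma exp_correction (x y : R) : `|x| <= 1 / 4 -> `|y| <= 1 / 4 ->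
  `|(1 - x) * expR (x + y) - 1| <= 3 * `|y| + 6 * x ^+ 2.
Proof.
move=> x4 y4.
have z2 : `|x + y| <= 1 / 2 by apply: le_trans (ler_normD _ _) _; lra.
have := expR_taylor z2; set e := expR _ - _ => eE.
have -> : (1 - x) * expR (x + y) - 1 = y + (- x ^+ 2 + (- (x * y) + (1 - x) * e)).
  by rewrite /e; ring.
have y0 := normr_ge0 y; have x0 := normr_ge0 x.
have h1 : `|- (x * y)| <= `|y| / 4 by rewrite normrN normrM; nra.
have h2 : `|1 - x| <= 5 / 4.
  by apply: le_trans (ler_normB _ _) _; rewrite normr1; lra.
have h3 : `|(1 - x) * e| <= 5 / 4 * (2 * (x + y) ^+ 2) by rewrite normrM ler_pM.
have h4 : `|- x ^+ 2| = x ^+ 2 by rewrite normrN ger0_norm// sqr_ge0.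
have h5 : y ^+ 2 <= `|y| / 4 by rewrite -(real_normK (num_real y)); nra.
have h6 : (x + y) ^+ 2 <= 2 * x ^+ 2 + 2 * y ^+ 2 by have := sqr_ge0 (x - y); lra.
apply: le_trans (ler_normD _ _) _.
apply: (@le_trans _ _ (`|y| + (x ^+ 2 + (`|y| / 4 + 5 / 4 * (2 * (x + y) ^+ 2))))).
  rewrite lerD2l; apply: le_trans (ler_normD _ _) _; rewrite h4 lerD2l.
  by apply: le_trans (ler_normD _ _) _; apply: lerD.
lra.
Qed.

Lemma mean_cos_norm k (f : X -> R) : `|E k (fun x => cos (f x))| <= 1.
Proof. by apply: (mean_norm_ub (ch_mean hch k)) => x _; exact: cos_max. Qed.

Section Limit.
Variable Sig : 'M[R]_q.
Hypothesis hSig : Sig - lam^-1 *: (A *m Sig + Sig *m A^T) = Q.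

(** The exponential compensates the factor 1 - quad Q u / 2 of one step, so
    that this quantity is nearly constant along the backward flow. *)
Definition corrected k (u : 'rV[R]_q) b : R :=
  E k (fun x => cos (obs u k x + b)) * expR ((k%:R + kappa) * quad Sig u / 2).

Let sQ := sum_norm Q.
Let sS := sum_norm Sig.
Let sM := sum_norm (A *m Sig *m A^T).

Lemma corrected_step T : 0 <= T -> exists2 t1 : R, 0 < t1 & exists2 c : R, 0 <= c &
  forall k (u : 'rV[R]_q) t b, 0 <= t -> t <= t1 -> (forall i, `|u 0 i| <= t) ->
    t ^+ 2 * k.+1%:R <= T ->
  `|corrected k.+1 u b - corrected k (back k u) b| <= c * (t / k.+1%:R).
Proof.
move=> T0; have [c c0 hc] := mean_one_step T0.
have sQ0 : 0 <= sQ by exact: sum_norm_ge0.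
have sM0 : 0 <= sM by exact: sum_norm_ge0.
have sS0 : 0 <= sS by exact: sum_norm_ge0.
have [mm mmE] : exists mm, mm = sM / lam ^+ 2 by exists (sM / lam ^+ 2).
have sl0 : 0 <= mm by rewrite mmE divr_ge0// sqr_ge0.
have D0 : 0 < 4 * (1 + sQ + mm) by lra.
pose e0 : R := expR ((kappa + 1) * T * sS).
have e00 : 0 <= e0 by exact: expR_ge0.
(* small enough for the hypotheses of exp_correction *)
exists (4 * (1 + sQ + mm))^-1; first by rewrite invr_gt0.
exists (e0 * (c + 3 * (mm) + 6 * sQ ^+ 2 * T)).
  by rewrite mulr_ge0// !addr_ge0// !mulr_ge0// ?invr_ge0 ?sqr_ge0 ?exprn_ge0.
move=> k u t b t0 tt1 ut tT.
have bt := back_le k ut.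
set z : R := k.+1%:R in tT *.
have zp : 0 < z by exact: z0.
have zu : z^-1 <= 1 by rewrite invf_le1// z1.
have zi : 0 < z^-1 by rewrite invr_gt0.
have kp1 := kappa_ge1.
have kk : 0 < k%:R + kappa by rewrite ltr_wpDl// (lt_le_trans ltr01 kappa_ge1).
have zk : z <= k%:R + kappa by rewrite /z mulrSr lerD2l.
have tD : t * (4 * (1 + sQ + mm)) <= 1 by rewrite -ler_pdivlMr// mul1r.
have tD1 : 0 <= t * sQ by exact: mulr_ge0.
have tD2 : 0 <= t * (mm) by exact: mulr_ge0.
have t1 : t <= 1 by lra.
have tsq : t ^+ 2 <= t by rewrite expr2 ler_piMl.
pose x := quad Q u / 2.
pose y := - (quad (A *m Sig *m A^T) u / (lam ^+ 2 * (k%:R + kappa))) / 2.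
have xb : `|x| <= t ^+ 2 * sQ.
  rewrite /x normrM (ger0_norm (_ : 0 <= 2^-1)) ?invr_ge0//.
  have := quad_norm Q ut; rewrite -/sQ => h.
  have : 0 <= t ^+ 2 * sQ by rewrite mulr_ge0// sqr_ge0.
  by lra.
have yb : `|y| <= mm * (t / z) * t.
  rewrite /y normrM normrN (ger0_norm (_ : 0 <= 2^-1)) ?invr_ge0//.
  have h0 : 0 < lam ^+ 2 by rewrite exprn_gt0.
  rewrite normrM normfV (gtr0_norm (_ : 0 < lam ^+ 2 * _)) ?mulr_gt0//.
  have h1 : (lam ^+ 2 * (k%:R + kappa))^-1 <= (lam ^+ 2 * z)^-1.
    by rewrite lef_pV2 ?posrE ?mulr_gt0// ler_pM2l.
  have h2 : `|quad (A *m Sig *m A^T) u| / (lam ^+ 2 * (k%:R + kappa)) <=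
      t ^+ 2 * sM * (lam ^+ 2 * z)^-1.
    apply: ler_pM => //; last exact: quad_norm.
    by rewrite invr_ge0 mulr_ge0// ltW.
  have h3 : t ^+ 2 * sM * (lam ^+ 2 * z)^-1 = mm * (t / z) * t.
    by rewrite mmE invfM; ring.
  rewrite -h3; apply: le_trans h2; rewrite ler_piMr ?invf_le1 ?ler1n//.
  by rewrite mulr_ge0// invr_ge0 mulr_ge0// ltW.
have yb1 : `|y| <= mm * (t / z).
  by apply: le_trans yb _; rewrite ler_piMr// mulr_ge0// divr_ge0// ltW.
have x4 : `|x| <= 1 / 4.
  apply: le_trans xb _; have : t ^+ 2 * sQ <= t * sQ by rewrite ler_wpM2r.
  by lra.
have y4 : `|y| <= 1 / 4.
  apply: le_trans yb _.
  have h : mm * (t / z) * t <= t * (mm).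
    rewrite [leLHS](_ : _ = t * (mm) * (t / z)); last by ring.
    by rewrite ler_piMr// mulr_ile1// ltW.
  by apply: le_trans h _; lra.
have x2b : x ^+ 2 <= sQ ^+ 2 * T * (t / z).
  rewrite -(real_normK (num_real x)).
  apply: (@le_trans _ _ ((t ^+ 2 * sQ) ^+ 2)); first by rewrite lerXn2r ?nnegrE// mulr_ge0// sqr_ge0.
  rewrite [leLHS](_ : _ = sQ ^+ 2 * (t ^+ 2 * t ^+ 2)); last by ring.
  rewrite -mulrA ler_wpM2l ?sqr_ge0//.
  rewrite [leRHS](_ : _ = T / z * t); last by ring.
  by rewrite ler_pM ?sqr_ge0// ler_pdivlMr.
rewrite /corrected.
set a' := E k.+1 _; set a := E k _.
have hstep := hc k u t b t0 ut tT; rewrite -/a -/a' -/z in hstep.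
have -> : (k.+1%:R + kappa) * quad Sig u / 2 =
    (k%:R + kappa) * quad Sig (back k u) / 2 + (x + y).
  by rewrite (quad_back k u hSig) /x /y; ring.
rewrite expRD; set e := expR _.
have expb (w : R) (v : 'rV[R]_q) : (forall i, `|v 0 i| <= t) -> 0 <= w ->
    w <= (kappa + 1) * z -> expR (w * quad Sig v / 2) <= e0.
  move=> vt w0 wz; rewrite ler_expR.
  have h := quad_norm Sig vt; rewrite -/sS in h.
  apply: (@le_trans _ _ (`|w * quad Sig v|)).
    have := ler_norm (w * quad Sig v); have := normr_ge0 (w * quad Sig v); lra.
  rewrite normrM (ger0_norm w0).
  apply: (@le_trans _ _ ((kappa + 1) * z * (t ^+ 2 * sS))); first exact: ler_pM.
  rewrite [leLHS](_ : _ = (kappa + 1) * (t ^+ 2 * z) * sS); last by ring.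
  by rewrite ler_wpM2r// ler_wpM2l//; lra.
have eb : e <= e0.
  apply: expb => //; first exact: ltW.
  have : kappa <= kappa * z by rewrite ler_peMr// ?z1//; lra.
  by rewrite /z mulrSr; have := ler0n R k; lra.
have e'b : e * expR (x + y) <= e0.
  rewrite -expRD (_ : _ + (x + y) = (k.+1%:R + kappa) * quad Sig u / 2).
    apply: expb => //; first by rewrite addr_ge0//; lra.
    have : kappa <= kappa * z by rewrite ler_peMr// ?z1//; lra.
    by rewrite -/z; lra.
  by rewrite (quad_back k u hSig) /x /y; ring.
have -> : a' * (e * expR (x + y)) - a * e =
    e * expR (x + y) * (a' - (1 - x) * a) + a * e * ((1 - x) * expR (x + y) - 1).
  by ring.
apply: le_trans (ler_normD _ _) _; rewrite !normrM.
rewrite (ger0_norm (expR_ge0 _ : 0 <= e)) (ger0_norm (expR_ge0 _)).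
have a_1 : `|a| <= 1 by exact: mean_cos_norm.
have h1 : e * expR (x + y) * `|a' - (1 - x) * a| <= e0 * (c * (t / z)).
  by apply: ler_pM => //; rewrite mulr_ge0 ?expR_ge0.
have h2 : `|a| * e * `|(1 - x) * expR (x + y) - 1| <=
   1 * e0 * (3 * (mm * (t / z)) + 6 * (sQ ^+ 2 * T * (t / z))).
  apply: ler_pM => //; first by rewrite mulr_ge0 ?expR_ge0.
    by apply: ler_pM => //; exact: expR_ge0.
  apply: le_trans (exp_correction x4 y4) _; apply: lerD; rewrite ler_pM2l//.
apply: le_trans (lerD h1 h2) _.
by rewrite le_eqVlt; apply/orP; left; apply/eqP; ring.
Qed.

(** The row vector s carried backwards from time n over j steps. *)
Fixpoint back_iter (n : nat) (s : 'rV[R]_q) (j : nat) : 'rV[R]_q :=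
  if j is j'.+1 then back (n - j) (back_iter n s j') else s.

Lemma back_iter_le n (s : 'rV[R]_q) j t : (forall i, `|s 0 i| <= t) -> forall i, `|back_iter n s j 0 i| <= t.
Proof. by move=> st; elim: j => //= j IH; exact: back_le. Qed.

Lemma obs_scale a (u : 'rV[R]_q) k x : obs (a *: u) k x = a * obs u k x.
Proof. by rewrite /obs -scalemxAl mxE. Qed.

Lemma obs_norm (u : 'rV[R]_q) t k x : Rch k x -> (forall i, `|u 0 i| <= t) ->
  `|obs u k x| <= t * (q%:R * (C * k.+1%:R)).
Proof.
move=> rx ut; rewrite /obs mxE; apply: l1_dot => //; first by rewrite mulr_ge0.
by move=> i; exact: (ud_bound hud).
Qed.

(** Telescoping of [corrected] from time n, where u is s / sqrt n, down to
    time 0, where V is bounded and u tends to 0. *)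
Lemma clt_cos (s : 'rV[R]_q) (b : R) :
  (fun n => E n (fun x => cos (obs s n x / Num.sqrt n%:R + b))) @ \oo -->
  cos b * expR (- (quad Sig s / 2)).
Proof.
pose t : R := \sum_i `|s 0 i|.
have t0 : 0 <= t by exact: sumr_ge0.
have st i : `|s 0 i| <= t by rewrite /t (bigD1 i)//= lerDl sumr_ge0.
(* the transported vectors have entries at most t / sqrt n, so the bound T on
   their squares times the time is t ^ 2 *)
have [t1 t1_0 [c c0 hc]] := corrected_step (sqr_ge0 t).
pose r n : R := (Num.sqrt n%:R)^-1.
have r0 n : 0 <= r n by rewrite invr_ge0 sqrtr_ge0.
have rcv : r n @[n --> \oo] --> 0 by exact: cvg_invsqrt.
have rt n i : `|(r n *: s) 0 i| <= r n * t.
  by rewrite mxE normrM (ger0_norm (r0 n)) ler_wpM2l.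
have rtcv : r n * t @[n --> \oo] --> 0.
  by rewrite -[X in _ --> X](mul0r t); apply: cvgM => //; exact: cvg_cst.
pose G n k := corrected k (back_iter n (r n *: s) (n - k)) b.
have dG : (fun n => G n n - G n 0) @ \oo --> (0 : R).
  apply/norm_cvg0P; pose H n : R := c * t * (r n * \sum_(k < n) k.+1%:R^-1).
  have Hc : H n @[n --> \oo] --> 0.
    rewrite -[X in _ --> X](mulr0 (c * t)); apply: cvgM; first exact: cvg_cst.
    exact: cvg_harmonic_sqrt.
  apply: (squeeze_cvgr _ (cvg_cst 0) Hc); near=> n.
  rewrite normr_ge0/=.
  have n0 : (0 < n)%N by near: n; exact: nbhs_infty_gt.
  have rn : r n ^+ 2 * n%:R = 1.
    by rewrite /r exprVn sqr_sqrtr// mulVf// pnatr_eq0 -lt0n.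
  have rt1 : r n * t <= t1 by near: n; exact: (cvgr_le _ rtcv).
  have -> : G n n - G n 0 = \sum_(k < n) (G n k.+1 - G n k).
    rewrite -(big_mkord predT (fun k => G n k.+1 - G n k)) telescope_sumr//.
  apply: le_trans (ler_norm_sum _ _ _) _.
  rewrite /H -mulrA mulrCA !mulr_sumr; apply: ler_sum => -[k kn] _ /=.
  rewrite /G -(subnSK kn)/= (_ : (n - (n - k.+1).+1 = k)%N); last by rewrite subnSK// subKn// ltnW.
  apply: le_trans (hc _ _ (r n * t) _ _ _ _ _) _ => //.
  - by rewrite mulr_ge0.
  - exact: back_iter_le.
  - rewrite exprMn mulrAC ler_piMl ?sqr_ge0//.
    by rewrite -[leRHS]rn ler_wpM2l ?sqr_ge0// ler_nat.
  - rewrite le_eqVlt; apply/orP; left; apply/eqP; ring.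
have G0 : (fun n => G n 0%N) @ \oo --> cos b.
  have e0 : (fun n => (kappa * quad Sig (back_iter n (r n *: s) n) / 2)) @ \oo --> (0 : R).
    apply/norm_cvg0P; pose H n : R := kappa * (t ^+ 2 * sS) * (r n * r n).
    have Hc : H n @[n --> \oo] --> 0.
      rewrite -[X in _ --> X](mulr0 (kappa * (t ^+ 2 * sS))); apply: cvgM; first exact: cvg_cst.
      by rewrite -[X in _ --> X](mulr0 0); exact: (cvgM rcv rcv).
    apply: (squeeze_cvgr _ (cvg_cst 0) Hc); near=> n; rewrite normr_ge0/=.
    have := quad_norm Sig (back_iter_le n n (rt n)); rewrite -/sS.
    set Z := quad _ _ => hZ; have kp1 := kappa_ge1.
    rewrite !normrM (ger0_norm (_ : 0 <= kappa)); last lra.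
    rewrite (ger0_norm (_ : 0 <= 2^-1)) ?invr_ge0//.
    have h : kappa * `|Z| <= kappa * ((r n * t) ^+ 2 * sS) by rewrite ler_wpM2l//; lra.
    have h' : 0 <= kappa * `|Z| by rewrite mulr_ge0//; lra.
    rewrite /H; lra.
  have e1 : expR (kappa * quad Sig (back_iter n (r n *: s) n) / 2) @[n --> \oo] --> (1 : R).
    by have := cvg_comp _ _ e0 (@continuous_expR R 0); rewrite expR0.
  have a0 : (fun n => E 0%N (fun x => cos (obs (back_iter n (r n *: s) n) 0 x + b))) @ \oo --> cos b.
    apply/subr_cvg0; apply/norm_cvg0P; pose H n : R := t * (q%:R * C) * r n.
    have Hc : H n @[n --> \oo] --> 0.
      rewrite -[X in _ --> X](mulr0 (t * (q%:R * C))); apply: cvgM; [exact: cvg_cst|by []].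
    apply: (squeeze_cvgr _ (cvg_cst 0) Hc); near=> n; rewrite normr_ge0/=.
    rewrite -(mean_cst (ch_mean hch 0) (cos b)) -(mean_cst (ch_mean hch 0) (H n)).
    apply: (mean_dist (ch_mean hch 0)) => x rx.
    apply: le_trans (cos_lip _ _) _; rewrite addrK.
    apply: le_trans (obs_norm rx (back_iter_le n n (rt n))) _.
    by rewrite mulr1 /H le_eqVlt; apply/orP; left; apply/eqP; ring.
  rewrite -[X in _ --> X]mulr1.
  apply: (cvg_trans _ (cvgM a0 e1)); apply: near_eq_cvg; near=> n.
  by rewrite /G /corrected subn0 add0r.
have Gn : (fun n => G n n) @ \oo --> cos b.
  rewrite -[X in _ --> X]add0r.
  apply: (cvg_trans _ (cvgD dG G0)); apply: near_eq_cvg; near=> n.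
  by rewrite /= subrK.
have en : (fun n => expR (- ((n%:R + kappa) * quad Sig (r n *: s) / 2))) @ \oo -->
    expR (- (quad Sig s / 2)).
  have : (fun n => - ((1 + kappa * (r n * r n)) * quad Sig s / 2)) @ \oo -->
     - ((1 + kappa * (0 * 0)) * quad Sig s / 2).
    apply: cvgN; apply: cvgM; last exact: cvg_cst.
    apply: cvgM; last exact: cvg_cst; apply: cvgD; first exact: cvg_cst.
    by apply: cvgM; [exact: cvg_cst|exact: (cvgM rcv rcv)].
  rewrite !mulr0 addr0 mul1r => h.
  apply: (cvg_trans _ (cvg_comp _ _ h (@continuous_expR R (- (quad Sig s / 2))))).
  apply: near_eq_cvg; near=> n => /=.
  have n0 : (0 < n)%N by near: n; exact: nbhs_infty_gt.
  have rn : r n ^+ 2 * n%:R = 1.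
    by rewrite /r exprVn sqr_sqrtr// mulVf// pnatr_eq0 -lt0n.
  congr (expR (- (_ / 2))); rewrite quad_scale.
  rewrite [RHS](_ : _ = (r n ^+ 2 * n%:R + kappa * (r n * r n)) * quad Sig s).
    by rewrite rn.
  by ring.
apply: (cvg_trans _ (cvgM Gn en)); apply: near_eq_cvg; near=> n => /=.
rewrite /G /corrected subnn -[LHS]mulrA -expRD /=.
rewrite subrr expR0 mulr1; congr (E n _); apply/funext => x.
by rewrite obs_scale mulrC.
Unshelve. all: by end_near.
Qed.

End Limit.

Lemma clt_cos_exists : exists2 Sig : 'M[R]_q, Sig^T = Sig &
  forall (s : 'rV[R]_q) (b : R),
  (fun n => E n (fun x => cos ((s *m V n x) 0 0 / Num.sqrt n%:R + b))) @ \oo -->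
  cos b * expR (- ((s *m Sig *m s^T) 0 0 / 2)).
Proof.
have [Sig ST hS] := lyapunov_exists (ud_dominant hud) lam0 (ud_sym hud).
by exists Sig => // s b; exact: clt_cos.
Qed.

End Chain.

(** * Trigonometric test functions and weak convergence *)

Lemma continuous_sum_ord (R : realType) (T : topologicalType) n
    (F : 'I_n -> T -> R) : (forall i, continuous (F i)) ->
  continuous (fun x => \sum_i F i x).
Proof.
by move=> cF; apply: continuous_big; [exact: add_continuous|move=> i _; exact: cF].
Qed.

Section TrigApprox.
Context {R : realType} {r : nat}.
Implicit Types (f g h : 'rV[R]_r -> R) (x : 'rV[R]_r).

Definition bcont f := continuous f /\ exists M, forall x, `|f x| <= M.

(** Integration is linear only on integrable functions; the restriction to
    bounded continuous functions makes integrals against any probability an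
    instance. *)
Record is_bcmean (E : ('rV[R]_r -> R) -> R) : Prop := IsBCMean {
  bcmeanD : forall f g, bcont f -> bcont g -> E (fun x => f x + g x) = E f + E g;
  bcmeanZ : forall a f, bcont f -> E (fun x => a * f x) = a * E f;
  bcmean1 : E (fun=> 1) = 1;
  bcmean_le : forall f g, bcont f -> bcont g -> (forall x, f x <= g x) -> E f <= E g }.

(** The cosines with arbitrary phase span an algebra, by the addition
    formulas. *)
Inductive trig : ('rV[R]_r -> R) -> Prop :=
| trig_cos (t : 'cV[R]_r) b : trig (fun x => cos ((x *m t) 0 0 + b))
| trigD f g : trig f -> trig g -> trig (fun x => f x + g x)
| trigZ a f : trig f -> trig (fun x => a * f x).

Lemma trig_cst c : trig (fun=> c).
Proof.
have -> : (fun=> c) = (fun x => c * cos ((x *m (0 : 'cV[R]_r)) 0 0 + 0)).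
  by apply/funext => x; rewrite mulmx0 mxE addr0 cos0 mulr1.
by apply: trigZ; exact: trig_cos.
Qed.

Lemma trig_mul_cos f (t : 'cV[R]_r) b : trig f ->
  trig (fun x => f x * cos ((x *m t) 0 0 + b)).
Proof.
elim=> [s c|f1 f2 _ h1 _ h2|a f1 _ h1].
- have -> : (fun x => cos ((x *m s) 0 0 + c) * cos ((x *m t) 0 0 + b)) =
    (fun x => 2^-1 * (cos ((x *m (s + t)) 0 0 + (c + b)) +
                      cos ((x *m (s - t)) 0 0 + (c - b)))).
    apply/funext => x; set p := (x *m s) 0 0; set q := (x *m t) 0 0.
    have -> : (x *m (s + t)) 0 0 = p + q by rewrite mulmxDr mxE.
    have -> : (x *m (s - t)) 0 0 = p - q.
      by rewrite mulmxBr mxE [X in _ + X]mxE.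
    rewrite (_ : p + q + (c + b) = (p + c) + (q + b)); last by ring.
    rewrite (_ : p - q + (c - b) = (p + c) - (q + b)); last by ring.
    by rewrite (cosB (p + c)) (cosD (p + c)); field.
  by apply: trigZ; apply: trigD; exact: trig_cos.
- rewrite (_ : (fun x => _) = (fun x => f1 x * cos ((x *m t) 0 0 + b) +
     f2 x * cos ((x *m t) 0 0 + b))); first exact: trigD.
  by apply/funext => x; rewrite mulrDl.
- rewrite (_ : (fun x => _) = (fun x => a * (f1 x * cos ((x *m t) 0 0 + b)))).
    exact: trigZ.
  by apply/funext => x; rewrite mulrA.
Qed.

Lemma trigM f g : trig f -> trig g -> trig (fun x => f x * g x).
Proof.
move=> tf; elim=> [t b|g1 g2 _ h1 _ h2|a g1 _ h1]; first exact: trig_mul_cos.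
- rewrite (_ : (fun x => _) = (fun x => f x * g1 x + f x * g2 x)); first exact: trigD.
  by apply/funext => x; rewrite mulrDr.
- rewrite (_ : (fun x => _) = (fun x => a * (f x * g1 x))); first exact: trigZ.
  by apply/funext => x; rewrite mulrCA.
Qed.

Lemma continuous_dot (t : 'cV[R]_r) : continuous (fun x => (x *m t) 0 0).
Proof.
move=> x; rewrite (_ : (fun x => _) = (fun x => \sum_j x 0 j * t j 0)); last first.
  by apply/funext => y; rewrite mxE.
move: x; apply: continuous_sum_ord => j x.
by apply: continuousM; [exact: coord_continuous|exact: cst_continuous].
Qed.

Lemma trig_bcont f : trig f -> bcont f.
Proof.
elim=> [t b|f1 f2 _ [c1 [M1 h1]] _ [c2 [M2 h2]]|a f1 _ [c1 [M1 h1]]].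
- split; last by exists 1 => x; rewrite cos_max.
  move=> x; apply: (@continuous_comp _ _ _ (fun x => (x *m t) 0 0 + b) cos); last exact: continuous_cos.
  by apply: continuousD; [exact: continuous_dot|exact: cst_continuous].
- split; first by move=> x; apply: continuousD; [exact: c1|exact: c2].
  by exists (M1 + M2) => x; rewrite (le_trans (ler_normD _ _))// lerD.
- split; first by move=> x; apply: continuousM; [exact: cst_continuous|exact: c1].
  by exists (`|a| * M1) => x; rewrite normrM ler_wpM2l.
Qed.

Definition trig_limit (En : nat -> ('rV[R]_r -> R) -> R) (E : ('rV[R]_r -> R) -> R) :=
  forall (t : 'cV[R]_r) b, (fun n => En n (fun x => cos ((x *m t) 0 0 + b))) @ \oo -->
    E (fun x => cos ((x *m t) 0 0 + b)).

Lemma trig_cvg En E f : (forall n, is_bcmean (En n)) -> is_bcmean E ->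
  trig_limit En E -> trig f -> (fun n => En n f) @ \oo --> E f.
Proof.
move=> hEn hE lim; elim=> [t b|f1 f2 t1 h1 t2 h2|a f1 t1 h1]; first exact: lim.
- rewrite (bcmeanD hE (trig_bcont t1) (trig_bcont t2)).
  under eq_fun do rewrite (bcmeanD (hEn _) (trig_bcont t1) (trig_bcont t2)).
  exact: cvgD.
- rewrite (bcmeanZ hE a (trig_bcont t1)).
  under eq_fun do rewrite (bcmeanZ (hEn _) a (trig_bcont t1)).
  by apply: cvgM => //; exact: cvg_cst.
Qed.

Lemma trig_sin_coord (i : 'I_r) (a : R) : trig (fun x => sin (a * x 0 i)).
Proof.
have -> : (fun x => sin (a * x 0 i)) =
    (fun x => cos ((x *m (a *: delta_mx i 0 : 'cV[R]_r)) 0 0 + - (pi / 2))).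
  apply/funext => x; rewrite cosBpihalf -scalemxAr mxE; congr (sin (_ * _)).
  rewrite mxE (bigD1 i)//= big1 => [|j ji]; last by rewrite mxE (negbTE ji) mulr0.
  by rewrite mxE !eqxx mulr1 addr0.
exact: trig_cos.
Qed.

(** Bernstein polynomials as means: along the list s, a step at i raises the
    coordinate i of a random walk with probability z i, and g is evaluated
    at the end point. *)
Fixpoint walk (z : 'I_r -> R) (s : seq 'I_r) (g : ('I_r -> nat) -> R) : R :=
  if s is i :: s' then
    (1 - z i) * walk z s' g +
    z i * walk z s' (fun p => g (fun j => (j == i) + p j)%N)
  else g (fun=> 0%N).

Lemma walk_mean z s : (forall i, 0 <= z i <= 1) -> is_mean (fun=> True) (walk z s).
Proof.
move=> z01; elim: s => [|i s IH]; first by split => //= f g; exact.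
split => /= [f g|a f||f g fg].
- by rewrite !(meanD IH); ring.
- by rewrite !(meanZ IH); ring.
- by rewrite !(mean1 IH); ring.
- have /andP[z0 z1] := z01 i.
  apply: lerD; apply: ler_wpM2l; rewrite ?subr_ge0//.
    by apply: (mean_le IH) => p _; exact: fg.
  by apply: (mean_le IH) => p _; exact: fg.
Qed.

Lemma walk_trig (z : 'rV[R]_r -> 'I_r -> R) s (g : ('I_r -> nat) -> R) :
  (forall i, trig (fun x => z x i)) -> trig (fun x => walk (z x) s g).
Proof.
move=> tz; elim: s g => [|i s IH] g /=; first exact: trig_cst.
apply: trigD; apply: trigM => //.
have -> : (fun x => 1 - z x i) = (fun x => 1 + -1 * z x i).
  by apply/funext => x; rewrite mulN1r.
by apply: trigD; [exact: trig_cst|exact: trigZ].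
Qed.

(** The variance of a binomial law; the offset a carries the induction. *)
Lemma walk_var z s i a : (forall i, 0 <= z i <= 1) ->
  walk z s (fun p => ((p i)%:R - (count_mem i s)%:R * z i + a) ^+ 2) =
  (count_mem i s)%:R * (z i * (1 - z i)) + a ^+ 2.
Proof.
move=> z01; elim: s a => [|j s IH] a /=; first by rewrite !mul0r !subr0 !add0r.
have [->|ji] /= := eqVneq j i.
  rewrite add1n !mulrS.
  have hw := walk_mean s z01.
  rewrite (mean_eq hw (g := fun p => ((p i)%:R - (count_mem i s)%:R * z i + (a - z i)) ^+ 2)); last first.
    by move=> p _; ring.
  rewrite [in X in _ + X](mean_eq hw (g := fun p => ((p i)%:R - (count_mem i s)%:R * z i + (a + 1 - z i)) ^+ 2)); last first.
    by move=> p _; rewrite add1n mulrS; ring.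
  by rewrite !IH; ring.
rewrite !add0n !IH; ring.
Qed.

(** The range of sin on [-1, 1] stays away from the points -1 and 1, where
    asin is not Lipschitz. *)
Definition clip (u : R) : R := Num.max (- sin 1) (Num.min u (sin 1)).

Lemma sin1_ge0 : 0 <= sin (1 : R).
Proof. by apply/ltW/sin2_gt0; lra. Qed.

Lemma clip_itv u : - sin 1 <= clip u <= sin 1.
Proof.
rewrite /clip le_max lexx/= ge_max; have := sin1_ge0 => h.
by apply/andP; split; [lra|rewrite ge_min lexx orbT].
Qed.

Lemma clip_id u : - sin 1 <= u <= sin 1 -> clip u = u.
Proof. by move=> /andP[h1 h2]; rewrite /clip min_l// max_r. Qed.

Lemma clip_lip u v : `|clip u - clip v| <= `|u - v|.
Proof.
have h := sin1_ge0.
have cl w : [\/ (w <= - sin 1 /\ clip w = - sin 1), (- sin 1 <= w <= sin 1 /\ clip w = w)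
    | (sin 1 <= w /\ clip w = sin 1)].
  rewrite /clip; have [w1|w1] := leP w (sin 1).
    have [w2|w2] := leP w (- sin 1); first by apply: Or31.
    by apply: Or32; rewrite (ltW w2).
  apply: Or33; split; first exact: ltW.
  by rewrite max_r//; lra.
have := ler_norm (u - v); have := ler_norm (v - u); rewrite (distrC v) => h1 h2.
rewrite ler_norml; case: (cl u) => -[+ ->]; case: (cl v) => -[+ ->]; move=> hu hv;
  try (move/andP: hu => [? ?]); try (move/andP: hv => [? ?]); apply/andP; split; lra.
Qed.

Let sin1_le1 : sin (1 : R) <= 1. Proof. exact: sin_le1. Qed.

Lemma asin_clip u : -1 <= asin (clip u) <= 1.
Proof.
have /andP[h1 h2] := clip_itv u; have s1 := sin1_le1.
have c1 : -1 <= clip u <= 1 by apply/andP; split; lra.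
have p1 := @pihalf_ge1 R.
have ai : asin (clip u) \in `[(- (pi / 2)), (pi / 2)]%R.
  by rewrite in_itv/= asin_geNpi2 ?asin_lepi2.
have sE : sin (asin (clip u)) = clip u by rewrite asinK.
apply/andP; split; rewrite leNgt; apply/negP => h.
  have : sin (asin (clip u)) < sin (-1).
    by rewrite ltr_sin// in_itv/=; apply/andP; split; lra.
  by rewrite sE sinN; lra.
have : sin 1 < sin (asin (clip u)).
  by rewrite ltr_sin// in_itv/=; apply/andP; split; lra.
by rewrite sE; lra.
Qed.

Lemma sin_expand a b : -1 <= a <= 1 -> -1 <= b <= 1 ->
  cos 1 * `|a - b| <= `|sin a - sin b| :> R.
Proof.
wlog ba : a b / b <= a.
  move=> H ha hb; have [|ab] := leP b a; first by move=> ?; exact: H.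
  by rewrite distrC (distrC (sin a)); apply: H => //; exact: ltW.
move=> /andP[a1 a2] /andP[b1 b2].
move: ba; rewrite le_eqVlt => /predU1P[->|ba]; first by rewrite !subrr normr0 mulr0.
have [|c /itvP cab ->] := @MVT _ sin cos b a ba (fun z _ => is_derive_sin z).
  by apply: derivable_within_continuous => z _; exact: derivable_sin.
rewrite normrM ler_wpM2r//; apply: le_trans (ler_norm _).
rewrite -(cos_norm c) leNgt; apply/negP.
have c1 : `|c| <= 1.
  have := cab; rewrite ler_norml => h; apply/andP; split.
    by apply/ltW/(le_lt_trans b1); rewrite h.
  by apply/ltW/(lt_le_trans _ a2); rewrite h.
have p2 := @pi_ge2 R.
rewrite ltr_cos ?in_itv/= ?normr_ge0/=; [|lra|lra].
by rewrite ltNge c1.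
Qed.

Lemma asin_clip_lip u v : `|asin (clip u) - asin (clip v)| <= (cos 1)^-1 * `|u - v|.
Proof.
rewrite -(ler_pM2l (cos1_gt0 R)) mulrA mulfV ?gt_eqF ?cos1_gt0// mul1r.
apply: le_trans (sin_expand (asin_clip u) (asin_clip v)) _.
have s1 := sin1_le1.
have /andP[h1 h2] := clip_itv u; have /andP[h3 h4] := clip_itv v.
rewrite !asinK ?in_itv/=; [exact: clip_lip| |];
  by apply/andP; split; lra.
Qed.

(** Heine's theorem on a cube, except that the second point may lie outside
    of it. *)
Lemma uniform_on_cube h (L e : R) : continuous h -> 0 < e -> exists2 d : R, 0 < d &
  forall x (y : 'rV[R]_r), (forall i, `|x 0 i| <= L) ->
    (forall i, `|y 0 i - x 0 i| < d) -> `|h y - h x| <= e.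
Proof.
move=> ch e0.
have cK : compact [set x : 'rV[R]_r | forall i, `[- L, L]%classic (x 0 i)].
  by apply: (@rV_compact R r (fun=> `[- L, L]%classic)) => i; exact: segment_compact.
move/compact_near_coveringP : cK => /(_ R (0^'+)
  (fun d x => forall y : 'rV[R]_r, (forall i, `|y 0 i - x 0 i| < d) -> `|h y - h x| <= e)) H.
have {}H : \forall d \near 0^'+, [set x : 'rV[R]_r | forall i, `[- L, L]%classic (x 0 i)] `<=`
    (fun x => forall y : 'rV[R]_r, (forall i, `|y 0 i - x 0 i| < d) -> `|h y - h x| <= e).
  apply: H => x _.
  have : \forall y \near x, `|h x - h y| < e / 2.
    have /cvgrPdist_lt hx := ch x.
    by apply: hx; rewrite divr_gt0.
  move=> /nbhs_ballP[d /= d0 hd].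
  exists (ball x (d / 2), [set t : R | t < d / 2]) => /=.
    split; first by apply: nbhsx_ballx; rewrite divr_gt0.
    by apply: nbhs_right_lt; rewrite divr_gt0.
  move=> [x' t] /= [xx' td] y yx'.
  have h1 : `|h x - h x'| < e / 2 by apply: hd; apply: (le_ball _ xx'); lra.
  have h2 : `|h x - h y| < e / 2.
    apply: hd; split=> // i j; have [_ /(_ i j)] := xx'; rewrite (ord1 i) /ball/= => h2.
    have h3 := lt_trans (yx' j) td.
    apply: (le_lt_trans (ler_distD (x' 0 j) _ _)).
    by rewrite (distrC (x' 0 j)); lra.
  have := ler_distD (h x) (h y) (h x'); rewrite (distrC (h y) (h x)); lra.
near (0 : R)^'+ => d.
exists d; first by near: d; exact: nbhs_right_gt.
move=> x y xL; apply: (near H d) => // i /=.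
by rewrite in_itv/= -ler_norml.
Unshelve. all: by end_near.
Qed.

(** Weierstrass approximation on a cube which keeps the sup norm everywhere:
    on the cube x_i = L asin (sin (x_i / L)), and the Bernstein polynomials
    of z -> h (L asin (2 z - 1)) are taken at the points z_i = (1 + sin (x_i
    / L)) / 2, which lie in [0, 1] for all x. *)
Lemma trig_approx h (L e : R) : continuous h -> (exists M, forall x, `|h x| <= M) ->
  0 < L -> 0 < e -> exists Q, [/\ trig Q,
    (forall M, (forall x, `|h x| <= M) -> forall x, `|Q x| <= M) &
    forall x, (forall i, `|x 0 i| <= L) -> `|Q x - h x| <= e].
Proof.
move=> ch [M hM] L0 e0.
have M0 : 0 <= M by apply: le_trans (hM 0).
have e2 : 0 < e / 2 by rewrite divr_gt0.
have [d d0 hd] := uniform_on_cube L ch e2.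
pose theta (y : 'I_r -> R) : 'rV[R]_r := \row_i (L * asin (clip (2 * y i - 1))).
pose z x i := 2^-1 * (1 + sin (L^-1 * x 0 i)) : R.
have z01 x i : 0 <= z x i <= 1.
  have := sin_le1 (L^-1 * x 0 i); have := sin_geN1 (L^-1 * x 0 i); rewrite /z.
  by move=> ? ?; apply/andP; split; lra.
have tz i : trig (fun x => z x i).
  apply: trigZ; apply: trigD; [exact: trig_cst|exact: trig_sin_coord].
pose A := 2 * M * (2 * L / cos 1) ^+ 2 / d ^+ 2.
have A0 : 0 <= A.
  by rewrite /A divr_ge0 ?sqr_ge0// mulr_ge0 ?sqr_ge0// mulr_ge0.
(* Chebyshev's inequality with variance at most N in each coordinate leaves the
   error A r / N, which is at most e / 2 *)
pose N := (Num.truncn (A * r%:R / (e / 2))).+1.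
have Ne : A * r%:R <= N%:R * (e / 2).
  by rewrite -ler_pdivrMr// ltW// /N; exact: truncnS_gt.
have N0 : 0 < N%:R :> R by rewrite ltr0n.
pose s := flatten (nseq N (enum 'I_r)).
have cs i : count_mem i s = N.
  rewrite /s; elim: (N) => //= n IH; rewrite count_cat IH.
  by rewrite count_uniq_mem ?enum_uniq// mem_enum.
pose Q x := walk (z x) s (fun p => h (theta (fun i => (p i)%:R / N%:R))).
exists Q; split.
- exact: walk_trig.
- move=> M' hM' x; apply: (mean_norm_ub (walk_mean s (z01 x))) => p _; exact: hM'.
move=> x xL.
have hw := walk_mean s (z01 x).
have xz i : L * asin (clip (2 * z x i - 1)) = x 0 i.
  have -> : 2 * z x i - 1 = sin (L^-1 * x 0 i) by rewrite /z; field.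
  have xi : -1 <= L^-1 * x 0 i <= 1.
    rewrite -ler_norml normrM gtr0_norm ?invr_gt0// mulrC ler_pdivrMr// mul1r.
    exact: xL.
  have p1 := @pihalf_ge1 R; have /andP[x1 x2] := xi.
  have i1 : (L^-1 * x 0 i) \in `[(- (pi / 2)), (pi / 2)]%R.
    by rewrite in_itv/=; apply/andP; split; lra.
  have j1 : (1 : R) \in `[(- (pi / 2)), (pi / 2)]%R.
    by rewrite in_itv/=; apply/andP; split; lra.
  have j2 : (-1 : R) \in `[(- (pi / 2)), (pi / 2)]%R.
    by rewrite in_itv/=; apply/andP; split; lra.
  rewrite clip_id ?sinK//; first by rewrite mulVKf ?gt_eqF.
  rewrite -sinN; apply/andP; split; rewrite leNgt; apply/negP.
    by rewrite ltr_sin// ltNge x1.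
  by rewrite ltr_sin// ltNge x2.
rewrite -(mean_cst hw (h x)).
apply: (@le_trans _ _ (walk (z x) s (fun p => e / 2 + A / N%:R ^+ 2 *
    \sum_i ((p i)%:R - (count_mem i s)%:R * z x i + 0) ^+ 2))).
  apply: (mean_dist hw) => p _.
  pose D i := (p i)%:R - N%:R * z x i.
  have S0 : 0 <= A / N%:R ^+ 2 * \sum_i D i ^+ 2.
    rewrite mulr_ge0//; first by rewrite divr_ge0// exprn_ge0// ltW.
    by apply: sumr_ge0 => i _; exact: sqr_ge0.
  rewrite (eq_bigr (fun i => D i ^+ 2)); last by move=> i _; rewrite cs addr0.
  set y := theta _.
  have yx i : `|y 0 i - x 0 i| <= 2 * L / cos 1 * `|D i / N%:R|.
    rewrite /y mxE -(xz i) -mulrBr normrM gtr0_norm//.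
    apply: le_trans (ler_wpM2l (ltW L0) (asin_clip_lip _ _)) _.
    rewrite (_ : 2 * ((p i)%:R / N%:R) - 1 - (2 * z x i - 1) = 2 * (D i / N%:R)); last first.
      by rewrite /D; field; rewrite gt_eqF.
    rewrite normrM (ger0_norm (ler0n R 2)) le_eqVlt; apply/orP; left; apply/eqP.
    by ring.
  have [near|] := pselect (forall i, `|y 0 i - x 0 i| < d).
    by apply: le_trans (hd x y xL near) _; rewrite lerDl.
  move=> /existsNP[i /negP]; rewrite -leNgt => di.
  apply: (@le_trans _ _ (2 * M)).
    by apply: le_trans (ler_normB _ _) _; have := hM y; have := hM x; lra.
  apply: (@le_trans _ _ (A / N%:R ^+ 2 * D i ^+ 2)); last first.
    rewrite (bigD1 i)//= mulrDr; apply: (@le_trans _ _ (A / N%:R ^+ 2 * D i ^+ 2 + 0)).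
      by rewrite addr0.
    rewrite addrCA lerD2l addr_ge0 ?(ltW e2)// mulr_ge0//.
      by rewrite divr_ge0// exprn_ge0// ltW.
    by apply: sumr_ge0 => j _; exact: sqr_ge0.
  have h1 : d ^+ 2 <= (2 * L / cos 1 * `|D i / N%:R|) ^+ 2.
    rewrite lerXn2r ?nnegrE ?(ltW d0)//; last exact: le_trans (yx i).
    by rewrite mulr_ge0// divr_ge0 ?mulr_ge0 ?(ltW L0) ?(ltW (cos1_gt0 R)).
  rewrite exprMn real_normK ?num_real// in h1.
  rewrite [leRHS](_ : _ = 2 * M * ((2 * L / cos 1) ^+ 2 * (D i / N%:R) ^+ 2 / d ^+ 2)); last first.
    by rewrite /A; field; rewrite !gt_eqF ?cos1_gt0.
  by rewrite ler_peMr ?mulr_ge0// ler_pdivlMr ?exprn_gt0// mul1r.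
rewrite (meanD hw) (mean_cst hw) (meanZ hw) (mean_sum hw).
under eq_bigr do rewrite (walk_var _ _ _ (z01 x)) cs expr0n/= addr0.
rewrite -[leRHS](_ : e / 2 + e / 2 = e); last by field.
rewrite lerD2l.
apply: (@le_trans _ _ (A / N%:R ^+ 2 * \sum_(i < r) N%:R)).
  apply: ler_wpM2l; first by rewrite divr_ge0// exprn_ge0// ltW.
  apply: ler_sum => i _; have /andP[z0 z1] := z01 x i.
  by rewrite ler_piMr ?ler0n// mulr_ile1// ?subr_ge0// gerBl.
rewrite sum_cst [leLHS](_ : _ = A * r%:R / N%:R); last by field; rewrite gt_eqF.
by rewrite ler_pdivrMr// [leRHS]mulrC.
Qed.

(** A bounded continuous majorant of the indicator of the complement of the
    cube with half-side L; it expresses tightness for functionals that are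
    only known on bounded continuous functions. *)
Definition tail (L : R) x : R := \sum_i Num.min 1 ((L^-1 * x 0 i) ^+ 2).

Lemma tail_bcont L : bcont (tail L).
Proof.
split; last first.
  exists r%:R => x; rewrite ger0_norm; last first.
    by apply: sumr_ge0 => i _; rewrite le_min ler01 sqr_ge0.
  rewrite -[leRHS]mulr1 -sum_cst; apply: ler_sum => i _.
  by rewrite ge_min lexx.
apply: continuous_sum_ord => i x.
apply: (@continuous_min _ _ (fun=> 1 : R) (fun x => (L^-1 * x 0 i) ^+ 2)); first exact: cst_continuous.
rewrite (_ : (fun x => _) = (fun x => (L^-1 * x 0 i) * (L^-1 * x 0 i))); last first.
  by apply/funext => y; rewrite expr2.
have c : {for x, continuous (fun x => L^-1 * x 0 i)}.
  by apply: continuousM; [exact: cst_continuous|exact: coord_continuous].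
exact: (continuousM c c).
Qed.

Lemma tail_ge1 L x : 0 < L -> ~ (forall i, `|x 0 i| <= L) -> 1 <= tail L x.
Proof.
move=> L0 /existsNP[i /negP]; rewrite -ltNge => Lx.
rewrite /tail (bigD1 i)//= -[leLHS]addr0; apply: lerD.
  rewrite le_min lexx/= -(real_normK (num_real _)) normrM gtr0_norm ?invr_gt0//.
  by rewrite exprn_ege1// mulrC ler_pdivlMr// mul1r ltW.
by apply: sumr_ge0 => j _; rewrite le_min ler01 sqr_ge0.
Qed.

Lemma tail_le (L L' : R) x : 0 < L -> L <= L' -> tail L' x <= tail L x.
Proof.
move=> L0 LL'; apply: ler_sum => i _; rewrite le_min ge_min lexx/= ge_min.
apply/orP; right; rewrite -(real_normK (num_real (L' ^-1 * _))) -(real_normK (num_real (L ^-1 * _))).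
rewrite lerXn2r ?nnegrE// !normrM ler_wpM2r//.
have L'0 := lt_le_trans L0 LL'.
by rewrite !gtr0_norm ?invr_gt0// lef_pV2.
Qed.

Lemma tail_ge0 L x : 0 <= tail L x.
Proof. by apply: sumr_ge0 => j _; rewrite le_min ler01 sqr_ge0. Qed.

(** A continuity theorem for characteristic functions: h is replaced by a
    trigonometric polynomial which is close to h on a large cube and obeys
    the same bound outside, where tightness applies. *)
Lemma trig_weak_limit En E h : (forall n, is_bcmean (En n)) -> is_bcmean E ->
  trig_limit En E ->
  (forall e, 0 < e -> exists2 L, 0 < L &
     E (tail L) <= e /\ \forall n \near \oo, En n (tail L) <= e) ->
  bcont h -> (fun n => En n h) @ \oo --> E h.
Proof.
move=> hEn hE lim tight [ch [M hM]].
have M0 : 0 <= M by apply: le_trans (hM 0).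
apply/cvgrPdist_le => e e0.
pose e1 := e / (5 + 4 * M).
have D0 : 0 < 5 + 4 * M by lra.
have e10 : 0 < e1 by rewrite divr_gt0.
have [L L0 [EL EnL]] := tight _ e10.
have [Q [tQ Qb Qh]] := trig_approx ch (ex_intro _ M hM) L0 e10.
have bh : bcont h by split => //; exists M.
have bT := tail_bcont L.
have bTM : bcont (fun x => 2 * M * tail L x).
  split; first by move=> x; exact: (continuousM (@cst_continuous _ _ (2 * M) x) (bT.1 x)).
  by case: bT.2 => K hK; exists (`|2 * M| * K) => x; rewrite normrM ler_wpM2l.
have be : bcont (fun=> e1 : R) by exact: trig_bcont (trig_cst e1).
have bR : bcont (fun x => e1 + 2 * M * tail L x).
  split; first by move=> x; exact: (continuousD (be.1 x) (bTM.1 x)).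
  case: bTM.2 => K hK; exists (e1 + K) => x.
  by apply: le_trans (ler_normD _ _) _; rewrite gtr0_norm// lerD2l.
have bQ := trig_bcont tQ.
have pw x : `|Q x - h x| <= e1 + 2 * M * tail L x.
  have [inL|outL] := pselect (forall i, `|x 0 i| <= L).
    by apply: le_trans (Qh x inL) _; rewrite lerDl mulr_ge0 ?tail_ge0 ?mulr_ge0.
  have := tail_ge1 L0 outL => t1.
  apply: (@le_trans _ _ (2 * M)).
    by apply: le_trans (ler_normB _ _) _; have := hM x; have := Qb _ hM x; lra.
  apply: (@le_trans _ _ (2 * M * tail L x)); first by rewrite ler_peMr// mulr_ge0.
  by rewrite lerDr ltW.
have cmp F : is_bcmean F -> F (tail L) <= e1 -> `|F Q - F h| <= e1 + 2 * M * e1.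
  move=> hF FL.
  have FR : F (fun x => e1 + 2 * M * tail L x) <= e1 + 2 * M * e1.
    rewrite (bcmeanD hF be bTM) (bcmeanZ hF (2 * M) bT).
    have -> : F (fun=> e1) = e1.
      rewrite (_ : (fun=> e1) = (fun x : 'rV[R]_r => e1 * (fun=> 1) x)); last first.
        by apply/funext => x; rewrite mulr1.
      by rewrite (bcmeanZ hF e1 (trig_bcont (trig_cst 1))) (bcmean1 hF) mulr1.
    by rewrite lerD2l ler_wpM2l// mulr_ge0.
  have bsum (f : 'rV[R]_r -> R) : bcont f -> bcont (fun x => f x + (e1 + 2 * M * tail L x)).
    move=> [cf [K1 hK1]]; case: bR => cR [K2 hK2]; split.
      by move=> x; exact: (continuousD (cf x) (cR x)).
    by exists (K1 + K2) => x; rewrite (le_trans (ler_normD _ _))// lerD.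
  have h1 : F Q <= F (fun x => h x + (e1 + 2 * M * tail L x)).
    apply: (bcmean_le hF) => //; first exact: bsum.
    by move=> x; have := pw x; rewrite ler_norml => /andP[_ ?]; lra.
  have h2 : F h <= F (fun x => Q x + (e1 + 2 * M * tail L x)).
    apply: (bcmean_le hF) => //; first exact: bsum.
    by move=> x; have := pw x; rewrite ler_norml => /andP[? _]; lra.
  rewrite (bcmeanD hF bh bR) in h1; rewrite (bcmeanD hF bQ bR) in h2.
  by rewrite ler_norml; apply/andP; split; lra.
have eE : e = 5 * e1 + 4 * M * e1 by rewrite /e1; field; rewrite gt_eqF.
have := trig_cvg hEn hE lim tQ => /cvgrPdist_le/(_ _ e10) QE.
near=> n.
have c1 := cmp E hE EL.
have c2 : `|En n Q - En n h| <= e1 + 2 * M * e1 by apply: cmp => //; near: n; exact: EnL.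
have c3 : `|E Q - En n Q| <= e1 by near: n; exact: QE.
move: c1 c2 c3; rewrite !ler_norml => /andP[? ?] /andP[? ?] /andP[? ?].
by rewrite eE; apply/andP; split; lra.
Unshelve. all: by end_near.
Qed.

End TrigApprox.

(** * The characteristic function of a normal law *)

Section NormalCharacteristic.
Context {R : realType}.
Variable s : R.
Hypothesis s0 : 0 < s.
Local Notation mu := (@lebesgue_measure R).
Let sn0 : s != 0. Proof. by rewrite gt_eqF. Qed.
Let p (x : R) : R := normal_pdf 0 s x.

Lemma integral_normal_prob f :
  measurable_fun setT f -> (normal_prob 0 s).-integrable setT f ->
  (\int[normal_prob 0 s]_x f x = \int[mu]_x (f x * (p x)%:E))%E.
Proof.
move=> mf intf.
have dom : normal_prob 0 s `<< mu by exact: normal_prob_dominates.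
rewrite -(Radon_Nikodym_change_of_variables dom)//=.
apply: ae_eq_integral => //.
- apply: emeasurable_funM => //; apply: (measurable_int mu).
- apply: emeasurable_funM => //=; apply/measurable_EFinP.
  exact: measurable_normal_pdf.
- apply: ae_eqe_mul2l => /=.
  rewrite Radon_NikodymE/=.
  case: cid => /= h [h1 h2 h3].
  apply: integral_ae_eq => //=.
  + by apply/measurable_EFinP; exact: measurable_normal_pdf.
  + by move=> E _ mE; rewrite -h3.
Qed.

Lemma pdfE x : p x = normal_peak s * expR (- x ^+ 2 / (s ^+ 2 *+ 2)).
Proof. by rewrite /p normal_pdfE// /normal_fun subr0. Qed.

Lemma pdf_ge0 x : 0 <= p x. Proof. exact: normal_pdf_ge0. Qed.

Lemma measurable_pdf : measurable_fun setT p.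
Proof. exact: measurable_normal_pdf. Qed.

Lemma continuous_pdf : continuous p.
Proof. exact: continuous_normal_pdf. Qed.

Lemma is_derive_pdf (x : R) : is_derive x 1 p (- (x / s ^+ 2 * p x)).
Proof.
have -> : p = (fun x => normal_peak s * expR (- x ^+ 2 / (s ^+ 2 *+ 2))).
  by apply/funext => y; rewrite pdfE.
have h : is_derive x 1 (fun x : R => - x ^+ 2 / (s ^+ 2 *+ 2)) (- (x / s ^+ 2)).
  apply: is_derive_eq; rewrite /GRing.scale/=; by field.
apply: is_derive_eq; rewrite /GRing.scale/=; by field.
Qed.

Lemma integrable_pdf : mu.-integrable setT (EFin \o p).
Proof. exact: integrable_normal_pdf. Qed.

Lemma integrable_bounded_pdf (f : R -> R) (M : R) : measurable_fun setT f ->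
  (forall x, `|f x| <= M) -> mu.-integrable setT (EFin \o (fun x => f x * p x)).
Proof.
move=> mf fM.
apply: (@le_integrable _ _ _ mu _ measurableT _ (fun x => (M * p x)%:E)).
- by apply/measurable_EFinP/measurable_funM => //; exact: measurable_pdf.
- move=> x _ /=; rewrite lee_fin !normrM ler_wpM2r//.
  exact: le_trans (fM x) (ler_norm _).
- rewrite (_ : (fun x => _) = (fun x => M%:E * (p x)%:E)%E)//.
  by apply: integrableZl => //; exact: integrable_pdf.
Qed.

(** |x| exp (- x^2 / (2 s^2)) is at most s times exp (- x^2 / (4 s^2)),
    which is proportional to a normal density of variance 2 s^2. *)
Definition pdf_env (x : R) : R :=
  s * normal_peak s / normal_peak (Num.sqrt 2 * s) * normal_pdf 0 (Num.sqrt 2 * s) x.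

Let s2n0 : Num.sqrt 2 * s != 0.
Proof. by rewrite mulf_neq0// gt_eqF// sqrtr_gt0. Qed.

Lemma pdf_env_ge x : `|x| * p x <= pdf_env x.
Proof.
rewrite /pdf_env normal_pdfE// pdfE /normal_fun subr0 exprMn sqr_sqrtr//.
have P0 := normal_peak_ge0 s; have P2 := normal_peak_gt0 s2n0.
set e1 := expR _; set e2 := expR _; move: P0 P2.
move: (normal_peak s) (normal_peak (Num.sqrt 2 * s)) => P Q P0 Q0.
have -> : s * P / Q * (Q * e2) = P * (s * e2).
  by field; rewrite gt_eqF.
rewrite mulrCA ler_wpM2l// /e1 /e2.
pose y := x / s.
have xE : x = s * y by rewrite /y mulrC divfK.
have -> : - x ^+ 2 / (s ^+ 2 *+ 2) = - (y ^+ 2 / 4) + - x ^+ 2 / (2 * s ^+ 2 *+ 2).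
  by rewrite xE; field.
rewrite expRD mulrA ler_wpM2r ?expR_ge0//.
rewrite xE normrM gtr0_norm// -mulrA ler_piMr ?(ltW s0)//.
rewrite expRN ler_pdivrMr ?expR_gt0// mul1r.
apply: le_trans (expR_ge1Dx _).
rewrite -(real_normK (num_real y)).
have := sqr_ge0 (`|y| / 2 - 1); lra.
Qed.

Lemma pdf_env_ge0 x : 0 <= pdf_env x.
Proof. by apply: le_trans (pdf_env_ge x); rewrite mulr_ge0 ?pdf_ge0. Qed.

Lemma integrable_pdf_env : mu.-integrable setT (EFin \o pdf_env).
Proof.
rewrite (_ : EFin \o pdf_env = (fun x => (s * normal_peak s / normal_peak (Num.sqrt 2 * s))%:E *
   (normal_pdf 0 (Num.sqrt 2 * s) x)%:E)%E)//.
by apply: integrableZl => //; exact: integrable_normal_pdf.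
Qed.

Section Wave.
Variables (t b : R).

Let stein (x : R) : R := t * cos (t * x + b) * p x - sin (t * x + b) * (x / s ^+ 2 * p x).
Let wave (x : R) : R := sin (t * x + b) * p x.

Lemma is_derive_wave (x : R) : is_derive x 1 wave (stein x).
Proof.
have h := is_derive_pdf x.
apply: is_derive_eq; rewrite /GRing.scale/= /stein; ring.
Qed.

Lemma continuous_affine_cos : continuous (fun x : R => cos (t * x + b)).
Proof.
move=> x; apply: (@continuous_comp _ _ _ (fun x => t * x + b) cos); last exact: continuous_cos.
apply: continuousD; last exact: cst_continuous.
by apply: continuousM; [exact: cst_continuous|].
Qed.

Lemma continuous_affine_sin : continuous (fun x : R => sin (t * x + b)).
Proof.
move=> x; apply: (@continuous_comp _ _ _ (fun x => t * x + b) sin); last exact: continuous_sin.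
apply: continuousD; last exact: cst_continuous.
by apply: continuousM; [exact: cst_continuous|].
Qed.

Lemma continuous_stein : continuous stein.
Proof.
have c0 : continuous (fun x : R => t * cos (t * x + b)).
  by move=> x; apply: continuousM; [exact: cst_continuous|exact: continuous_affine_cos].
have c1 : continuous (fun x : R => t * cos (t * x + b) * p x).
  by move=> x; exact: (continuousM (c0 x) (@continuous_pdf x)).
have c3 : continuous (fun x : R => x / s ^+ 2).
  exact: mulrr_continuous.
have c2 : continuous (fun x : R => sin (t * x + b) * (x / s ^+ 2 * p x)).
  move=> x; have c4 := continuousM (c3 x) (@continuous_pdf x).
  exact: (continuousM (@continuous_affine_sin x) c4).
by move=> x; exact: (continuousB (c1 x) (c2 x)).
Qed.

Lemma measurable_cos_affine : measurable_fun setT (fun x : R => cos (t * x + b)).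
Proof. exact: continuous_measurable_fun continuous_affine_cos. Qed.

Lemma measurable_sin_affine : measurable_fun setT (fun x : R => sin (t * x + b)).
Proof. exact: continuous_measurable_fun continuous_affine_sin. Qed.

Lemma integrable_cos : mu.-integrable setT (EFin \o (fun x => cos (t * x + b) * p x)).
Proof.
by apply: (@integrable_bounded_pdf _ 1); [exact: measurable_cos_affine|move=> x; exact: cos_max].
Qed.

Lemma integrable_xsin : mu.-integrable setT (EFin \o (fun x => - (x * sin (t * x + b)) * p x)).
Proof.
apply: (@le_integrable _ _ _ mu _ measurableT _ (EFin \o pdf_env)); last exact: integrable_pdf_env.
- apply/measurable_EFinP/measurable_funM; last exact: measurable_pdf.
  apply: measurableT_comp => //; apply: measurable_funM => //.
  exact: measurable_sin_affine.
- move=> x _ /=; rewrite lee_fin (ger0_norm (pdf_env_ge0 x)).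
  apply: le_trans (pdf_env_ge x); rewrite normrM normrN (ger0_norm (pdf_ge0 x)).
  by rewrite ler_wpM2r ?pdf_ge0// normrM ler_piMr// sin_max.
Qed.

Lemma steinE : stein = (fun x => t * (cos (t * x + b) * p x) +
  (s ^+ 2)^-1 * (- (x * sin (t * x + b)) * p x)).
Proof. by apply/funext => x; rewrite /stein; field. Qed.

Lemma integrable_stein : mu.-integrable setT (EFin \o stein).
Proof.
rewrite steinE (_ : EFin \o _ = (fun x => t%:E * (cos (t * x + b) * p x)%:E +
  ((s ^+ 2)^-1)%:E * (- (x * sin (t * x + b)) * p x)%:E)%E); last first.
  by apply/funext => x /=.
apply: integrableD => //; apply: integrableZl => //; [exact: integrable_cos|exact: integrable_xsin].
Qed.

Lemma pdf_decay (x : R) : 0 < x -> p x <= normal_peak s * (s ^+ 2 *+ 2) / x ^+ 2.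
Proof.
move=> x0; rewrite pdfE -mulrA ler_wpM2l ?normal_peak_ge0// mulNr expRN.
have d0 : 0 < s ^+ 2 *+ 2 by rewrite mulrn_wgt0// exprn_gt0.
rewrite -[leRHS]invrK lef_pV2 ?posrE ?expR_gt0 ?invr_gt0 ?divr_gt0 ?exprn_gt0//.
rewrite invfM invrK mulrC.
by apply: le_trans (expR_ge1Dx _); rewrite lerDr.
Qed.

(** Stein's identity: the integrand is the derivative of a function that
    vanishes at both infinities. *)
Lemma normal_stein : (\int[mu]_x (stein x)%:E = 0)%E.
Proof.
pose I n := `[- n.+1%:R, n.+1%:R]%classic : set R.
have ftc n : (\int[mu]_(x in I n) (stein x)%:E = (wave n.+1%:R - wave (- n.+1%:R))%:E)%E.
  rewrite EFinB; apply: continuous_FTC2.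
  - by rewrite -subr_gt0 opprK -natrD ltr0n.
  - by apply: continuous_subspaceT => x; exact: continuous_stein.
  - have cw : continuous wave.
      by move=> x; exact: (continuousM (@continuous_affine_sin x) (@continuous_pdf x)).
    split.
    + by move=> x _; exact: (@ex_derive _ _ _ _ _ _ _ (is_derive_wave x)).
    + by apply: cvg_at_right_filter; exact: cw.
    + by apply: cvg_at_left_filter; exact: cw.
  - by move=> x _; rewrite derive1E; exact: (@derive_val _ _ _ _ _ _ _ (is_derive_wave x)).
have l1 : (fun n => \int[mu]_(x in I n) (stein x)%:E)%E @ \oo --> (0 : R)%:E.
  under eq_fun do rewrite ftc.
  apply: cvg_EFin; first exact: nearW.
  pose K := 2 * (normal_peak s * (s ^+ 2 *+ 2)).
  have Kc : (fun n => K * n.+1%:R^-1) @ \oo --> (0 : R).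
    rewrite -[X in _ --> X](mulr0 K); apply: cvgM; first exact: cvg_cst.
    exact: cvg_harmonic.
  apply/norm_cvg0P; apply: (squeeze_cvgr _ (cvg_cst 0) Kc); near=> n.
  rewrite normr_ge0/=.
  have z0 : 0 < n.+1%:R :> R by [].
  have z1 : 1 <= n.+1%:R :> R by rewrite ler1n.
  have pN x : p (- x) = p x by rewrite !pdfE sqrrN.
  have h := pdf_decay z0.
  have h2 : normal_peak s * (s ^+ 2 *+ 2) / n.+1%:R ^+ 2 <= normal_peak s * (s ^+ 2 *+ 2) * n.+1%:R^-1.
    rewrite ler_wpM2l ?mulr_ge0 ?normal_peak_ge0 ?mulrn_wge0 ?sqr_ge0//.
    by rewrite expr2 invfM ler_piMl ?invr_ge0// invf_le1.
  have h3 := le_trans h h2.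
  apply: le_trans (ler_normB _ _) _; rewrite /wave pN !normrM (ger0_norm (pdf_ge0 _)).
  have a1 := sin_max (t * n.+1%:R + b); have a2 := sin_max (t * - n.+1%:R + b).
  have g1 := ler_wpM2r (pdf_ge0 n.+1%:R) a1; have g2 := ler_wpM2r (pdf_ge0 n.+1%:R) a2.
  rewrite mul1r in g1; rewrite mul1r in g2.
  apply: le_trans (lerD (le_trans g1 h3) (le_trans g2 h3)) _.
  by rewrite /K le_eqVlt; apply/orP; left; apply/eqP; ring.
have l2 : (fun n => \int[mu]_(x in I n) (stein x)%:E)%E @ \oo --> (\int[mu]_x (stein x)%:E)%E.
  under eq_fun do rewrite integral_mkcond.
  have ms : measurable_fun setT (EFin \o stein).
    by apply/measurable_EFinP; exact: continuous_measurable_fun continuous_stein.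
  apply: (@dominated_cvg _ _ _ mu setT measurableT
    (fun n => (EFin \o stein) \_ (I n)) (EFin \o stein) (fun x => `|stein x|%:E)).
  - move=> n; apply/(measurable_restrictT _ _).1 => //.
      exact: measurable_itv.
    exact: measurable_funTS.
  - move=> x _; apply: cvg_near_cst; near=> n; rewrite patchE ifT// inE /I/= in_itv/=.
    rewrite -ler_norml; apply: (@le_trans _ _ n%:R); last by rewrite ler_nat.
    near: n; exact: nbhs_infty_ger.
  - by [].
  - exact: (integrable_norm integrable_stein).
  - move=> n x _; rewrite patchE; case: ifP => _ //=.
    by rewrite normr0 lee_fin.
exact: (cvg_unique _ l2 l1).
Unshelve. all: by end_near.
Qed.

End Wave.

Let J (b t : R) : R := \int[mu]_x (cos (t * x + b) * p x).
Let J' (b t : R) : R := \int[mu]_x (- (x * sin (t * x + b)) * p x).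

(** Differentiating under the integral and applying Stein's identity gives
    the linear equation J' = - s^2 t J. *)
Lemma charfun_deriv b t : J' b t = - (s ^+ 2 * t * J b t).
Proof.
have h : t * J b t + (s ^+ 2)^-1 * J' b t = 0.
  rewrite /J /J' -!RintegralZl//; [|exact: integrable_xsin|exact: integrable_cos].
  rewrite -RintegralD//.
  - rewrite -[RHS]/(fine 0%E) -(normal_stein t b); congr fine.
    by apply: eq_integral => x _ /=; congr (_%:E); field.
  - exact: (integrableZl measurableT t (integrable_cos t b)).
  - exact: (integrableZl measurableT (s ^+ 2)^-1 (integrable_xsin t b)).
have : s ^+ 2 * (t * J b t + (s ^+ 2)^-1 * J' b t) = 0 by rewrite h mulr0.
rewrite mulrDr mulVKf ?gt_eqF ?exprn_gt0// mulrA => h1; lra.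
Qed.

Lemma is_derive_charfun (b t : R) : is_derive t 1 (J b) (J' b t).
Proof.
have d1 (u x : R) : is_derive u 1 (fun u : R => cos (u * x + b) * p x) (- (x * sin (u * x + b)) * p x).
  apply: is_derive_eq; rewrite /GRing.scale/=; ring.
have It : `]t - 1, t + 1[%classic t by rewrite /= in_itv/=; apply/andP; split; lra.
have A : forall u, `]t - 1, t + 1[%classic u -> mu.-integrable setT (EFin \o (fun x => cos (u * x + b) * p x)).
  by move=> u _; exact: integrable_cos.
have D : forall u x : R, `]t - 1, t + 1[%classic u -> setT x -> derivable (fun u : R => cos (u * x + b) * p x) u 1.
  by move=> u x _ _; exact: (@ex_derive _ _ _ _ _ _ _ (d1 u x)).
have dE (u x : R) : partial1of2 (fun u x : R => cos (u * x + b) * p x) u x = - (x * sin (u * x + b)) * p x.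
  by rewrite partial1of2E; exact: (@derive_val _ _ _ _ _ _ _ (d1 u x)).
have G : forall u x : R, `]t - 1, t + 1[%classic u -> setT x -> `|partial1of2 (fun u x : R => cos (u * x + b) * p x) u x| <= pdf_env x.
  move=> u x _ _; rewrite dE; apply: le_trans (pdf_env_ge x).
  rewrite normrM normrN (ger0_norm (pdf_ge0 x)) ler_wpM2r ?pdf_ge0//.
  by rewrite normrM ler_piMr// sin_max.
apply: DeriveDef.
  exact: (@derivable_under_integral _ _ _ mu _ _ measurableT _ _ _ It A D _ pdf_env_ge0 integrable_pdf_env G).
rewrite -derive1E (@differentiation_under_integral _ _ _ mu _ _ measurableT _ _ _ It A D _ pdf_env_ge0 integrable_pdf_env G).
by apply: eq_Rintegral => x _; rewrite dE.
Qed.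

Lemma charfunE b t : J b t = cos b * expR (- (s ^+ 2 * t ^+ 2 / 2)).
Proof.
pose H u := J b u * expR (s ^+ 2 * u ^+ 2 / 2).
have dH (u : R) : is_derive u 1 H 0.
  have h := is_derive_charfun b u.
  have h2 : is_derive u 1 (fun u : R => s ^+ 2 * u ^+ 2 / 2) (s ^+ 2 * u).
    apply: is_derive_eq; rewrite /GRing.scale/=; by field.
  apply: is_derive_eq; rewrite /GRing.scale/= charfun_deriv; ring.
have HE : H t = H 0 by apply: is_derive_0_is_cst.
have J0 : J b 0 = cos b.
  rewrite /J; under eq_Rintegral do rewrite mul0r add0r.
  rewrite RintegralZl//; last exact: integrable_pdf.
  by rewrite /Rintegral integral_normal_pdf/= mulr1.
move: HE; rewrite /H J0 expr0n/= mulr0 mul0r expR0 mulr1 => <-.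
by rewrite -mulrA -expRD subrr expR0 mulr1.
Qed.

Lemma normal_cos t b : \int[normal_prob 0 s]_x cos (t * x + b) =
  cos b * expR (- (s ^+ 2 * t ^+ 2 / 2)).
Proof.
rewrite -charfunE /Rintegral /J /Rintegral integral_normal_prob; last 2 first.
- by apply/measurable_EFinP; exact: measurable_cos_affine.
- apply: (@le_integrable _ _ _ _ _ measurableT _ (fun=> 1%E)).
  + by apply/measurable_EFinP; exact: measurable_cos_affine.
  + by move=> x _; rewrite /= lee_fin normr1 cos_max.
  + exact: finite_measure_integrable_cst.
by congr fine; apply: eq_integral => x _.
Qed.

End NormalCharacteristic.

(** * Laws on row vectors *)

Section BoundedIntegrals.
Context {R : realType} {d : measure_display} {T : measurableType d}.
Variable P : probability T R.

Lemma bounded_integrable (f : T -> R) (M : R) : measurable_fun setT f ->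
  (forall w, `|f w| <= M) -> P.-integrable setT (EFin \o f).
Proof.
move=> mf fM; apply: (@le_integrable _ _ _ P _ measurableT _ (fun=> M%:E)).
- exact/measurable_EFinP.
- move=> w _ /=; rewrite lee_fin; exact: le_trans (fM w) (ler_norm _).
- exact: finite_measure_integrable_cst.
Qed.

Lemma Rintegral_probability_cst (c : R) : \int[P]_w (fun=> c) w = c.
Proof.
rewrite Rintegral_cst// -[RHS]mulr1; congr (c * _).
by rewrite -[RHS]/(fine 1%E); congr fine; exact: probability_setT.
Qed.

Context {r : nat}.
Variable X : T -> 'rV[R]_r.
Hypothesis mX : forall h, continuous h -> measurable_fun setT (fun w => h (X w) : R).

Lemma bcont_integrable h : bcont h -> P.-integrable setT (EFin \o (fun w => h (X w))).
Proof. by move=> [ch [M hM]]; apply: (@bounded_integrable _ M) => //; exact: mX. Qed.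

Lemma integral_is_bcmean : is_bcmean (fun h => \int[P]_w h (X w)).
Proof.
split => [f g bf bg|a f bf||f g bf bg fg].
- by rewrite RintegralD//; exact: bcont_integrable.
- by rewrite RintegralZl//; exact: bcont_integrable.
- exact: Rintegral_probability_cst.
- by apply: le_Rintegral => //; exact: bcont_integrable.
Qed.

Lemma integral_tail e : 0 < e -> exists2 L, 0 < L & \int[P]_w tail L (X w) <= e.
Proof.
move=> e0.
pose f n w : \bar R := (tail n.+1%:R (X w))%:E.
have fc : (fun n => \int[P]_w f n w)%E @ \oo --> (\int[P]_w (cst 0 w))%E.
  apply: (@dominated_cvg _ _ _ P setT measurableT f (cst 0%E) (cst r%:R%:E)).
  - move=> n; apply/measurable_EFinP; apply: mX; exact: (tail_bcont n.+1%:R).1.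
  - move=> w _; apply: cvg_EFin; first exact: nearW.
    pose s := \sum_i X w 0 i ^+ 2.
    have sc : (fun n => s * n.+1%:R^-1) @ \oo --> (0 : R).
      rewrite -[X in _ --> X](mulr0 s); apply: cvgM; first exact: cvg_cst.
      exact: cvg_harmonic.
    apply: (squeeze_cvgr _ (cvg_cst 0) sc); near=> n; rewrite tail_ge0/=.
    rewrite /tail /s mulr_suml; apply: ler_sum => i _.
    rewrite ge_min; apply/orP; right.
    rewrite exprMn mulrC ler_wpM2l ?sqr_ge0// expr2 ler_piMl ?invr_ge0//.
    by rewrite invf_le1// ler1n.
  - by [].
  - exact: finite_measure_integrable_cst.
  - move=> n w _; rewrite /f /= lee_fin ger0_norm ?tail_ge0//.
    rewrite -[leRHS]mulr1 -sum_cst; apply: ler_sum => i _.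
    by rewrite ge_min lexx.
move: fc; rewrite integral0 => /fine_cvg fc.
have /cvgrPdist_le/(_ _ e0) := fc => fe.
near \oo => n.
exists n.+1%:R => //.
have : `|0 - (fine \o (fun n => \int[P]_w f n w)%E) n| <= e by near: n; exact: fe.
by rewrite sub0r normrN /= => /(le_trans (ler_norm _)).
Unshelve. all: by end_near.
Qed.

End BoundedIntegrals.

Section BorelVectors.
Context {R : realType} {r : nat}.

(** An open set is the union of the rational balls that it contains, and a
    ball for the sup norm is a product of intervals. *)
Lemma measurable_rV d (T : measurableType d) (X : T -> @borel_rV R r) :
  (forall i, measurable_fun setT (fun w => (X w : 'rV[R]_r) 0 i)) -> measurable_fun setT X.
Proof.
move=> mX; apply: (@measurability _ _ T (@borel_rV R r) setT X (@open 'rV[R]_r)) => //.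
move=> _ [U oU <-]; rewrite setTI.
pose q2r (q : 'rV[rat]_r) : 'rV[R]_r := map_mx ratr q.
pose A (q : 'rV[rat]_r * nat) : set T := fun w =>
  ball (q2r q.1) q.2.+1%:R^-1 (X w : 'rV[R]_r) /\
  (forall y, ball (q2r q.1) q.2.+1%:R^-1 y -> U y).
have -> : X @^-1` U = \bigcup_q A q.
  apply/seteqP; split => [w /= Uw|w [q _ [h1 h2]]]; last exact: h2.
  move: oU; rewrite openE => /(_ _ Uw) /nbhs_ballP[e /= e0 eU].
  have e2 : 0 < e / 2 by rewrite divr_gt0.
  pose n := Num.truncn (e / 2)^-1.
  have n1 : n.+1%:R^-1 < e / 2.
    by rewrite invf_plt ?posrE// truncnS_gt.
  have n0 : 0 < n.+1%:R^-1 :> R by rewrite invr_gt0.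
  have [en enE] : exists en : R, en = n.+1%:R^-1 by exists n.+1%:R^-1.
  rewrite -enE in n1 n0.
  have hq i : exists q : rat, ratr q \in `](X w : 'rV[R]_r) 0 i - en, (X w : 'rV[R]_r) 0 i + en[%R.
    by apply: rat_in_itvoo; rewrite ltrD2l (lt_trans _ n0)// oppr_lt0.
  pose q : 'rV[rat]_r := \row_i projT1 (cid (hq i)).
  have qX i : `|ratr (q 0 i) - (X w : 'rV[R]_r) 0 i| < en.
    rewrite mxE; case: cid => /= x; rewrite in_itv/= => /andP[x1 x2].
    by rewrite ltr_norml; apply/andP; split; lra.
  exists (q, n) => //; split => /=; rewrite -enE.
    by split => // i j; rewrite (ord1 i) mxE; exact: qX.
  move=> y [_ yq]; apply: eU; split => // i j; rewrite (ord1 i).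
  have h1 := yq 0 j; have h2 := qX j; rewrite mxE in h1.
  apply: le_lt_trans (ler_distD (ratr (q 0 j)) _ _) _.
  by rewrite distrC; move: h1; rewrite /ball/= => h1; lra.
apply: countable_bigcupT_measurable; first exact: countableP.
move=> q.
have [hU|hU] := pselect (forall y, ball (q2r q.1) q.2.+1%:R^-1 y -> U y); last first.
  by rewrite (_ : A q = set0)//; apply/seteqP; split => // w [].
have -> : A q = \big[setI/setT]_(i < r) ((fun w => (X w : 'rV[R]_r) 0 i) @^-1`
    (ball (q2r q.1 0 i) q.2.+1%:R^-1)).
  rewrite -bigcap_seq; apply/seteqP; split => [w [[_ h] _] i _|w h] /=; first exact: h.
  split => //; split=> // i j; rewrite (ord1 i); apply: (h j).
  by rewrite /= mem_index_enum.
apply: bigsetI_measurable => i _; rewrite -[X in measurable X]setTI.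
by apply: mX => //; apply: open_measurable; exact: ball_open.
Qed.

Lemma continuous_measurable_rV (h : 'rV[R]_r -> R) : continuous h ->
  measurable_fun (setT : set (@borel_rV R r)) (h : @borel_rV R r -> R).
Proof.
move=> ch; apply: (@measurability _ _ _ _ _ _ _ (RGenOInfty.measurableE R)).
move=> _ [_ [x ->] <-]; rewrite setTI; apply: sub_sigma_algebra.
by move/continuousP : ch => /(_ _ (rray_open x)).
Qed.

Lemma measurable_continuous_comp d (T : measurableType d) (X : T -> 'rV[R]_r) h :
  (forall i, measurable_fun setT (fun w => X w 0 i)) -> continuous h ->
  measurable_fun setT (fun w => h (X w) : R).
Proof.
move=> mX ch.
exact: (measurableT_comp (continuous_measurable_rV ch) (measurable_rV (X := X) mX)).
Qed.

End BorelVectors.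

Section LawUnique.
Context {R : realType}.
Context {d1 : measure_display} {T1 : measurableType d1} {d2 : measure_display}
  {T2 : measurableType d2}.
Variables (P1 : probability T1 R) (P2 : probability T2 R).
Variables (Y1 : T1 -> R) (Y2 : T2 -> R).
Hypotheses (mY1 : measurable_fun setT Y1) (mY2 : measurable_fun setT Y2).
Hypothesis same_cos : forall s b,
  \int[P1]_w cos (s * Y1 w + b) = \int[P2]_w cos (s * Y2 w + b).

(** The continuity theorem applied to a constant sequence. *)
Lemma law_continuous (g : R -> R) (M : R) : continuous g -> (forall y, `|g y| <= M) ->
  \int[P1]_w g (Y1 w) = \int[P2]_w g (Y2 w).
Proof.
move=> cg gM.
pose X1 w : 'rV[R]_1 := const_mx (Y1 w).
pose X2 w : 'rV[R]_1 := const_mx (Y2 w).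
have m1 h : continuous h -> measurable_fun setT (fun w => h (X1 w) : R).
  move=> ch; apply: measurable_continuous_comp => // i.
  by under eq_fun do rewrite mxE.
have m2 h : continuous h -> measurable_fun setT (fun w => h (X2 w) : R).
  move=> ch; apply: measurable_continuous_comp => // i.
  by under eq_fun do rewrite mxE.
pose h (x : 'rV[R]_1) := g (x 0 0).
have bh : bcont h.
  split; last by exists M => x; exact: gM.
  move=> x; apply: (@continuous_comp _ _ _ (fun x : 'rV[R]_1 => x 0 0) g); last exact: cg.
  exact: coord_continuous.
have hE1 := integral_is_bcmean P1 m1; have hE2 := integral_is_bcmean P2 m2.
have lim : trig_limit (fun=> (fun h => \int[P1]_w h (X1 w))) (fun h => \int[P2]_w h (X2 w)).
  move=> t b; rewrite (_ : (fun n => _) = (fun=> \int[P2]_w cos ((X2 w *m t) 0 0 + b))).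
    exact: cvg_cst.
  apply/funext => n.
  rewrite (_ : (fun w => _) = (fun w => cos (t 0 0 * Y1 w + b))); last first.
    by apply/funext => w; rewrite mxE big_ord1 mxE mulrC.
  rewrite same_cos; congr (Rintegral _ _ _); apply/funext => w.
  by rewrite mxE big_ord1 mxE mulrC.
have := @trig_weak_limit _ _ _ _ h (fun=> hE1) hE2 lim _ bh.
have tight e : 0 < e -> exists2 L, 0 < L & \int[P2]_w tail L (X2 w) <= e /\
    \forall n \near \oo, \int[P1]_w tail L (X1 w) <= e.
  move=> e0; have [L1 L10 h1] := integral_tail P1 m1 e0.
  have [L2 L20 h2] := integral_tail P2 m2 e0.
  exists (Num.max L1 L2); first by rewrite lt_max L10.
  split; last apply: nearW => _.
    apply: le_trans h2; apply: (bcmean_le hE2); try exact: tail_bcont.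
    by move=> x; apply: tail_le => //; rewrite le_max lexx orbT.
  apply: le_trans h1; apply: (bcmean_le hE1); try exact: tail_bcont.
  by move=> x; apply: tail_le => //; rewrite le_max lexx.
move=> /(_ tight) lim2.
have lim1 : (fun _ : nat => \int[P1]_w h (X1 w)) @ \oo --> \int[P1]_w h (X1 w).
  exact: cvg_cst.
have e1 : \int[P1]_w h (X1 w) = \int[P1]_w g (Y1 w).
  by apply: eq_Rintegral => w _; rewrite /h mxE.
have e2 : \int[P2]_w h (X2 w) = \int[P2]_w g (Y2 w).
  by apply: eq_Rintegral => w _; rewrite /h mxE.
rewrite -e1 -e2; exact: (cvg_unique _ lim1 lim2).
Qed.

(** Continuous functions that increase with n to the indicator of the
    half-line above a. *)
Definition ramp (a : R) (n : nat) (x : R) : R := Num.min 1 (Num.max 0 (n%:R * (x - a))).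

Lemma ramp_itv a n x : 0 <= ramp a n x <= 1.
Proof. by rewrite /ramp le_min ler01 le_max lexx/= ge_min lexx. Qed.

Lemma ramp_continuous a n : continuous (ramp a n).
Proof.
move=> x; apply: (@continuous_min _ _ (fun=> 1 : R) (fun x => Num.max 0 (n%:R * (x - a)))).
  exact: cst_continuous.
apply: (@continuous_max _ _ (fun=> 0 : R) (fun x => n%:R * (x - a))).
  exact: cst_continuous.
apply: continuousM; first exact: cst_continuous.
by apply: continuousB; [|exact: cst_continuous].
Qed.

Lemma ramp_cvg a x : ramp a n x @[n --> \oo] --> (\1_`]a, +oo[%classic x : R).
Proof.
rewrite indicE; have [ax|xa] := ltP a x.
  rewrite mem_set /=; last by rewrite in_itv/= ax.
  apply: cvg_near_cst; near=> n.
  have : 1 <= n%:R * (x - a).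
    rewrite -ler_pdivrMr ?subr_gt0// mul1r; near: n; exact: nbhs_infty_ger.
  move=> h; rewrite /ramp max_r ?min_l//; lra.
rewrite memNset /=; last by rewrite in_itv/= andbT; apply/negP; rewrite -leNgt.
apply: cvg_near_cst; apply: nearW => n.
rewrite /ramp max_l ?min_r//.
by rewrite mulr_ge0_le0// subr_le0.
Unshelve. all: by end_near.
Qed.

Lemma integral_ramp_cvg d (T : measurableType d) (P : probability T R) (Y : T -> R) a :
  measurable_fun setT Y ->
  (fun n => (\int[P]_w ramp a n (Y w))%:E) @ \oo --> P (Y @^-1` `]a, +oo[).
Proof.
move=> mY.
have mA : measurable (Y @^-1` `]a, +oo[) by rewrite -[X in measurable X]setTI; apply: mY.
have mr n : measurable_fun setT (fun w => ramp a n (Y w)).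
  by apply: measurableT_comp => //; exact: continuous_measurable_fun (@ramp_continuous a n).
have rb n w : `|ramp a n (Y w)| <= 1.
  by have /andP[h1 h2] := ramp_itv a n (Y w); rewrite ger0_norm.
rewrite (_ : (fun n => _) = (fun n => \int[P]_w (ramp a n (Y w))%:E)%E); last first.
  apply/funext => n; rewrite /Rintegral fineK//.
  by apply: integrable_fin_num => //; exact: bounded_integrable (mr n) (rb n).
rewrite (_ : P _ = \int[P]_w (\1_(Y @^-1` `]a, +oo[) w)%:E)%E; last first.
  by rewrite integral_indic// setIT.
apply: (@dominated_cvg _ _ _ P setT measurableT
  (fun n w => (ramp a n (Y w))%:E) _ (cst 1%E)).
- by move=> n; exact/measurable_EFinP.
- move=> w _; apply: cvg_EFin; first exact: nearW.
  have := @ramp_cvg a (Y w); rewrite /= !indicE.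
  by rewrite (_ : (w \in Y @^-1` `]a, +oo[) = (Y w \in `]a, +oo[%classic)).
- by [].
- exact: finite_measure_integrable_cst.
- by move=> n w _ /=; rewrite lee_fin.
Qed.

(** Half-lines form a generating pi-system, and their measures are limits of
    integrals of ramps. *)
Lemma law_unique (A : set R) : measurable A -> P1 (Y1 @^-1` A) = P2 (Y2 @^-1` A).
Proof.
move=> mA.
pose Z1 : {mfun T1 >-> R} :=
  HB.pack Y1 (isMeasurableFun.Build _ _ _ _ Y1 mY1).
pose Q1 := distribution P1 Z1.
pose Z2 : {mfun T2 >-> R} :=
  HB.pack Y2 (isMeasurableFun.Build _ _ _ _ Y2 mY2).
pose Q2 := distribution P2 Z2.
rewrite -[LHS]/(Q1 A) -[RHS]/(Q2 A).
apply: (@measure_unique _ _ _ (@RGenOInfty.G R) (fun n => `](- n%:R), +oo[%classic)) => //.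
- exact: RGenOInfty.measurableE.
- move=> _ _ [x ->] [y ->]; exists (Num.max x y).
  apply/seteqP; split => z /=; rewrite !in_itv/= !andbT gt_max.
    by move=> [-> ->].
  by move=> /andP[].
- by move=> i; exists (- i%:R).
- apply/seteqP; split => // x _.
  exists (Num.truncn `|x|).+1 => //=; rewrite in_itv/= andbT.
  have := truncnS_gt `|x|; have := ler_norm (- x); rewrite normrN => h1 h2; lra.
- move=> _ [a ->].
  have l1 := @integral_ramp_cvg _ _ P1 Y1 a mY1.
  have l2 := @integral_ramp_cvg _ _ P2 Y2 a mY2.
  have E : (fun n => (\int[P1]_w ramp a n (Y1 w))%:E) = (fun n => (\int[P2]_w ramp a n (Y2 w))%:E).
    apply/funext => n; congr EFin; apply: (@law_continuous _ 1); first exact: ramp_continuous.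
    by move=> y; have /andP[h1 h2] := ramp_itv a n y; rewrite ger0_norm.
  rewrite E in l1; exact: (cvg_unique _ l1 l2).
- by move=> k; apply: le_lt_trans (probability_le1 _ _) _ => //; exact: ltry.
Qed.

End LawUnique.

(** * Existence of multivariate normal laws *)

Section PsdFactor.
Context {R : realType}.

(** Completing the square in the first variable reduces the claim to the
    Schur complement. If the corner a is 0 then positivity kills the whole
    first row, and the convention 0^-1 = 0 keeps the formulas valid. *)
Lemma psd_factor n (S : 'M[R]_n) : covariance_matrix S ->
  exists L : 'M[R]_n, S = L^T *m L.
Proof.
elim: n S => [|n IH] S [ST Spos]; first by exists 0; apply/matrixP => -[].
move: S ST Spos; rewrite -[n.+1]/(1 + n)%N => S ST Spos.
pose a : R := S 0 0.
pose v : 'rV[R]_n := ursubmx S.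
pose D : 'M[R]_n := drsubmx S.
have ulE : ulsubmx S = a%:M.
  rewrite [LHS]mx11_scalar; congr (_%:M); rewrite !mxE /a; congr (S _ _); exact: val_inj.
have dlE : dlsubmx S = v^T by rewrite -[in LHS]ST -trmx_ursub.
have SE : S = block_mx a%:M v v^T D by rewrite -ulE -dlE submxK.
have DT : D^T = D by rewrite /D trmx_drsub ST.
have form (x : R) (y : 'cV[R]_n) :
    ((col_mx x%:M y)^T *m S *m col_mx x%:M y) 0 0 =
    a * x ^+ 2 + 2 * x * (v *m y) 0 0 + (y^T *m D *m y) 0 0.
  rewrite [in LHS]SE tr_col_mx tr_scalar_mx mul_row_block mul_row_col.
  rewrite !mulmxDl -!scalar_mxM !mul_scalar_mx.
  rewrite mxE [X in X + _]mxE [X in _ + X]mxE.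
  have -> : (y^T *m v^T *m x%:M) 0 0 = x * (v *m y) 0 0.
    rewrite -trmx_mul mul_mx_scalar mxE [X in _ * X]mxE; congr (_ * _).
  have -> : (x *: v *m y) 0 0 = x * (v *m y) 0 0 by rewrite -scalemxAl mxE.
  rewrite [(_%:M) 0 0]mxE eqxx mulr1n.
  by ring.
have pos (x : R) (y : 'cV[R]_n) :
    0 <= a * x ^+ 2 + 2 * x * (v *m y) 0 0 + (y^T *m D *m y) 0 0.
  by rewrite -form; exact: Spos.
have a0 : 0 <= a by have := pos 1 0; rewrite !mulmx0 !mxE; lra.
have va : a = 0 -> v = 0.
  move=> a00; suff vv : (v *m v^T) 0 0 = 0.
    apply/matrixP => i j; rewrite (ord1 i) [RHS]mxE.
    have : \sum_j v 0 j ^+ 2 = 0.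
      by rewrite -[RHS]vv mxE; apply: eq_bigr => k _; rewrite [X in _ = _ * X]mxE expr2.
    move/psumr_eq0P => /(_ (fun k _ => sqr_ge0 _)) /(_ j isT) /eqP.
    by rewrite sqrf_eq0 => /eqP.
  set q := (v *m v^T) 0 0; apply/eqP; apply: contraT => q0.
  set c := ((v^T)^T *m D *m v^T) 0 0.
  (* with a = 0 the form is affine in the first variable; this point makes it -1 *)
  have := pos (- (c + 1) / (2 * q)) v^T; rewrite a00 -/q -/c mul0r add0r.
  have -> : 2 * (- (c + 1) / (2 * q)) * q + c = -1 by field.
  by lra.
pose D' := D - a^-1 *: (v^T *m v).
have aa : a * a^-1 * a^-1 = a^-1.
  have [->|an0] := eqVneq a 0; first by rewrite invr0 mulr0.
  by rewrite mulfV// mul1r.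
have [L' D'E] : exists L' : 'M[R]_n, D' = L'^T *m L'.
  apply: IH; split.
    by rewrite /D' linearB/= linearZ/= trmx_mul trmxK DT.
  move=> y; have := pos (- (a^-1 * (v *m y) 0 0)) y.
  have -> : (y^T *m D' *m y) 0 0 = (y^T *m D *m y) 0 0 - a^-1 * (v *m y) 0 0 ^+ 2.
    rewrite /D' mulmxBr mulmxBl -scalemxAr -scalemxAl mxE [X in _ + X]mxE.
    rewrite [X in _ - X]mxE; congr (_ - _ * _).
    have -> : y^T *m (v^T *m v) *m y = (v *m y)^T *m (v *m y).
      by rewrite trmx_mul !mulmxA.
    by rewrite mxE big_ord1 [X in X * _]mxE expr2.
  set q := (v *m y) 0 0.
  have -> : a * (- (a^-1 * q)) ^+ 2 = a * a^-1 * a^-1 * q ^+ 2 by ring.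
  by rewrite aa; set w := a^-1; lra.
pose s := Num.sqrt a.
have ss : s * s = a by rewrite -expr2 sqr_sqrtr.
have sv : (s * s^-1) *: v = v.
  have [a00|an0] := eqVneq a 0; first by rewrite (va a00) scaler0.
  by rewrite mulfV ?scale1r// sqrtr_eq0 -ltNge lt_neqAle eq_sym an0.
exists (block_mx s%:M (s^-1 *: v) 0 L').
rewrite tr_block_mx mulmx_block tr_scalar_mx trmx0 !mulmx0 !mul0mx !addr0.
rewrite SE; congr block_mx.
- by rewrite -scalar_mxM ss.
- by rewrite mul_scalar_mx scalerA sv.
- by rewrite mul_mx_scalar linearZ/= scalerA -linearZ/= sv.
- have -> : (s^-1 *: v)^T *m (s^-1 *: v) = (s^-1 * s^-1) *: (v^T *m v).
    by rewrite [(_ *: v)^T]linearZ/= -scalemxAl -scalemxAr scalerA.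
  by rewrite -D'E /D' -invfM ss addrC subrK.
Qed.

End PsdFactor.

Section StandardNormals.
Context {R : realType}.

Definition lin (n : nat) (c z : 'I_n -> R) : R := \sum_i c i * z i.

(** Independence is recorded through the joint characteristic function; a
    further coordinate is adjoined by a product measure and Fubini's
    theorem. *)
Lemma standard_normals (n : nat) :
  exists (d : measure_display) (T : measurableType d) (P : probability T R)
    (z : 'I_n -> T -> R),
    (forall i, measurable_fun setT (z i)) /\
    (forall c b, \int[P]_w cos (lin c (z ^~ w) + b) =
       cos b * expR (- (\sum_i c i ^+ 2 / 2))).
Proof.
elim: n => [|n [d [T [P [z [mz hz]]]]]].
  exists _, (measurableTypeR R), (normal_prob 0 1 : probability _ R), (fun=> fun=> 0).
  split=> [[]//|c b]; rewrite big_ord0 oppr0 expR0 mulr1.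
  rewrite -[RHS](@Rintegral_probability_cst R _ (measurableTypeR R) (normal_prob 0 1)).
  by apply: eq_Rintegral => x _; rewrite /lin big_ord0 add0r.
pose N : probability (measurableTypeR R) R := normal_prob 0 1.
pose Z (i : 'I_n.+1) (w : T * measurableTypeR R) : R :=
  if unlift ord0 i is Some j then z j w.1 else w.2.
have mZ i : measurable_fun setT (Z i).
  rewrite /Z; case: unlift => [j|]; last exact: measurable_snd.
  by apply: measurableT_comp => //; exact: measurable_fst.
exists _, _, ((P \x N)%E : probability _ R), Z; split => // c b.
pose c' := fun j : 'I_n => c (lift ord0 j).
have ZE w : lin c (Z ^~ w) + b = c ord0 * w.2 + (lin c' (z ^~ w.1) + b).
  rewrite /lin big_ord_recl /Z unlift_none addrA; congr (_ * _ + _ + _).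
  by apply: eq_bigr => j _; rewrite liftK.
have mf : measurable_fun setT (fun w => cos (lin c (Z ^~ w) + b)).
  apply: measurableT_comp; first exact: continuous_measurable_fun (@continuous_cos R).
  apply: measurable_funD => //; apply: measurable_sum => i.
  by apply: measurable_funM => //; exact: mZ.
have intf : (P \x N)%E.-integrable setT (EFin \o (fun w => cos (lin c (Z ^~ w) + b))).
  apply: (@bounded_integrable _ _ _ ((P \x N)%E : probability _ R) _ 1 mf) => w.
  exact: cos_max.
rewrite /Rintegral -(integral12_prod_meas1 intf) /fubini_F.
rewrite (eq_integral (fun w => (cos (lin c' (z ^~ w) + b) * expR (- (c ord0 ^+ 2 / 2)))%:E)); last first.
  move=> w _; rewrite -[RHS]fineK//.
  rewrite -[LHS]fineK.
    congr EFin; rewrite -[LHS]/(\int[N]_y cos (lin c (Z ^~ (w, y)) + b)).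
    have -> : \int[N]_y cos (lin c (Z ^~ (w, y)) + b) =
        \int[N]_y cos (c ord0 * y + (lin c' (z ^~ w) + b)).
      by apply: eq_Rintegral => y _; rewrite ZE.
    by rewrite (normal_cos ltr01) expr1n mul1r.
  apply: integrable_fin_num => //.
  apply: (@bounded_integrable _ _ _ N _ 1) => [|y]; last exact: cos_max.
  apply: measurableT_comp; first exact: continuous_measurable_fun (@continuous_cos R).
  under eq_fun do rewrite ZE /=.
  apply: measurable_funD => //; exact: measurable_funM.
under eq_integral do rewrite EFinM.
have mz' : measurable_fun setT (fun w => cos (lin c' (z ^~ w) + b)).
  apply: measurableT_comp; first exact: continuous_measurable_fun (@continuous_cos R).
  apply: measurable_funD => //; apply: measurable_sum => i.
  by apply: measurable_funM => //; exact: mz.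
have intz : P.-integrable setT (EFin \o (fun w => cos (lin c' (z ^~ w) + b))).
  by apply: (@bounded_integrable _ _ _ P _ 1 mz') => w; exact: cos_max.
rewrite integralZr// fineM ?fin_numE//; last exact: integrable_fin_num.
rewrite -[fine (integral _ _ _)]/(\int[P]_w cos (lin c' (z ^~ w) + b)) hz /=.
rewrite -mulrA -expRD big_ord_recl; congr (_ * expR _); rewrite -opprD addrC; congr (- (_ + _)).
Qed.

End StandardNormals.

Section Mvnormal.
Context {R : realType} {r : nat}.

(** [normal0] is a bare set function, so the probability that it describes
    is exhibited before integrating against it. *)
Lemma normal0_cos (s2 : R) : 0 <= s2 ->
  exists Q : probability (measurableTypeR R) R, (forall A, measurable A -> Q A = normal0 s2 A) /\
    forall s b, \int[Q]_y cos (s * y + b) = cos b * expR (- (s ^+ 2 * s2 / 2)).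
Proof.
move=> s20; rewrite /normal0; have [->|sn0] := eqVneq s2 0.
  exists (\d_(0 : measurableTypeR R)); split => // s b.
  rewrite /Rintegral integral_dirac//; last first.
    apply/measurable_EFinP; apply: continuous_measurable_fun.
    exact: continuous_affine_cos.
  rewrite /dirac indicE mem_set// mul1e/= mulr0 add0r.
  by rewrite mulr0 mul0r oppr0 expR0 mulr1.
exists (normal_prob 0 (Num.sqrt s2)); split => // s b.
rewrite normal_cos; last by rewrite sqrtr_gt0 lt_neqAle eq_sym sn0.
by rewrite sqr_sqrtr// (mulrC s2).
Qed.

(** With S = L^T L, the law of z L for a row z of independent standard
    normals. Its linear forms have the right characteristic functions, hence
    the right laws. *)
Lemma mvnormal_exists (S : 'M[R]_r) : covariance_matrix S ->
  exists mu : probability (borel_rV r) R, is_mvnormal S mu /\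
    forall (t : 'cV[R]_r) b, \int[mu]_x cos ((x *m t) 0 0 + b) =
      cos b * expR (- ((t^T *m S *m t) 0 0 / 2)).
Proof.
move=> covS; have [L SE] := psd_factor covS.
have [d [T [P [z [mz hz]]]]] := @standard_normals R r.
pose X (w : T) : @borel_rV R r := (\row_i z i w) *m L.
have Xt w (t : 'cV[R]_r) : ((X w : 'rV[R]_r) *m t) 0 0 = lin (fun i => (L *m t) i 0) (z ^~ w).
  rewrite /X -mulmxA mxE; apply: eq_bigr => i _.
  by rewrite [X in X * _]mxE mulrC.
have mX : measurable_fun setT X.
  apply: measurable_rV => i; rewrite /X.
  under eq_fun do rewrite mxE.
  apply: measurable_sum => j; apply: measurable_funM => //.
  by under eq_fun do rewrite mxE; exact: mz.
pose Xm : {mfun T >-> @borel_rV R r} := HB.pack X (isMeasurableFun.Build _ _ _ _ X mX).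
pose mu : probability (@borel_rV R r) R := distribution P Xm.
have cosX (t : 'cV[R]_r) b : \int[P]_w cos ((X w *m t : 'M[R]_1) 0 0 + b) =
    cos b * expR (- ((t^T *m S *m t) 0 0 / 2)).
  under eq_Rintegral do rewrite Xt.
  rewrite hz; congr (_ * expR (- _)); rewrite -mulr_suml; congr (_ / _).
  rewrite SE mulmxA -mulmxA -trmx_mul mxE.
  by apply: eq_bigr => i _; rewrite [X in _ = X * _]mxE expr2.
have mc (t : 'cV[R]_r) b := continuous_measurable_rV (trig_bcont (trig_cos t b)).1.
exists mu; split; last first.
  move=> t b; rewrite -cosX /Rintegral integral_distribution//.
  - by have /measurable_EFinP := mc t b.
  - apply: (@bounded_integrable _ _ _ P _ 1) => [|w]; last exact: cos_max.
    exact: (measurableT_comp (mc t b) mX).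
move=> t A mA.
have s20 := covS.2 t.
have ct : continuous (fun x : 'rV[R]_r => (x *m t) 0 0) by exact: continuous_dot.
rewrite -[LHS]/(P ((fun w => ((X w : 'rV[R]_r) *m t) 0 0) @^-1` A)).
have [Q [QA Qcos]] := normal0_cos s20.
rewrite -(QA _ mA) -[RHS]/(Q ((fun y => y) @^-1` A)).
apply: law_unique => //.
  exact: (measurableT_comp (continuous_measurable_rV ct) mX).
move=> s b.
rewrite Qcos.
have -> : \int[P]_w cos (s * ((X w : 'rV[R]_r) *m t) 0 0 + b) =
    \int[P]_w cos (((X w : 'rV[R]_r) *m (s *: t)) 0 0 + b).
  by apply: eq_Rintegral => w _; rewrite -scalemxAr [in RHS]mxE.
rewrite cosX; congr (_ * expR (- (_ / 2))).
by rewrite [(s *: t)^T]linearZ/= -!scalemxAl -scalemxAr scalerA mxE expr2.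
Qed.

End Mvnormal.

(** * Degrees after fusing a block *)

Section Attach.
Implicit Types (G : mgraph) (B : block).

Lemma fuse_lshift G (v x : 'I_(nvert G)) B (y : 'I_(nvert B)) :
  (fuse v y == lshift _ x) = (y == hook B) && (x == v).
Proof.
rewrite /fuse; case: unliftP => [z ->|->].
  by rewrite eq_rlshift eq_sym (negbTE (neq_lift _ _)).
by rewrite eqxx /= (inj_eq (@lshift_inj _ _)) eq_sym.
Qed.

Lemma fuse_rshift G (v : 'I_(nvert G)) B (y : 'I_(nvert B)) (z : 'I_(nvert B).-1) :
  (fuse v y == rshift _ z) = (y == lift (hook B) z).
Proof.
rewrite /fuse; case: unliftP => [z' ->|->].
  by rewrite (inj_eq (@rshift_inj _ _)) (inj_eq lift_inj).
by rewrite eq_lrshift (negbTE (neq_lift _ _)).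
Qed.

Lemma deg_attach_old G (v x : 'I_(nvert G)) B :
  @deg (attach v B) (lshift _ x) = (deg x + (x == v) * deg (hook B))%N.
Proof.
rewrite /deg /= big_cat !big_map/=; congr (_ + _)%N.
rewrite big_distrr/=; apply: eq_bigr => e _; rewrite !fuse_lshift.
by case: (x == v); rewrite ?andbT ?andbF ?mul1n ?mul0n.
Qed.

Lemma deg_attach_new G (v : 'I_(nvert G)) B (z : 'I_(nvert B).-1) :
  @deg (attach v B) (rshift _ z) = deg (lift (hook B) z).
Proof.
rewrite /deg /= big_cat !big_map/= big1 => [|e _]; last by rewrite !eq_lrshift.
by rewrite add0n; apply: eq_bigr => e _; rewrite !fuse_rshift.
Qed.

(** Total weights and degree counts are sums of a function of the degree;
    fusing changes such a sum by an amount that depends only on the degree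
    of the latch and on the block. *)
Lemma sum_deg_attach (V : zmodType) (phi : nat -> V) G (v : 'I_(nvert G)) B :
  \sum_(x < nvert (attach v B)) phi (deg x) =
  \sum_(x < nvert G) phi (deg x) +
    (phi (deg v + deg (hook B))%N - phi (deg v) +
     \sum_(y < nvert B | y != hook B) phi (deg y)).
Proof.
rewrite /= big_split_ord/= addrA; congr (_ + _); last first.
  rewrite [RHS]big_mkcond/= (bigD1_ord (hook B))//= eqxx add0r.
  apply: eq_bigr => z _.
  by rewrite deg_attach_new eq_sym neq_lift.
rewrite (bigD1 v)//= [in RHS](bigD1 v)//= deg_attach_old eqxx mul1n.
rewrite [RHS]addrC addrA subrK; congr (_ + _).
by apply: eq_bigr => x xv; rewrite deg_attach_old (negbTE xv) mul0n addn0.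
Qed.

Definition deg_gt0_graph G : Prop := (0 < nvert G)%N /\ forall x : 'I_(nvert G), (0 < deg x)%N.

(** In a connected graph with a second vertex no vertex is isolated. *)
Lemma deg_gt0_block B : deg_gt0_graph B.
Proof.
have n2 := block_nvert B; split; first exact: ltnW.
move=> x.
have [y xy] : exists y : 'I_(nvert B), y != x.
  have [x0|x0] := eqVneq (nat_of_ord x) 0%N.
    by exists (Ordinal n2); rewrite -val_eqE /= x0.
  by exists (Ordinal (ltnW n2)); rewrite -val_eqE /= eq_sym.
have /connectP[s] := block_connected x y.
case: s => [_ yx|z s /= /andP[xz _] _]; first by rewrite yx eqxx in xy.
rewrite /deg lt0n sum_nat_seq_eq0 -has_predC.
move: xz => /orP[] h; apply/hasP; eexists; try exact: h; by rewrite /= eqxx ?addn1.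
Qed.

Lemma deg_gt0_attach G (v : 'I_(nvert G)) B :
  deg_gt0_graph G -> deg_gt0_graph (attach v B).
Proof.
move=> [n0 dG]; split; first by rewrite /= addn_gt0 n0.
move=> x; rewrite -(@fintype.splitK (nvert G) (nvert B).-1 x); case: (@fintype.split (nvert G) (nvert B).-1 x) => z /=.
  by rewrite deg_attach_old addn_gt0 dG.
by rewrite deg_attach_new; exact: (deg_gt0_block B).2.
Qed.

Lemma nb_degE (R : pzSemiRingType) G k :
  (nb_deg G k)%:R = \sum_(x < nvert G) (deg x == k)%:R :> R.
Proof.
rewrite /nb_deg -sum1_card natr_sum big_mkcond/=; apply: eq_bigr => x _.
by rewrite inE; case: eqP.
Qed.

End Attach.

(** * The law of the hooking network *)

Section Kernel.
Context {R : realType}.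
Variables (chi rho : R) (m : nat) (B : 'I_m -> block) (p : 'I_m -> R).

Definition total_weight (G : mgraph) : R :=
  \sum_(x < nvert G) weight chi rho (deg x).

Definition hook_kernel (G : mgraph) (F : mgraph -> R) : R :=
  \sum_(v < nvert G) \sum_(i < m)
    weight chi rho (deg v) / total_weight G * p i * F (attach v (B i)).

Definition hook_tr (G G' : mgraph) : Prop :=
  exists (v : 'I_(nvert G)) (i : 'I_m), G' = attach v (B i).

(** The last step is composed innermost, so that [ch_step] holds by
    computation. *)
Fixpoint kernel_iter (n : nat) (F : mgraph -> R) (G : mgraph) : R :=
  if n is n'.+1 then kernel_iter n' (fun G' => hook_kernel G' F) G else F G.

Lemma kernel_iterS n F G :
  kernel_iter n.+1 F G = hook_kernel G (kernel_iter n F).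
Proof. by elim: n F => //= n IH F; rewrite -IH. Qed.

Hypotheses (hchi : 0 <= chi) (hchirho : 0 < chi + rho).

Lemma weight_gt0 k : (0 < k)%N -> 0 < weight chi rho k.
Proof.
case: k => // k _; rewrite /weight mulrSr mulrDr mulr1 -addrA.
by rewrite ltr_wpDl// mulr_ge0.
Qed.

Lemma total_weight_gt0 G : deg_gt0_graph G -> 0 < total_weight G.
Proof.
case: G => -[|n] E [//= n0 dG]; rewrite /total_weight/=.
rewrite (bigD1 ord0)//= ltr_pwDl ?weight_gt0 ?dG//.
by apply: sumr_ge0 => i _; apply/ltW/weight_gt0/dG.
Qed.

Hypotheses (hp : forall i, 0 < p i) (hp1 : \sum_(i < m) p i = 1).

Lemma latch_sum G : deg_gt0_graph G ->
  \sum_(v < nvert G) weight chi rho (deg v) / total_weight G = 1.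
Proof.
by move=> dG; rewrite -mulr_suml mulfV// gt_eqF// total_weight_gt0.
Qed.

Lemma hook_kernel_mean G : deg_gt0_graph G -> is_mean (hook_tr G) (hook_kernel G).
Proof.
move=> dG; have W0 := total_weight_gt0 dG.
split => [f g|a f||f g fg]; rewrite /hook_kernel.
- rewrite -big_split/=; apply: eq_bigr => v _; rewrite -big_split/=.
  by apply: eq_bigr => i _; rewrite mulrDr.
- rewrite mulr_sumr; apply: eq_bigr => v _; rewrite mulr_sumr.
  by apply: eq_bigr => i _; rewrite mulrCA.
- rewrite -[RHS](latch_sum dG); apply: eq_bigr => v _.
  by under eq_bigr do rewrite mulr1; rewrite -mulr_sumr hp1 mulr1.
- apply: ler_sum => v _; apply: ler_sum => i _; apply: ler_wpM2l.
    by rewrite mulr_ge0 ?(ltW (hp i))// divr_ge0 ?ltW// weight_gt0// dG.2.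
  by apply: fg; exists v, i.
Qed.

Lemma latch_probE G (v : 'I_(nvert G)) :
  latch_prob chi rho G v = weight chi rho (deg v) / total_weight G.
Proof. by rewrite /latch_prob; case: insubP => [u _ /val_inj -> //|]; rewrite ltn_ord. Qed.

Definition grow (G : mgraph) (v : nat) (i : 'I_m) : mgraph :=
  if insub v is Some u then @attach G u (B i) else G.

Lemma growE G (v : 'I_(nvert G)) i : grow G v i = attach v (B i).
Proof. by rewrite /grow; case: insubP => [u _ /val_inj -> //|]; rewrite ltn_ord. Qed.

Lemma deg_gt0_grow G v i : deg_gt0_graph G -> deg_gt0_graph (grow G v i).
Proof. by rewrite /grow; case: insub => // u dG; exact: deg_gt0_attach. Qed.

Lemma networkS i0 a c n : network B i0 a c n.+1 = grow (network B i0 a c n) (a n) (c n).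
Proof. by []. Qed.

Lemma deg_gt0_network i0 a c n : deg_gt0_graph (network B i0 a c n).
Proof.
elim: n => [|n IH]; first exact: deg_gt0_block.
by rewrite networkS; exact: deg_gt0_grow.
Qed.

Lemma network_eq i0 a a' c c' n :
  (forall j, (j < n)%N -> a j = a' j /\ c j = c' j) ->
  network B i0 a c n = network B i0 a' c' n.
Proof.
elim: n => // n IH h; rewrite !networkS IH => [|j jn]; last by apply: h; exact: ltnW.
by have [-> ->] := h n (ltnSn n).
Qed.

Definition upd (T : Type) (f : nat -> T) (n : nat) (x : T) : nat -> T :=
  fun j => if j == n then x else f j.

Lemma upd_lt (T : Type) (f : nat -> T) n x j : (j < n)%N -> upd f n x j = f j.
Proof. by move=> jn; rewrite /upd ltn_eqF. Qed.

Lemma network_upd i0 a c n v i :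
  network B i0 (upd a n v) (upd c n i) n.+1 = grow (network B i0 a c n) v i.
Proof.
rewrite networkS /upd !eqxx; congr grow; apply: network_eq => j jn.
by rewrite ltn_eqF.
Qed.

Section Process.
Context {d : measure_display} {T : measurableType d}.
Variables (P : probability T R).
Variables (b0 : T -> 'I_m) (latch : nat -> T -> nat) (blk : nat -> T -> 'I_m).
Hypothesis hG : hooking_process chi rho B p P b0 latch blk.

Local Notation net := (hooking_network B b0 latch blk).
Local Notation pst := (past b0 latch blk).

Lemma hooking_networkS n w : net n.+1 w = grow (net n w) (latch n w) (blk n w).
Proof. by []. Qed.

Lemma measurable_net n (S : set mgraph) : measurable (net n @^-1` S).
Proof.
elim: n S => [|n IH] S.
  rewrite (_ : _ @^-1` S = \big[setU/set0]_(i < m | `[< S (B i) >]) (b0 @^-1` [set i])).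
    by apply: bigsetU_measurable => i _; exact: (measurable_start hG).
  rewrite -bigcup_seq_cond; apply/seteqP; split => [w /= Sw|w [i /= /andP[_ /asboolP Si] bi]]; last first.
    by rewrite /hooking_network/= bi.
  by exists (b0 w) => //=; rewrite mem_index_enum/=; exact/asboolP.
rewrite (_ : _ @^-1` S = \bigcup_v \big[setU/set0]_(i < m)
   (latch n @^-1` [set v] `&` blk n @^-1` [set i] `&`
    net n @^-1` [set G | S (grow G v i)])).
  apply: bigcupT_measurable => v; apply: bigsetU_measurable => i _.
  apply: measurableI => //; apply: measurableI.
    exact: (measurable_latch hG).
  exact: (measurable_blk hG).
apply/seteqP; split => [w Sw|w [v _]].
  exists (latch n w) => //; rewrite -bigcup_seq; exists (blk n w) => //=.
  by rewrite mem_index_enum.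
by rewrite -bigcup_seq => -[i _ [[/= <- <-]]].
Qed.

Lemma measurable_fun_net n (F : mgraph -> R) : measurable_fun setT (fun w => F (net n w)).
Proof. by move=> _ A mA; rewrite setTI; exact: (measurable_net n (F @^-1` A)). Qed.

Lemma bounded_net n (F : mgraph -> R) : exists M, forall w, `|F (net n w)| <= M.
Proof.
elim: n F => [|n IH] F.
  exists (\sum_(i < m) `|F (B i)|) => w.
  by rewrite /hooking_network/= (bigD1 (b0 w))//= lerDl sumr_ge0.
have [M hM] := IH (fun G => `|F G| + \sum_(v < nvert G) \sum_(i < m) `|F (attach v (B i))|).
exists M => w; apply: le_trans (hM w); apply: le_trans (ler_norm _).
rewrite hooking_networkS /grow; case: insub => [u|]; last first.
  by rewrite lerDl; apply: sumr_ge0 => v _; exact: sumr_ge0.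
apply: (@le_trans _ _ (\sum_(v < nvert (net n w)) \sum_(i < m) `|F (attach v (B i))|)).
  rewrite (bigD1 u)//= (bigD1 (blk n w))//= -addrA lerDl addr_ge0 ?sumr_ge0// => v _.
  exact: sumr_ge0.
by rewrite lerDr.
Qed.

Lemma measurable_past i0 a c n : measurable (pst i0 a c n).
Proof.
elim: n => [|n IH].
  rewrite (_ : pst _ _ _ _ = b0 @^-1` [set i0]); first exact: (measurable_start hG).
  by apply/seteqP; split => [w [] //|w /= bw]; split.
rewrite (_ : pst _ _ _ _ = pst i0 a c n `&` latch n @^-1` [set a n] `&` blk n @^-1` [set c n]).
  apply: measurableI; last exact: (measurable_blk hG).
  by apply: measurableI => //; exact: (measurable_latch hG).
apply/seteqP; split => [w [bw h]|w [[[bw h] /= la] bc]]; first split; first split.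
- by split => // j jn; apply: h; exact: ltnW.
- by have [] := h n (ltnSn n).
- by have [] := h n (ltnSn n).
split => // j; rewrite ltnS leq_eqVlt => /predU1P[->//|]; exact: h.
Qed.

Lemma past_upd i0 a c n v i :
  pst i0 (upd a n v) (upd c n i) n.+1 =
  pst i0 a c n `&` [set w | latch n w = v] `&` [set w | blk n w = i].
Proof.
apply/seteqP; split => [w [bw h]|w [[[bw h] /= la] /= bc]].
  have [h1 h2] := h n (ltnSn n); rewrite /upd !eqxx in h1 h2.
  split => //; split => //; split => // j jn.
  by have [] := h j (ltnW jn); rewrite !upd_lt.
split => // j; rewrite ltnS leq_eqVlt => /predU1P[->|jn]; first by rewrite /upd eqxx.
by rewrite !upd_lt//; exact: h.
Qed.

Lemma net_past i0 a c n w : pst i0 a c n w -> net n w = network B i0 a c n.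
Proof. by move=> [<- h]; apply: network_eq => j /h. Qed.

Definition past_prob i0 a c n : R := fine (P (pst i0 a c n)).

Lemma past_prob_upd i0 a c n (v : 'I_(nvert (network B i0 a c n))) i :
  past_prob i0 (upd a n v) (upd c n i) n.+1 =
  past_prob i0 a c n * (weight chi rho (deg v) / total_weight (network B i0 a c n) * p i).
Proof.
rewrite /past_prob past_upd (block_law hG) (latch_law hG) latch_probE.
rewrite -[P (pst _ _ _ _)]fineK ?fin_num_measure//; last exact: measurable_past.
by rewrite -!EFinM /= mulrA.
Qed.

Lemma indicator_integral A : measurable A -> \int[P]_w (\1_A w : R) = fine (P A).
Proof. by move=> mA; rewrite /Rintegral integral_indic// setIT. Qed.

Definition tame (g : T -> R) : Prop :=
  measurable_fun setT g /\ exists M, forall w, `|g w| <= M.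

Lemma tame_integrable g : tame g -> P.-integrable setT (EFin \o g).
Proof. by move=> [mg [M gM]]; exact: (bounded_integrable P mg gM). Qed.

Lemma tameD f g : tame f -> tame g -> tame (fun w => f w + g w).
Proof.
move=> [mf [M fM]] [mg [N gN]]; split; first exact: measurable_funD.
by exists (M + N) => w; rewrite (le_trans (ler_normD _ _))// lerD.
Qed.

Lemma tameM f g : tame f -> tame g -> tame (fun w => f w * g w).
Proof.
move=> [mf [M fM]] [mg [N gN]]; split; first exact: measurable_funM.
by exists (M * N) => w; rewrite normrM ler_pM.
Qed.

Lemma tame_norm f : tame f -> tame (fun w => `|f w|).
Proof.
move=> [mf [M fM]]; split; first exact: measurableT_comp.
by exists M => w; rewrite normr_id.
Qed.

Lemma tame_cst c : tame (fun=> c).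
Proof. by split; [exact: measurable_cst|exists `|c|]. Qed.

Lemma tame_sum (I : Type) (s : seq I) (F : I -> T -> R) : (forall i, tame (F i)) ->
  tame (fun w => \sum_(i <- s) F i w).
Proof.
move=> tF; elim: s => [|i s IH].
  by under [X in tame X]eq_fun do rewrite big_nil; exact: tame_cst.
by under [X in tame X]eq_fun do rewrite big_cons; exact: tameD.
Qed.

Lemma tame_indic A : measurable A -> tame (\1_A : T -> R).
Proof.
move=> mA; split; first exact: measurable_indic.
by exists 1 => w; rewrite indicE; case: (_ \in _); rewrite ?normr1 ?normr0.
Qed.

Lemma tame_net n F : tame (fun w => F (net n w)).
Proof. by split; [exact: measurable_fun_net|exact: bounded_net]. Qed.

Lemma integral_sum (I : Type) (s : seq I) (F : I -> T -> R) : (forall i, tame (F i)) ->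
  \int[P]_w (\sum_(i <- s) F i w) = \sum_(i <- s) \int[P]_w F i w.
Proof.
move=> tF; elim: s => [|i s IH].
  under eq_Rintegral do rewrite big_nil.
  by rewrite big_nil; exact: Rintegral_probability_cst.
under eq_Rintegral do rewrite big_cons.
rewrite big_cons -IH RintegralD//; apply: tame_integrable => //.
exact: tame_sum.
Qed.

Let branch i0 a c n (v : 'I_(nvert (network B i0 a c n))) (i : 'I_m) : set T :=
  pst i0 (upd a n v) (upd c n i) n.+1.

(** The events past are refined by the next latch and block. The refinements
    have total probability P (past), by the laws of the latch and of the
    block, so they cover it up to a null set. *)
Lemma past_split_integral i0 a c n (g : T -> R) : tame g ->
  \int[P]_w (\1_(pst i0 a c n) w * g w) =
  \sum_(v < nvert (network B i0 a c n)) \sum_(i < m)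
    \int[P]_w (\1_(@branch i0 a c n v i) w * g w).
Proof.
move=> tg; have [mg [M gM]] := tg.
have mbr v i : measurable (@branch i0 a c n v i) by exact: measurable_past.
pose rest w : R := \1_(pst i0 a c n) w -
  \sum_(v < nvert (network B i0 a c n)) \sum_(i < m) \1_(@branch i0 a c n v i) w.
have tin v i : tame (\1_(@branch i0 a c n v i) : T -> R) by exact: tame_indic.
have tpast : tame (\1_(pst i0 a c n) : T -> R) by exact/tame_indic/measurable_past.
have tsum : tame (fun w => \sum_(v < nvert (network B i0 a c n)) \sum_(i < m)
    (\1_(@branch i0 a c n v i) w : R)).
  by apply: tame_sum => v; apply: tame_sum => i; exact: tin.
have trest : tame rest.
  rewrite (_ : rest = (fun w => \1_(pst i0 a c n) w + (-1) *
    \sum_(v < nvert (network B i0 a c n)) \sum_(i < m) \1_(@branch i0 a c n v i) w)).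
    by apply: tameD => //; apply: tameM => //; exact: tame_cst.
  by apply/funext => w; rewrite mulN1r.
have rest0 w : 0 <= rest w.
  rewrite /rest subr_ge0 [X in _ <= X]indicE.
  have [|] := pselect (exists v i, @branch i0 a c n v i w); last first.
    move=> nb; rewrite big1 ?ler0n// => v _; rewrite big1// => i _.
    by rewrite indicE memNset// => h; apply: nb; exists v, i.
  move=> [v [i br]].
  have br' := br; rewrite /branch past_upd in br'.
  have [[pw la] bc] := br'; rewrite mem_set//= (bigD1 v)//= (bigD1 i)//= indicE mem_set//=.
  rewrite !big1 ?addr0//.
    move=> v' v'v; apply: big1 => i' _; rewrite indicE memNset//.
    rewrite /branch past_upd => -[[_ /= la'] _]; move: v'v.
    by rewrite -val_eqE /= -la -la' eqxx.
  move=> i' i'i; rewrite indicE memNset//.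
  by rewrite /branch past_upd => -[_ /= bc']; rewrite -bc' bc eqxx in i'i.
have int_rest : \int[P]_w rest w = 0.
  rewrite /rest RintegralB//; [|exact: tame_integrable|exact: tame_integrable].
  rewrite integral_sum; last by move=> v; apply: tame_sum => i; exact: tin.
  under eq_bigr do rewrite (integral_sum _ (tin _)).
  rewrite indicator_integral; last exact: measurable_past.
  under eq_bigr do under eq_bigr do rewrite (indicator_integral (mbr _ _)) -/(past_prob _ _ _ _) past_prob_upd.
  rewrite -/(past_prob i0 a c n).
  under eq_bigr do under eq_bigr do rewrite mulrA.
  under eq_bigr do rewrite -mulr_sumr hp1 mulr1.
  rewrite -mulr_sumr latch_sum ?mulr1 ?subrr//; exact: deg_gt0_network.
have int_restg : \int[P]_w (rest w * g w) = 0.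
  apply/eqP; rewrite -normr_le0.
  have h1 : `|\int[P]_w (rest w * g w)| <= \int[P]_w `|rest w * g w|.
    by apply: le_normr_Rintegral => //; exact/tame_integrable/tameM.
  apply: le_trans h1 _.
  rewrite -(mulr0 M) -int_rest -RintegralZl//; last exact: tame_integrable.
  apply: le_Rintegral => //.
  - exact/tame_integrable/tame_norm/tameM.
  - exact/tame_integrable/tameM/trest/tame_cst.
  - by move=> w _; rewrite normrM (ger0_norm (rest0 w)) mulrC ler_wpM2r.
have E w : \1_(pst i0 a c n) w * g w = \sum_(v < nvert (network B i0 a c n)) \sum_(i < m)
    (\1_(@branch i0 a c n v i) w * g w) + rest w * g w.
  under eq_bigr do rewrite -mulr_suml.
  by rewrite -mulr_suml -mulrDl /rest addrC subrK.
under eq_Rintegral do rewrite E.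
rewrite RintegralD//; last 2 first.
- apply: tame_integrable; apply: tame_sum => v; apply: tame_sum => i; exact: tameM.
- exact/tame_integrable/tameM.
rewrite int_restg addr0 integral_sum; last first.
  by move=> v; apply: tame_sum => i; exact: tameM.
by apply: eq_bigr => v _; rewrite integral_sum// => i; exact: tameM.
Qed.

Lemma past_integral k i0 a c n (F : mgraph -> R) :
  \int[P]_w (\1_(pst i0 a c n) w * F (net (n + k) w)) =
  past_prob i0 a c n * kernel_iter k F (network B i0 a c n).
Proof.
elim: k a c n => [|k IH] a c n.
  rewrite addn0 /= /past_prob -indicator_integral; last exact: measurable_past.
  rewrite mulrC -RintegralZl//; last exact/tame_integrable/tame_indic/measurable_past.
  apply: eq_Rintegral => w _; rewrite indicE.
  have [pw|npw] := pselect (pst i0 a c n w); last by rewrite memNset// mul0r mulr0.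
  by rewrite mem_set// mul1r mulr1 (net_past pw).
rewrite past_split_integral; last exact: tame_net.
rewrite kernel_iterS /hook_kernel mulr_sumr; apply: eq_bigr => v _.
rewrite mulr_sumr; apply: eq_bigr => i _.
rewrite -addSnnS IH past_prob_upd network_upd growE.
by rewrite -!mulrA.
Qed.

Definition start_prob (i : 'I_m) : R := fine (P (b0 @^-1` [set i])).

Lemma start_prob_ge0 i : 0 <= start_prob i. Proof. exact: fine_ge0. Qed.

Lemma past0 i a c : pst i a c 0 = b0 @^-1` [set i].
Proof. by apply/seteqP; split => [w [] //|w /= bw]; split. Qed.

Lemma start_sum1 w : \sum_(i < m) (\1_(b0 @^-1` [set i]) w : R) = 1.
Proof.
rewrite (bigD1 (b0 w))//= indicE mem_set//= big1 ?addr0// => i iw.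
by rewrite indicE memNset//= => h; rewrite h eqxx in iw.
Qed.

Lemma start_prob_sum : \sum_(i < m) start_prob i = 1.
Proof.
have mb i := measurable_start hG i.
under eq_bigr do rewrite /start_prob -(indicator_integral (mb _)).
rewrite -integral_sum; last by move=> i; exact: tame_indic.
by under eq_Rintegral do rewrite start_sum1; exact: Rintegral_probability_cst.
Qed.

Definition net_mean (n : nat) (F : mgraph -> R) : R :=
  \sum_(i < m) start_prob i * kernel_iter n F (B i).

Lemma net_meanE n (F : mgraph -> R) : \int[P]_w F (net n w) = net_mean n F.
Proof.
have mb i := measurable_start hG i.
have -> : \int[P]_w F (net n w) = \int[P]_w (\sum_(i < m) (\1_(b0 @^-1` [set i]) w * F (net n w))).
  by apply: eq_Rintegral => w _; rewrite -mulr_suml start_sum1 mul1r.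
rewrite integral_sum; last by move=> i; apply: tameM; [exact: tame_indic|exact: tame_net].
apply: eq_bigr => i _.
have := past_integral n i (fun=> 0%N) (fun=> i) 0 F.
by rewrite past0 add0n /past_prob past0.
Qed.

(** The networks that occur at time n with positive probability;
    nonessential degrees are a constraint on these networks only. *)
Inductive reach : nat -> mgraph -> Prop :=
| reach0 i : start_prob i != 0 -> reach 0 (B i)
| reachS n G (v : 'I_(nvert G)) i : reach n G -> reach n.+1 (attach v (B i)).

Lemma reach_deg_gt0 n G : reach n G -> deg_gt0_graph G.
Proof.
by elim=> [i _|{}n {}G v i _ h]; [exact: deg_gt0_block|exact: deg_gt0_attach].
Qed.

Lemma reach_past n G : reach n G ->
  exists i0 a c, network B i0 a c n = G /\ 0 < past_prob i0 a c n.
Proof.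
elim=> [i i0|{}n {}G v i rG [i0 [a [c [GE pp]]]]].
  exists i, (fun=> 0%N), (fun=> i); split => //.
  by rewrite /past_prob past0 lt_neqAle eq_sym i0 start_prob_ge0.
move: v; rewrite -GE => v.
exists i0, (upd a n v), (upd c n i); rewrite network_upd growE; split => //.
have dG := deg_gt0_network i0 a c n.
rewrite past_prob_upd mulr_gt0// mulr_gt0// divr_gt0 ?weight_gt0 ?total_weight_gt0//.
exact: dG.2.
Qed.

Lemma reach_essential n G l : reach n G -> (0 < l)%N -> (2 <= nb_deg G l)%N ->
  essential B P b0 latch blk l.
Proof.
move=> rG l0 G2; split => //.
have [i0 [a [c [GE pp]]]] := reach_past rG.
have mE : measurable [set w | exists n, (2 <= nb_deg (net n w) l)%N].
  rewrite (_ : [set w | _] = \bigcup_k (net k @^-1` [set H | (2 <= nb_deg H l)%N])).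
    by apply: bigcupT_measurable => k; exact: measurable_net.
  by apply/seteqP; split => [w [k kE]|w [k _ kE]]; exists k.
apply: (@lt_le_trans _ _ (P (pst i0 a c n))).
  have fp : P (pst i0 a c n) \is a fin_num by apply: fin_num_measure; exact: measurable_past.
  by rewrite -(fineK fp) lte_fin.
apply: le_measure; rewrite ?inE//; first exact: measurable_past.
by move=> w /net_past pw /=; exists n; rewrite pw GE.
Qed.

Lemma kernel_iter_mean_le k n G F F' : reach n G ->
  (forall H, reach (n + k) H -> F H <= F' H) -> kernel_iter k F G <= kernel_iter k F' G.
Proof.
elim: k F F' => [|k IH] F F' rG FF' /=; first by apply: FF'; rewrite addn0.
apply: IH => // H rH; apply: (mean_le (hook_kernel_mean (reach_deg_gt0 rH))).
by move=> _ [v [i ->]]; apply: FF'; rewrite addnS; exact: reachS.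
Qed.

Lemma kernel_iterD k F F' G : deg_gt0_graph G ->
  kernel_iter k (fun H => F H + F' H) G = kernel_iter k F G + kernel_iter k F' G.
Proof.
elim: k G => // k IH G dG; rewrite !kernel_iterS -(meanD (hook_kernel_mean dG)).
apply: (mean_eq (hook_kernel_mean dG)) => _ [v [i ->]].
by apply: IH; exact: deg_gt0_attach.
Qed.

Lemma kernel_iterZ k a F G : deg_gt0_graph G ->
  kernel_iter k (fun H => a * F H) G = a * kernel_iter k F G.
Proof.
elim: k G => // k IH G dG; rewrite !kernel_iterS -(meanZ (hook_kernel_mean dG)).
apply: (mean_eq (hook_kernel_mean dG)) => _ [v [i ->]].
by apply: IH; exact: deg_gt0_attach.
Qed.

Lemma kernel_iter1 k G : deg_gt0_graph G -> kernel_iter k (fun=> 1) G = 1.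
Proof.
elim: k G => // k IH G dG; rewrite kernel_iterS -[RHS](mean1 (hook_kernel_mean dG)).
apply: (mean_eq (hook_kernel_mean dG)) => _ [v [i ->]].
by apply: IH; exact: deg_gt0_attach.
Qed.

Lemma net_is_mean n : is_mean (reach n) (net_mean n).
Proof.
split => [f g|a f||f g fg]; rewrite /net_mean.
- rewrite -big_split/=; apply: eq_bigr => i _.
  by rewrite kernel_iterD ?mulrDr//; exact: deg_gt0_block.
- rewrite mulr_sumr; apply: eq_bigr => i _.
  by rewrite kernel_iterZ ?(mulrCA a)//; exact: deg_gt0_block.
- rewrite -[RHS]start_prob_sum; apply: eq_bigr => i _.
  by rewrite kernel_iter1 ?mulr1//; exact: deg_gt0_block.
- apply: ler_sum => i _; have [->|i0] := eqVneq (start_prob i) 0; first by rewrite !mul0r.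
  rewrite ler_wpM2l ?start_prob_ge0//.
  by apply: (@kernel_iter_mean_le n 0) => //; exact: reach0.
Qed.

Lemma net_markov_chain :
  markov_chain reach hook_tr net_mean hook_kernel.
Proof.
split; [exact: net_is_mean| |by []].
by move=> k G rG; apply: hook_kernel_mean; exact: reach_deg_gt0 rG.
Qed.

End Process.

End Kernel.
(** * One step of the degree counts *)

Section Gain.
Context {R : realType}.
Variables (chi rho : R) (m : nat) (B : 'I_m -> block) (p : 'I_m -> R).
Hypotheses (hchi : 0 <= chi) (hchirho : 0 < chi + rho).
Hypotheses (hp : forall i, 0 < p i) (hp1 : \sum_(i < m) p i = 1).
Local Notation w := (weight chi rho).
Local Notation W := (total_weight chi rho).

(** As the weight is affine in the degree, the weight gained by the latch is
    the same for all latches. *)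
Definition gain (b : 'I_m) : R :=
  \sum_(y < nvert (B b) | y != hook (B b)) w (deg y) + chi * (deg (hook (B b)))%:R.

Lemma total_weight_attach G (v : 'I_(nvert G)) b :
  W (attach v (B b)) = W G + gain b.
Proof.
rewrite /total_weight sum_deg_attach /gain; congr (_ + _).
by rewrite /weight natrD; ring.
Qed.

Lemma weight_ge k : (0 < k)%N -> chi + rho <= w k.
Proof.
case: k => // k _; rewrite /weight mulrSr mulrDr mulr1.
by have : 0 <= chi * k%:R by [exact: mulr_ge0|]; lra.
Qed.

Lemma gain_ge b : chi + rho <= gain b.
Proof.
have n2 := block_nvert (B b).
have [y yh] : exists y : 'I_(nvert (B b)), y != hook (B b).
  have [x0|x0] := eqVneq (nat_of_ord (hook (B b))) 0%N.
    by exists (Ordinal n2); rewrite -val_eqE /= x0.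
  by exists (Ordinal (ltnW n2)); rewrite -val_eqE /= eq_sym.
rewrite /gain (bigD1 y)//= -addrA -[leLHS]addr0; apply: lerD.
  exact/weight_ge/(deg_gt0_block (B b)).2.
rewrite addr_ge0 ?mulr_ge0//; apply: sumr_ge0 => z _.
by apply/ltW/weight_gt0 => //; exact: (deg_gt0_block (B b)).2.
Qed.

Lemma total_weight_block_ge b : chi + rho <= W (B b).
Proof.
rewrite /total_weight (bigD1 (hook (B b)))//= -[leLHS]addr0; apply: lerD.
  exact/weight_ge/(deg_gt0_block (B b)).2.
apply: sumr_ge0 => z _; apply/ltW/weight_gt0 => //; exact: (deg_gt0_block (B b)).2.
Qed.

Definition fresh (b : 'I_m) (k : nat) : R :=
  \sum_(y < nvert (B b) | y != hook (B b)) (deg y == k)%:R.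

Lemma nb_deg_attach G (v : 'I_(nvert G)) b k :
  (nb_deg (attach v (B b)) k)%:R = (nb_deg G k)%:R +
    (fresh b k + ((deg v + deg (hook (B b)))%N == k)%:R - (deg v == k)%:R) :> R.
Proof.
rewrite !nb_degE (sum_deg_attach (fun d => (d == k)%:R)) /fresh; congr (_ + _).
by rewrite addrC addrA.
Qed.

Lemma f_degE k : f_deg B p k = \sum_(b < m) p b * fresh b k.
Proof.
apply: eq_bigr => b _; congr (_ * _); rewrite -sum1_card natr_sum /fresh.
rewrite [LHS]big_mkcond [RHS]big_mkcond/=; apply: eq_bigr => y _.
by rewrite inE; case: (y != _) => //=; case: (deg y == k).
Qed.

Lemma g_degE k : g_deg B p k = \sum_(b < m) p b * (deg (hook (B b)) == k)%:R.
Proof.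
rewrite /g_deg big_mkcond/=; apply: eq_bigr => b _.
by case: eqP => _; rewrite ?mulr1 ?mulr0.
Qed.

Lemma sum_at (N k : nat) (F : nat -> R) : (0 < k < N)%N ->
  \sum_(1 <= l < N) F l * (k == l)%:R = F k.
Proof.
move=> /andP[k0 kN].
rewrite (bigD1_seq k)/= ?mem_index_iota ?k0 ?kN ?iota_uniq//.
rewrite eqxx mulr1 big1 ?addr0// => l lk.
by rewrite eq_sym (negbTE lk) mulr0.
Qed.

(** Only finitely many terms of the series differ from 0, because the
    degrees in the blocks are bounded; exchanging sums groups it by block. *)
Lemma lambda1E : lambda1 chi rho B p = \sum_(b < m) p b * gain b.
Proof.
pose D := (\max_(b < m) \max_(y < nvert (B b)) deg y)%N.
have dD b (y : 'I_(nvert (B b))) : (deg y <= D)%N.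
  apply: leq_trans (leq_bigmax b); exact: (leq_bigmax y).
apply: lim_near_cst; first exact: norm_hausdorff.
exists D.+1 => // N /= DN.
have dN b (y : 'I_(nvert (B b))) : (0 < deg y < N)%N.
  by rewrite (deg_gt0_block (B b)).2 (leq_ltn_trans (dD b y)).
rewrite big_split/=.
have -> : \sum_(1 <= k < N) w k * f_deg B p k =
    \sum_(b < m) p b * \sum_(y < nvert (B b) | y != hook (B b)) w (deg y).
  under eq_bigr do rewrite f_degE mulr_sumr.
  rewrite exchange_big/=; apply: eq_bigr => b _.
  under eq_bigr do rewrite mulrCA.
  rewrite -mulr_sumr; congr (_ * _); rewrite /fresh.
  under [LHS]eq_bigr do rewrite mulr_sumr.
  by rewrite exchange_big/=; apply: eq_bigr => y _; rewrite sum_at.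
have -> : \sum_(1 <= k < N) chi * k%:R * g_deg B p k =
    \sum_(b < m) p b * (chi * (deg (hook (B b)))%:R).
  under eq_bigr do rewrite g_degE mulr_sumr.
  rewrite exchange_big/=; apply: eq_bigr => b _.
  under eq_bigr do rewrite mulrCA.
  by rewrite -mulr_sumr (sum_at (fun k => chi * k%:R)).
by rewrite -big_split/=; apply: eq_bigr => b _; rewrite mulrDr.
Qed.

Lemma lambda1_gt0 : 0 < lambda1 chi rho B p.
Proof.
rewrite lambda1E; apply: lt_le_trans hchirho _.
rewrite -[leLHS]mul1r -hp1 mulr_suml; apply: ler_sum => b _.
by rewrite ler_wpM2l ?gain_ge// ltW.
Qed.

Lemma hook_kernel_deg G (H : nat -> 'I_m -> R) (F : mgraph -> R) :
  (forall (v : 'I_(nvert G)) b, F (attach v (B b)) = H (deg v) b) ->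
  hook_kernel chi rho B p G F =
  \sum_(v < nvert G) w (deg v) / W G * \sum_(b < m) p b * H (deg v) b.
Proof.
move=> FH; apply: eq_bigr => v _; rewrite mulr_sumr; apply: eq_bigr => b _.
by rewrite FH mulrA.
Qed.

Section Targets.
Variables (r : nat) (k : 'I_r -> nat).
Hypothesis k_inj : injective k.
Let K : nat := (\max_(i < r) k i)%N.

(** Each degree up to K that is not a target occurs at most once, hence
    contributes at most one value of phi. *)
Lemma sum_split_targets G (phi : nat -> R) : deg_gt0_graph G ->
  (forall l, (0 < l)%N -> (l <= K)%N -> (forall i, k i != l) -> (nb_deg G l <= 1)%N) ->
  (forall l, (K < l)%N -> phi l = 0) ->
  `|\sum_(v < nvert G) phi (deg v) - \sum_(i < r) (nb_deg G (k i))%:R * phi (k i)|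
    <= \sum_(l < K.+1) `|phi l|.
Proof.
move=> dG nb1 phiK.
pose psi l := if [exists i, k i == l] then 0 else phi l.
have phiE l : phi l = \sum_(i < r) (l == k i)%:R * phi (k i) + psi l.
  rewrite /psi; case: existsP => [[i /eqP kil]|ni].
    rewrite addr0 (bigD1 i)//= kil eqxx mul1r big1 ?addr0// => j ji.
    by rewrite -kil (inj_eq k_inj) eq_sym (negbTE ji) mul0r.
  rewrite big1 ?add0r// => i _; have [lk|_] := eqVneq l (k i); last by rewrite mul0r.
  by case: ni; exists i; rewrite lk.
have -> : \sum_(v < nvert G) phi (deg v) - \sum_(i < r) (nb_deg G (k i))%:R * phi (k i) =
   \sum_(v < nvert G) psi (deg v).
  under eq_bigr do rewrite phiE.
  rewrite big_split/= exchange_big/=.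
  under eq_bigr do rewrite -mulr_suml -nb_degE.
  by rewrite addrC addrK.
have psiK d : psi d = \sum_(l < K.+1) (d == l)%:R * psi l.
  have [dK|Kd] := ltnP d K.+1.
    rewrite (bigD1 (Ordinal dK))//= eqxx mul1r big1 ?addr0// => l ld.
    by move: ld; rewrite -val_eqE /= => ld; rewrite eq_sym (negbTE ld) mul0r.
  rewrite big1 => [|l _]; first by rewrite /psi phiK//; case: ifP.
  by rewrite (gtn_eqF (leq_trans (ltn_ord l) Kd)) mul0r.
under eq_bigr do rewrite psiK.
rewrite exchange_big/=; apply: le_trans (ler_norm_sum _ _ _) _.
apply: ler_sum => l _; rewrite -mulr_suml -nb_degE normrM.
rewrite /psi; case: existsP => [_|ni]; first by rewrite normr0 mulr0.
rewrite ger0_norm ?ler0n// ler_piMl//.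
have [l0|l0] := posnP l; last first.
  rewrite lern1; apply: nb1 => //; first by rewrite -ltnS.
  by move=> i; apply/negP => kil; apply: ni; exists i.
rewrite lern1 /nb_deg (_ : [set v | _]%SET = finset.set0) ?cards0//.
by apply/setP => v; rewrite !inE l0 gtn_eqF// dG.2.
Qed.

Definition avg (H : nat -> 'I_m -> R) (l : nat) : R := \sum_(b < m) p b * H l b.

Definition slack (H : nat -> 'I_m -> R) : R :=
  \sum_(l < K.+1) `|w l * (avg H l - avg H K.+1)|.

(** Above K the functional does not depend on the degree of the latch.
    Relative to this common value only degrees up to K contribute, and
    [sum_split_targets] reduces them to the targets. *)
Lemma kernel_targets G (H : nat -> 'I_m -> R) (F : mgraph -> R) : deg_gt0_graph G ->
  (forall l, (0 < l)%N -> (l <= K)%N -> (forall i, k i != l) -> (nb_deg G l <= 1)%N) ->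
  (forall l b, (K < l)%N -> H l b = H K.+1 b) ->
  (forall (v : 'I_(nvert G)) b, F (attach v (B b)) = H (deg v) b) ->
  `|hook_kernel chi rho B p G F - (avg H K.+1 +
     \sum_(j < r) w (k j) * ((nb_deg G (k j))%:R / W G) * (avg H (k j) - avg H K.+1))|
  <= slack H / W G.
Proof.
move=> dG nb1 HK FH; have W0 := total_weight_gt0 hchi hchirho dG.
rewrite (hook_kernel_deg FH).
pose phi l := w l * (avg H l - avg H K.+1).
have phiK l : (K < l)%N -> phi l = 0.
  move=> Kl; rewrite /phi (_ : avg H l = avg H K.+1) ?subrr ?mulr0//.
  by apply: eq_bigr => b _; rewrite (HK _ _ Kl).
have := sum_split_targets dG nb1 phiK; rewrite -/(slack H).
set s1 := \sum_(v < nvert G) phi (deg v); set s2 := \sum_(i < r) _ => h.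
rewrite [X in `|X|](_ : _ = (s1 - s2) / W G).
  by rewrite normrM normfV (gtr0_norm W0) ler_wpM2r// invr_ge0 ltW.
rewrite opprD addrA mulrBl; congr (_ - _); last first.
  rewrite /s2 mulr_suml; apply: eq_bigr => j _; rewrite /phi; ring.
rewrite -[avg H K.+1]mulr1 -(latch_sum hchi hchirho dG) mulr_sumr -sumrB /s1 mulr_suml.
by apply: eq_bigr => v _; rewrite /phi -/(avg H (deg v)); ring.
Qed.

End Targets.

End Gain.

(** * The centred degree vector *)

Section Vector.
Context {R : realType}.
Variables (chi rho : R) (m : nat) (B : 'I_m -> block) (p : 'I_m -> R).
Hypotheses (hchi : 0 <= chi) (hchirho : 0 < chi + rho).
Hypotheses (hp : forall i, 0 < p i) (hp1 : \sum_(i < m) p i = 1).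
Context {d : measure_display} {T : measurableType d}.
Variables (P : probability T R).
Variables (b0 : T -> 'I_m) (latch : nat -> T -> nat) (blk : nat -> T -> 'I_m).
Hypothesis hG : hooking_process chi rho B p P b0 latch blk.
Variables (r : nat) (k : 'I_r -> nat).
Hypotheses (hk_incr : forall i j : 'I_r, (i < j)%N -> (k i < k j)%N)
    (hk_ess : forall i, essential B P b0 latch blk (k i))
    (hk_first : forall l, essential B P b0 latch blk l ->
       (exists i, k i = l) \/ (forall i, (k i < l)%N)).
Variable nu : 'rV[R]_r.
Hypothesis hnu : forall i, nu 0 i =
       1 / (lambda1 chi rho B p + weight chi rho (k i)) *
       (f_deg B p (k i) +
        \sum_(j < r | (j < i)%N)
           weight chi rho (k j) * g_deg B p (k i - k j) * nu 0 j).

Local Notation w := (weight chi rho).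
Local Notation W := (total_weight chi rho).
Local Notation lam := (lambda1 chi rho B p).
Local Notation K := (\max_(i < r) k i)%N.
Local Notation Rch := (reach B P b0).

Lemma k_injective : injective k.
Proof.
move=> i j kij; apply/val_inj/eqP; have [ij|ji|//] := ltngtP (val i) (val j).
  by have := hk_incr ij; rewrite kij ltnn.
by have := hk_incr ji; rewrite kij ltnn.
Qed.

Lemma k_gt0 i : (0 < k i)%N. Proof. by have [] := hk_ess i. Qed.

Lemma wk_gt0 i : 0 < w (k i). Proof. exact/weight_gt0/k_gt0. Qed.

(** The listed degrees are the smallest essential ones, so an unlisted
    degree up to the largest of them is nonessential. *)
Lemma nonessential_nb n G l : Rch n G -> (0 < l)%N -> (l <= K)%N ->
  (forall i, k i != l) -> (nb_deg G l <= 1)%N.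
Proof.
move=> rG l0 lK kl; rewrite leqNgt; apply/negP => nb2.
have [[i ki]|kall] := hk_first (reach_essential hchi hchirho hp hG rG l0 nb2).
  by have := kl i; rewrite ki eqxx.
suff : (K <= l.-1)%N by rewrite leqNgt prednK// lK.
by apply/bigmax_leqP => i _; rewrite -ltnS prednK.
Qed.

(** Multiplying the coordinate i by eps^i multiplies the entry (i, j), j <
    i, of the lower triangular drift matrix by eps^(i - j). The value of eps
    is such that the off-diagonal entries of a row or of a column then add
    up to at most the diagonal entry. *)
Definition eps : R := (1 + r%:R + (\sum_j w (k j)) * (\sum_j (w (k j))^-1))^-1.

Lemma eps_den : 0 <= (\sum_j w (k j)) * (\sum_j (w (k j))^-1).
Proof.
rewrite mulr_ge0// sumr_ge0// => j _; rewrite ?invr_ge0; exact/ltW/wk_gt0.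
Qed.

Lemma eps_gt0 : 0 < eps.
Proof. by rewrite /eps invr_gt0; have := eps_den; have := ler0n R r; lra. Qed.

Lemma eps_mul_le x : 0 <= x -> x <= 1 + r%:R + (\sum_j w (k j)) * (\sum_j (w (k j))^-1) ->
  eps * x <= 1.
Proof.
move=> x0 h; have e0 := eps_gt0; rewrite -invr_gt0 invrK in e0.
by rewrite /eps mulrC ler_pdivrMr// mul1r.
Qed.

Lemma eps_le1 : eps <= 1.
Proof.
by rewrite -[leLHS]mulr1; apply: eps_mul_le => //; have := eps_den; have := ler0n R r; lra.
Qed.

Definition scale (i : 'I_r) : R := eps ^+ i.

Lemma scale_gt0 i : 0 < scale i. Proof. by rewrite exprn_gt0// eps_gt0. Qed.

Lemma scale_ratio (i j : 'I_r) : (j < i)%N -> scale i / scale j <= eps.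
Proof.
move=> ji; rewrite ler_pdivrMr ?scale_gt0// /scale -exprS.
by rewrite ler_wiXn2l// ?eps_le1// ltW// eps_gt0.
Qed.

(** Coordinate 0 is the centred total weight, coordinate i + 1 the deviation
    of the i-th count from its equilibrium W nu_i. *)
Definition coord n G (a : 'I_r.+1) : R :=
  if unlift ord0 a is Some i
  then scale i * ((nb_deg G (k i))%:R - W G * nu 0 i) else W G - lam * n%:R.

Definition V n G : 'cV[R]_r.+1 := \col_a coord n G a.

(** The increment of a coordinate when the block b is hooked to a latch of
    degree l. *)
Definition jump (a : 'I_r.+1) (l : nat) (b : 'I_m) : R :=
  if unlift ord0 a is Some i
  then scale i * (fresh B b (k i) + ((l + deg (hook (B b)))%N == k i)%:R
                  - (l == k i)%:R - gain chi rho B b * nu 0 i)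
  else gain chi rho B b - lam.

Lemma V0E n G : V n G ord0 0 = W G - lam * n%:R.
Proof. by rewrite mxE /coord unlift_none. Qed.

Lemma VliftE n G i :
  V n G (lift ord0 i) 0 = scale i * ((nb_deg G (k i))%:R - W G * nu 0 i).
Proof. by rewrite mxE /coord liftK. Qed.

Lemma V_step n G (v : 'I_(nvert G)) b a :
  V n.+1 (attach v (B b)) a 0 - V n G a 0 = jump a (deg v) b.
Proof.
rewrite /jump; case: unliftP => [i ->|->].
  by rewrite !VliftE nb_deg_attach total_weight_attach; ring.
by rewrite !V0E total_weight_attach mulrSr; ring.
Qed.

Lemma jump_far a l b : (K < l)%N -> jump a l b = jump a K.+1 b.
Proof.
have far l' i : (K < l')%N -> ((l' + deg (hook (B b)))%N == k i) = false /\ (l' == k i) = false.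
  move=> h; have hk : (k i < l')%N by apply: leq_ltn_trans h; exact: leq_bigmax.
  by rewrite !gtn_eqF// (leq_trans hk) ?leq_addr.
move=> Kl; rewrite /jump; case: unlift => // i.
by have [-> ->] := far l i Kl; have [-> ->] := far K.+1 i (ltnSn _).
Qed.

Definition jump_bound : R := \sum_a \sum_(l < K.+2) \sum_b `|jump a l b|.

Lemma jump_bound_ge0 : 0 <= jump_bound.
Proof. by do 3!apply: sumr_ge0 => ? _. Qed.

Lemma jump_le a l b : `|jump a l b| <= jump_bound.
Proof.
wlog lK : l / (l < K.+2)%N.
  move=> H; have [|Kl] := ltnP l K.+2; first exact: H.
  rewrite jump_far; first exact: H.
  exact: ltnW.
rewrite /jump_bound (bigD1 a)//= (bigD1 (Ordinal lK))//= (bigD1 b)//= -!addrA lerDl.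
rewrite addr_ge0 ?sumr_ge0// addr_ge0 ?sumr_ge0// => *; rewrite ?sumr_ge0// => *.
exact: sumr_ge0.
Qed.

Definition move_prob (i j : 'I_r) : R :=
  \sum_(b < m) p b * ((k j + deg (hook (B b)))%N == k i)%:R.

Lemma move_prob_ge0 i j : 0 <= move_prob i j.
Proof. by apply: sumr_ge0 => b _; rewrite mulr_ge0// ltW. Qed.

Lemma move_prob_le1 i j : move_prob i j <= 1.
Proof.
rewrite -hp1; apply: ler_sum => b _; rewrite ler_piMr ?(ltW (hp b))//.
by case: eqP.
Qed.

Lemma k_le_mono (i j : 'I_r) : (i <= j)%N -> (k i <= k j)%N.
Proof.
rewrite leq_eqVlt => /predU1P[/val_inj -> //|]; by move/hk_incr/ltnW.
Qed.

Lemma move_prob_0 (i j : 'I_r) : (i <= j)%N -> move_prob i j = 0.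
Proof.
move=> ij; apply: big1 => b _; rewrite gtn_eqF ?mulr0//.
rewrite (leq_ltn_trans (k_le_mono ij))// -[ltnLHS]addn0 ltn_add2l.
exact: (deg_gt0_block (B b)).2.
Qed.

Lemma move_prob_g (i j : 'I_r) : (j < i)%N -> move_prob i j = g_deg B p (k i - k j).
Proof.
move=> ji; rewrite g_degE; apply: eq_bigr => b _; congr (_ * (nat_of_bool _)%:R).
by rewrite -[RHS](eqn_add2l (k j)) subnKC// ltnW// hk_incr.
Qed.

Lemma avg_jump0 l : avg p (jump ord0) l = 0.
Proof.
rewrite /avg /jump unlift_none; under eq_bigr do rewrite mulrBr.
by rewrite sumrB -lambda1E// -mulr_suml hp1 mul1r subrr.
Qed.

Lemma avg_jump_lift i l : avg p (jump (lift ord0 i)) l =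
  scale i * (f_deg B p (k i) + \sum_b p b * ((l + deg (hook (B b)))%N == k i)%:R
             - (l == k i)%:R - lam * nu 0 i).
Proof.
rewrite /avg /jump liftK; under eq_bigr do rewrite mulrCA.
rewrite -mulr_sumr lambda1E// f_degE; congr (_ * _).
have one : (l == k i)%:R = \sum_b p b * (l == k i)%:R :> R.
  by rewrite -mulr_suml hp1 mul1r.
rewrite [X in _ = _ - X - _]one mulr_suml -big_split/= -!sumrB.
by apply: eq_bigr => b _; ring.
Qed.

Lemma avg_jump_far i :
  avg p (jump (lift ord0 i)) K.+1 = scale i * (f_deg B p (k i) - lam * nu 0 i).
Proof.
have ki : (k i <= K)%N by exact: leq_bigmax.
rewrite avg_jump_lift (gtn_eqF (_ : k i < K.+1)%N)// subr0.
rewrite big1 ?addr0// => b _.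
by rewrite gtn_eqF ?mulr0// (leq_trans (_ : k i < K.+1)%N)// leq_addr.
Qed.

Lemma avg_jump_diff i j :
  avg p (jump (lift ord0 i)) (k j) - avg p (jump (lift ord0 i)) K.+1 =
  scale i * (move_prob i j - (i == j)%:R).
Proof.
rewrite avg_jump_far avg_jump_lift -/(move_prob i j) (inj_eq k_injective) (eq_sym j).
by ring.
Qed.

(** The recursion that defines nu, cleared of denominators: the mean drift
    of the counts vanishes at N = W nu. *)
Lemma nu_balance i : f_deg B p (k i) - lam * nu 0 i +
  \sum_j w (k j) * (move_prob i j - (i == j)%:R) * nu 0 j = 0.
Proof.
have l0 := lambda1_gt0 B hchi hchirho hp hp1; have w0 := wk_gt0 i.
have h : (lam + w (k i)) * nu 0 i = f_deg B p (k i) +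
    \sum_(j < r | (j < i)%N) w (k j) * g_deg B p (k i - k j) * nu 0 j.
  by rewrite hnu mulrA mul1r mulfV ?mul1r// gt_eqF// addr_gt0.
have -> : \sum_j w (k j) * (move_prob i j - (i == j)%:R) * nu 0 j =
    \sum_(j < r | (j < i)%N) w (k j) * g_deg B p (k i - k j) * nu 0 j - w (k i) * nu 0 i.
  under eq_bigr do rewrite mulrBr mulrBl.
  rewrite sumrB; congr (_ - _).
    rewrite [RHS]big_mkcond/=; apply: eq_bigr => j _.
    by case: ltnP => ji; [rewrite move_prob_g|rewrite move_prob_0// mulr0 mul0r].
  rewrite (bigD1 i)//= eqxx mulr1 big1 ?addr0// => j ji.
  by rewrite eq_sym (negbTE ji) mulr0 mul0r.
by move: h; set s := \sum_(j < r | _) _ => h; lra.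
Qed.

Definition drift_mx : 'M[R]_r.+1 := \matrix_(a, c)
  if unlift ord0 a is Some i then
    if unlift ord0 c is Some j
    then scale i * (w (k j) * (move_prob i j - (i == j)%:R)) / scale j else 0
  else 0.

Lemma drift_mx_lift i j : drift_mx (lift ord0 i) (lift ord0 j) =
  scale i * (w (k j) * (move_prob i j - (i == j)%:R)) / scale j.
Proof. by rewrite mxE !liftK. Qed.

Lemma drift_mx_0l c : drift_mx ord0 c = 0. Proof. by rewrite mxE unlift_none. Qed.
Lemma drift_mx_0r a : drift_mx a ord0 = 0.
Proof. by rewrite mxE unlift_none; case: unlift. Qed.

Lemma drift_mx_diag i : drift_mx (lift ord0 i) (lift ord0 i) = - w (k i).
Proof.
rewrite drift_mx_lift move_prob_0// eqxx sub0r mulrN1 mulrN mulNr mulrAC mulfV ?mul1r//.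
by rewrite gt_eqF// scale_gt0.
Qed.

Lemma drift_mx_off i j : i != j -> `|drift_mx (lift ord0 i) (lift ord0 j)| <= eps * w (k j).
Proof.
move=> ij; rewrite drift_mx_lift (negbTE ij) subr0.
have [ji|ij'] := ltnP j i; last first.
  by rewrite move_prob_0// mulr0 mulr0 mul0r normr0 mulr_ge0 ?ltW ?eps_gt0 ?wk_gt0.
rewrite mulrAC normrM ger0_norm; last by rewrite divr_ge0 ?ltW ?scale_gt0.
have w0 := wk_gt0 j; have h0 := move_prob_ge0 i j.
rewrite ger0_norm; last by rewrite mulr_ge0// ltW.
apply: ler_pM; rewrite ?scale_ratio//.
- by rewrite divr_ge0 ?ltW ?scale_gt0.
- by rewrite mulr_ge0// ltW.
- by rewrite ler_piMr ?move_prob_le1// ltW.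
Qed.

Lemma drift_mx_dominant : dominant drift_mx.
Proof.
have e0 := eps_gt0.
have split_sum (F : 'I_r.+1 -> R) (a : 'I_r.+1) : (forall c, 0 <= F c) ->
    \sum_(c | c != a) F c <= F ord0 + \sum_(j | lift ord0 j != a) F (lift ord0 j).
  move=> F0; rewrite big_mkcond big_ord_recl/= [X in _ <= _ + X]big_mkcond lerD2r.
  by case: (_ != _).
split => a; case: (unliftP ord0 a) => [i ->|->].
- apply: le_trans (split_sum (fun c => `|drift_mx (lift ord0 i) c|) _ _) _ => //.
  rewrite drift_mx_0r normr0 add0r drift_mx_diag opprK.
  apply: (@le_trans _ _ (\sum_j eps * w (k j))).
    rewrite [leLHS]big_mkcond; apply: ler_sum => j _.
    rewrite (inj_eq lift_inj); case: (eqVneq j i) => [_|ji] /=.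
      by rewrite mulr_ge0 ?ltW// wk_gt0.
    by apply: drift_mx_off; rewrite eq_sym.
  rewrite -mulr_sumr -[leRHS]mul1r -ler_pdivrMr ?wk_gt0// -mulrA.
  apply: eps_mul_le.
    by rewrite mulr_ge0 ?invr_ge0 ?(ltW (wk_gt0 i))// sumr_ge0// => j _; exact/ltW/wk_gt0.
  have : (\sum_j w (k j)) * (w (k i))^-1 <= (\sum_j w (k j)) * (\sum_j (w (k j))^-1).
    rewrite ler_wpM2l//; first by rewrite sumr_ge0// => j _; exact/ltW/wk_gt0.
    by rewrite [leRHS](bigD1 i)//= lerDl sumr_ge0// => j _; rewrite invr_ge0 ltW// wk_gt0.
  move/le_trans; apply; rewrite lerDr; have := ler0n R r; lra.
- rewrite drift_mx_0l oppr0 big1// => c _; by rewrite drift_mx_0l normr0.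
- apply: le_trans (split_sum (fun c => `|drift_mx c (lift ord0 i)|) _ _) _ => //.
  rewrite drift_mx_0l normr0 add0r drift_mx_diag opprK.
  apply: (@le_trans _ _ (\sum_(j < r) eps * w (k i))).
    rewrite [leLHS]big_mkcond; apply: ler_sum => j _.
    rewrite (inj_eq lift_inj); case: (eqVneq j i) => [_|ji] /=.
      by rewrite mulr_ge0 ?ltW// wk_gt0.
    exact: drift_mx_off.
  rewrite sum_cst mulrA ler_piMl ?(ltW (wk_gt0 i))// mulrC.
  by apply: eps_mul_le => //; have := eps_den; lra.
- rewrite drift_mx_0r oppr0 big1// => c _; by rewrite drift_mx_0r normr0.
Qed.

Definition jump2 a c l b : R := jump a l b * jump c l b.

(** In the limit the latch has degree k j with probability w (k j) nu_j, and
    otherwise the jump is that of a latch of degree above K. *)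
Definition cov_mx : 'M[R]_r.+1 := \matrix_(a, c)
  (avg p (jump2 a c) K.+1 +
   \sum_j w (k j) * nu 0 j * (avg p (jump2 a c) (k j) - avg p (jump2 a c) K.+1)).

Lemma cov_mx_sym : cov_mx^T = cov_mx.
Proof.
apply/matrixP => a c; rewrite !mxE.
have E l : avg p (jump2 c a) l = avg p (jump2 a c) l.
  by apply: eq_bigr => b _; rewrite /jump2 (mulrC (jump c l b)).
by rewrite E; congr (_ + _); apply: eq_bigr => j _; rewrite E.
Qed.

Lemma reach_total n G : Rch n G -> n.+1%:R * (chi + rho) <= W G.
Proof.
elim=> [i _|{}n {}G v i _ IH]; first by rewrite mul1r total_weight_block_ge.
rewrite total_weight_attach mulrSr mulrDl mul1r lerD// gain_ge//.
Qed.

Lemma target_ratio n G j : Rch n G ->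
  (nb_deg G (k j))%:R / W G = nu 0 j + V n G (lift ord0 j) 0 / scale j / W G.
Proof.
move=> rG; rewrite VliftE; field; rewrite !gt_eqF ?scale_gt0//.
exact: total_weight_gt0 (reach_deg_gt0 rG).
Qed.

(** Inserting N_j = W nu_j + (N_j - W nu_j) into [kernel_targets], the
    constant terms cancel by [nu_balance] and the linear terms form the
    drift matrix. *)
Lemma V_drift n G a : Rch n G ->
  `|hook_kernel chi rho B p G (fun H => V n.+1 H a 0 - V n G a 0) -
    (drift_mx *m V n G) a 0 / W G| <= slack chi rho p k (jump a) / W G.
Proof.
move=> rG; have dG := reach_deg_gt0 rG.
have := @kernel_targets R chi rho m B p hchi hchirho r k k_injective G (jump a)
  (fun H => V n.+1 H a 0 - V n G a 0) dG (fun l => nonessential_nb rG)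
  (fun l b => @jump_far a l b) (fun v b => V_step n v b a).
set main := _ + \sum_(j < r) _ => h; suff -> : (drift_mx *m V n G) a 0 / W G = main by [].
rewrite /main mxE big_ord_recl drift_mx_0r mul0r add0r.
case: (unliftP ord0 a) => [i ->|->]; last first.
  rewrite avg_jump0 add0r mulr_suml !big1// => j _; first by rewrite !avg_jump0 subrr mulr0.
  by rewrite drift_mx_0l !mul0r.
rewrite [X in _ = _ + X](eq_bigr (fun j => w (k j) * (nu 0 j + V n G (lift ord0 j) 0 / scale j / W G) *
     (scale i * (move_prob i j - (i == j)%:R)))); last first.
  by move=> j _; rewrite (target_ratio j rG) (avg_jump_diff i j).
rewrite avg_jump_far mulr_suml.
have -> : \sum_(j < r) w (k j) * (nu 0 j + V n G (lift ord0 j) 0 / scale j / W G) *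
     (scale i * (move_prob i j - (i == j)%:R)) =
   scale i * (\sum_j w (k j) * (move_prob i j - (i == j)%:R) * nu 0 j) +
   \sum_j drift_mx (lift ord0 i) (lift ord0 j) * V n G (lift ord0 j) 0 / W G.
  rewrite mulr_sumr -big_split/=; apply: eq_bigr => j _.
  by rewrite drift_mx_lift; ring.
by rewrite addrA -mulrDr nu_balance mulr0 add0r.
Qed.

Lemma jump2_far a c l b : (K < l)%N -> jump2 a c l b = jump2 a c K.+1 b.
Proof. by move=> Kl; rewrite /jump2 !jump_far. Qed.

Definition cov_slope (a c : 'I_r.+1) : R :=
  \sum_j `|w (k j) / scale j * (avg p (jump2 a c) (k j) - avg p (jump2 a c) K.+1)|.

Lemma V_cov n G a c : Rch n G ->
  `|hook_kernel chi rho B p G (fun H => (V n.+1 H a 0 - V n G a 0) * (V n.+1 H c 0 - V n G c 0)) -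
    cov_mx a c| <= (slack chi rho p k (jump2 a c) + cov_slope a c * l1 V n G) / W G.
Proof.
move=> rG; have dG := reach_deg_gt0 rG.
have W0 : 0 < W G by exact: total_weight_gt0.
have step (v : 'I_(nvert G)) b : (V n.+1 (attach v (B b)) a 0 - V n G a 0) *
   (V n.+1 (attach v (B b)) c 0 - V n G c 0) = jump2 a c (deg v) b by rewrite !V_step.
have := @kernel_targets R chi rho m B p hchi hchirho r k k_injective G (jump2 a c)
  (fun H => (V n.+1 H a 0 - V n G a 0) * (V n.+1 H c 0 - V n G c 0)) dG (fun l => nonessential_nb rG)
  (fun l b => @jump2_far a c l b) step.
set main := _ + \sum_(j < r) _ => h.
apply: le_trans (ler_distD main _ _) _; rewrite mulrDl; apply: lerD => //.
rewrite /main mxE opprD addrACA subrr add0r -sumrB.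
apply: le_trans (ler_norm_sum _ _ _) _.
rewrite /cov_slope mulr_suml mulr_suml; apply: ler_sum => j _.
rewrite (target_ratio _ rG).
rewrite [X in `|X|](_ : _ = w (k j) / scale j * (avg p (jump2 a c) (k j) - avg p (jump2 a c) K.+1) *
   (V n G (lift ord0 j) 0 / W G)); last by ring.
rewrite normrM -[leRHS]mulrA ler_wpM2l// normrM normfV (gtr0_norm W0).
by rewrite ler_wpM2r ?invr_ge0 ?(ltW W0)// V_l1.
Qed.

Definition start_bound : R := \sum_a \sum_b `|V 0 (B b) a 0|.

Lemma V_le n G a : Rch n G -> `|V n G a 0| <= start_bound + n%:R * jump_bound.
Proof.
elim=> [i _|{}n {}G v i _ IH].
  rewrite mul0r addr0 /start_bound (bigD1 a)//= (bigD1 i)//= -addrA lerDl.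
  by rewrite addr_ge0 ?sumr_ge0// => c _; exact: sumr_ge0.
have -> : V n.+1 (attach v (B i)) a 0 = V n G a 0 + jump a (deg v) i.
  by rewrite -(V_step n v i a) addrC subrK.
apply: le_trans (ler_normD _ _) _; rewrite mulrSr mulrDl mul1r addrA.
by apply: lerD => //; exact: jump_le.
Qed.

Definition inv_min : R := (chi + rho)^-1.
Definition slack_sum : R := \sum_a slack chi rho p k (jump a).
Definition slack2_sum : R := \sum_a \sum_c slack chi rho p k (jump2 a c).
Definition slope_sum : R := \sum_a \sum_c cov_slope a c.
Definition urn_const : R := 1 + (start_bound + jump_bound) + inv_min +
  inv_min * slack_sum + inv_min * (slack2_sum + slope_sum).

Lemma slack_ge0 H : 0 <= slack chi rho p k H.
Proof. exact: sumr_ge0. Qed.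

Lemma slope_ge0 a c : 0 <= cov_slope a c. Proof. exact: sumr_ge0. Qed.

Lemma inv_total_le n G : Rch n G -> (W G)^-1 <= inv_min / n.+1%:R.
Proof.
move=> rG; have W0 := total_weight_gt0 hchi hchirho (reach_deg_gt0 rG).
rewrite /inv_min -invfM lef_pV2 ?posrE ?mulr_gt0//.
by rewrite mulrC; exact: reach_total.
Qed.

Lemma V_urn_drift :
  urn_drift Rch (hook_tr B) (hook_kernel chi rho B p) V W drift_mx cov_mx lam urn_const.
Proof.
have s0 : 0 <= start_bound by apply: sumr_ge0 => a _; exact: sumr_ge0.
have j0 := jump_bound_ge0.
have i0 : 0 <= inv_min by rewrite invr_ge0 ltW.
have t0 : 0 <= slack_sum by apply: sumr_ge0 => a _; exact: slack_ge0.
have t2 : 0 <= slack2_sum.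
  by apply: sumr_ge0 => a _; apply: sumr_ge0 => c _; exact: slack_ge0.
have t3 : 0 <= slope_sum.
  by apply: sumr_ge0 => a _; apply: sumr_ge0 => c _; exact: slope_ge0.
have p1 : 0 <= inv_min * slack_sum by exact: mulr_ge0.
have p2 : 0 <= inv_min * (slack2_sum + slope_sum) by rewrite mulr_ge0// addr_ge0.
split.
- by rewrite /urn_const; lra.
- exact: lambda1_gt0.
- exact: drift_mx_dominant.
- exact: cov_mx_sym.
- move=> n G a rG; apply: le_trans (V_le a rG) _.
  apply: (@le_trans _ _ ((start_bound + jump_bound) * n.+1%:R)); last first.
    by rewrite ler_wpM2r// /urn_const; lra.
  rewrite mulrDl; apply: lerD; first by rewrite ler_peMr// ler1n.
  by rewrite mulrC ler_wpM2l// ler_nat.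
- move=> n G _ a rG [v [b ->]]; rewrite V_step.
  by apply: le_trans (jump_le _ _ _) _; rewrite /urn_const; lra.
- move=> n G a rG; apply: le_trans (V_drift a rG) _.
  apply: (@le_trans _ _ (slack_sum * (inv_min / n.+1%:R))).
    apply: ler_pM; rewrite ?slack_ge0 ?inv_total_le//.
      by rewrite invr_ge0 ltW// (total_weight_gt0 hchi hchirho (reach_deg_gt0 rG)).
    by rewrite /slack_sum (bigD1 a)//= lerDl sumr_ge0// => c _; exact: slack_ge0.
  by rewrite mulrA ler_pM2r ?invr_gt0// mulrC /urn_const; lra.
- move=> n G a c rG; apply: le_trans (V_cov a c rG) _.
  have l0 := l1_ge0 V n G.
  have ha : slack chi rho p k (jump2 a c) <= slack2_sum.
    rewrite /slack2_sum (bigD1 a)//= (bigD1 c)//= -addrA lerDl.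
    by rewrite addr_ge0 ?sumr_ge0// => *; rewrite ?slack_ge0// sumr_ge0// => *; exact: slack_ge0.
  have hb : cov_slope a c <= slope_sum.
    rewrite /slope_sum (bigD1 a)//= (bigD1 c)//= -addrA lerDl.
    by rewrite addr_ge0 ?sumr_ge0// => *; rewrite ?slope_ge0// sumr_ge0// => *; exact: slope_ge0.
  apply: (@le_trans _ _ (((slack2_sum + slope_sum) * (1 + l1 V n G)) * (inv_min / n.+1%:R))).
    apply: ler_pM; rewrite ?inv_total_le//.
    + by rewrite addr_ge0 ?slack_ge0// mulr_ge0// slope_ge0.
    + by rewrite invr_ge0 ltW// (total_weight_gt0 hchi hchirho (reach_deg_gt0 rG)).
    rewrite mulrDl; apply: lerD.
      by apply: le_trans ha _; rewrite ler_peMr// lerDl.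
    by apply: ler_pM; rewrite ?slope_ge0// lerDr.
  rewrite mulrA ler_pM2r ?invr_gt0// mulrAC ler_wpM2r ?addr_ge0//.
  by rewrite mulrC /urn_const; lra.
- move=> n G rG; apply: (@le_trans _ _ (inv_min * W G)).
    rewrite /inv_min mulrC ler_pdivlMr//; exact: reach_total.
  rewrite ler_wpM2r//; last by rewrite /urn_const; lra.
  by rewrite ltW// (total_weight_gt0 hchi hchirho (reach_deg_gt0 rG)).
- move=> n G rG; rewrite -V0E; apply: (@le_trans _ _ (1 * (1 + l1 V n G))).
    by rewrite mul1r; have := V_l1 V n G ord0; lra.
  by rewrite ler_wpM2r// ?addr_ge0 ?l1_ge0// /urn_const; lra.
Qed.

End Vector.

(** * Convergence in distribution *)

Section ChainLimit.
Context {R : realType} {X : Type} {q : nat}.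
Variables (Rch : nat -> X -> Prop) (tr : X -> X -> Prop).
Variables (E : nat -> (X -> R) -> R) (K : X -> (X -> R) -> R).
Variables (V : nat -> X -> 'cV[R]_q) (S : X -> R) (A Q : 'M[R]_q) (lam C : R).
Hypotheses (hch : markov_chain Rch tr E K) (hud : urn_drift Rch tr K V S A Q lam C).

(** The limit exp (- quad / 2) of means of cosines is at most 1. *)
Lemma clt_cos_psd (Sig : 'M[R]_q) :
  (forall (s : 'rV[R]_q) b,
    (fun n => E n (fun x => cos ((s *m V n x) 0 0 / Num.sqrt n%:R + b))) @ \oo -->
    cos b * expR (- ((s *m Sig *m s^T) 0 0 / 2))) ->
  forall s : 'rV[R]_q, 0 <= (s *m Sig *m s^T) 0 0.
Proof.
move=> lim s; have l0 := lim s 0.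
have : cos 0 * expR (- ((s *m Sig *m s^T) 0 0 / 2)) <= 1.
  rewrite -(cvg_lim _ l0)//; apply: limr_le; first by apply/cvg_ex; eexists; exact: l0.
  apply: nearW => n; apply: le_trans (mean_cos_norm hch n _); exact: ler_norm.
rewrite cos0 mul1r -[leRHS]expR0 ler_expR oppr_le0.
by rewrite pmulr_lge0// invr_gt0.
Qed.

Section Projection.
Variables (r : nat) (M : 'M[R]_(r, q)).

Definition rescaled n x : 'rV[R]_r := (Num.sqrt n%:R)^-1 *: (M *m V n x)^T.

Lemma rescaled_dot n x (t : 'cV[R]_r) :
  (rescaled n x *m t) 0 0 = (t^T *m M *m V n x) 0 0 / Num.sqrt n%:R.
Proof.
rewrite /rescaled -scalemxAl mxE mulrC; congr (_ / _).
have -> : t^T *m M *m V n x = ((M *m V n x)^T *m t)^T by rewrite trmx_mul trmxK mulmxA.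
by rewrite [RHS]mxE.
Qed.

Lemma rescaled_mean n : is_bcmean (fun h => E n (fun x => h (rescaled n x))).
Proof.
have hE := ch_mean hch n.
split => [f g _ _|a f _||f g _ _ fg]; [exact: (meanD hE)|exact: (meanZ hE)|exact: (mean1 hE)|].
by apply: (mean_le hE) => x _; exact: fg.
Qed.

Lemma rescaled_coord n x i :
  `|rescaled n x 0 i| <= (Num.sqrt n%:R)^-1 * (sum_norm M * l1 V n x).
Proof.
rewrite /rescaled !mxE normrM ger0_norm ?invr_ge0 ?sqrtr_ge0//.
rewrite ler_wpM2l ?invr_ge0 ?sqrtr_ge0//.
apply: le_trans (ler_norm_sum _ _ _) _; rewrite /l1 mulr_sumr; apply: ler_sum => j _.
rewrite normrM ler_wpM2r// /sum_norm (bigD1 i)//= (bigD1 j)//= -addrA lerDl.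
by rewrite addr_ge0 ?sumr_ge0// => k _; exact: sumr_ge0.
Qed.

(** Chebyshev's inequality, from the second moment of V. *)
Lemma rescaled_tail e : 0 < e -> exists2 L, 0 < L &
  forall n, E n (fun x => tail L (rescaled n x)) <= e.
Proof.
move=> e0.
have m0 := sum_norm_ge0 M; set c := @moment_const R q C; have c0 : 0 <= c := moment_const_ge0 hud.
pose D := r%:R * sum_norm M ^+ 2 * (2 * c).
have D0 : 0 <= D.
  rewrite /D; apply: mulr_ge0; first by apply: mulr_ge0; [exact: ler0n|exact: sqr_ge0].
  by apply: mulr_ge0.
(* L^2 >= L >= D / e *)
pose L := 1 + D / e.
have De0 : 0 <= D / e by rewrite divr_ge0// ltW.
have L1 : 1 <= L by rewrite lerDl.
have L0 : 0 < L by exact: lt_le_trans L1.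
exists L => // n.
pose y : R := (Num.sqrt n%:R)^-1.
have y0 : 0 <= y by rewrite invr_ge0 sqrtr_ge0.
have y2 : y ^+ 2 * n.+1%:R <= 2.
  rewrite /y exprVn sqr_sqrtr//; case: n {y y0} => [|n]; first by rewrite invr0 mul0r.
  by rewrite mulrC ler_pdivrMr// -natrM ler_nat mul2n -addnn addSn addnS !ltnS leq_addr.
have hE := ch_mean hch n.
pose b := r%:R * (L^-1 ^+ 2 * (y ^+ 2 * sum_norm M ^+ 2)).
have i2 : 0 <= L^-1 ^+ 2 by exact: sqr_ge0.
have s2 : 0 <= sum_norm M ^+ 2 by exact: sqr_ge0.
have b0 : 0 <= b.
  by apply: mulr_ge0 => //; apply: mulr_ge0 => //; apply: mulr_ge0 => //; exact: sqr_ge0.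
apply: (@le_trans _ _ (E n (fun x => b * l1 V n x ^+ 2))).
  apply: (mean_le hE) => x _.
  rewrite /b -mulrA -sum_cst; apply: ler_sum => i _; rewrite ge_min; apply/orP; right.
  rewrite exprMn -mulrA ler_wpM2l ?sqr_ge0// -!exprMn -mulrA.
  rewrite -(real_normK (num_real (rescaled n x 0 i))) lerXn2r ?nnegrE//.
    by rewrite !mulr_ge0// ?sum_norm_ge0// l1_ge0.
  exact: rescaled_coord.
rewrite (meanZ hE).
apply: le_trans (ler_wpM2l b0 (mean_l1sq hch hud n)) _; rewrite -/c.
have -> : b * (c * n.+1%:R) = r%:R * sum_norm M ^+ 2 * c * L^-1 ^+ 2 * (y ^+ 2 * n.+1%:R).
  by rewrite /b; ring.
apply: (@le_trans _ _ (r%:R * sum_norm M ^+ 2 * c * L^-1 ^+ 2 * 2)).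
  apply: ler_wpM2l => //; apply: mulr_ge0 => //; apply: mulr_ge0 => //.
  exact: mulr_ge0.
rewrite -mulrA (mulrC (L^-1 ^+ 2)) mulrA -(mulrA _ c) (mulrC c) -/D exprVn ler_pdivrMr ?exprn_gt0//.
have eL : e * (D / e) = D by rewrite mulrC mulfVK// gt_eqF.
have LL : D / e <= L ^+ 2.
  by apply: (@le_trans _ _ L); [rewrite lerDr|rewrite expr2 ler_peMr// ltW].
by rewrite -[leLHS]eL ler_wpM2l// ltW.
Qed.

Theorem chain_clt : exists Cov : 'M[R]_r, covariance_matrix Cov /\
  exists mu : probability (borel_rV r) R, is_mvnormal Cov mu /\
  forall h : 'rV[R]_r -> R, bcont h ->
    (fun n => E n (fun x => h (rescaled n x))) @ \oo --> \int[mu]_x h x.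
Proof.
have [Sig SigT lim] := clt_cos_exists hch hud.
pose Cov := M *m Sig *m M^T.
have CovE (t : 'cV[R]_r) : t^T *m Cov *m t = t^T *m M *m Sig *m (t^T *m M)^T.
  by rewrite trmx_mul trmxK /Cov !mulmxA.
have hCov : covariance_matrix Cov.
  split; first by rewrite /Cov !trmx_mul trmxK SigT mulmxA.
  by move=> t; rewrite CovE; exact: clt_cos_psd.
exists Cov; split=> //.
have [mu [hmu mucos]] := mvnormal_exists hCov; exists mu; split=> // h bh.
have mid (g : 'rV[R]_r -> R) : continuous g ->
    measurable_fun (setT : set (@borel_rV R r)) (fun x => g x).
  exact: continuous_measurable_rV.
have hmean := @integral_is_bcmean R _ _ mu r (fun x : @borel_rV R r => (x : 'rV[R]_r)) mid.
apply: (trig_weak_limit rescaled_mean hmean) => //.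
- move=> t b; rewrite mucos CovE.
  by under eq_fun do under eq_fun do rewrite rescaled_dot; exact: lim.
- move=> e e0; have [L1 L10 h1] := rescaled_tail e0.
  have [L2 L20 h2] := @integral_tail R _ _ mu r (fun x : @borel_rV R r => (x : 'rV[R]_r)) mid e e0.
  exists (Num.max L1 L2); first by rewrite lt_max L10.
  split; last apply: nearW => n.
    apply: le_trans h2; apply: (bcmean_le hmean); try exact: tail_bcont.
    by move=> x; apply: tail_le => //; rewrite le_max lexx orbT.
  apply: le_trans (h1 n); apply: (bcmean_le (rescaled_mean n)); try exact: tail_bcont.
  by move=> x; apply: tail_le => //; rewrite le_max lexx.
Qed.

End Projection.

End ChainLimit.
Theorem theorem1p3 (R : realType) (chi rho : R)
    (hchi : 0 <= chi) (hchirho : 0 < chi + rho)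
    (m : nat) (B : 'I_m -> block) (p : 'I_m -> R)
    (hp : forall i, 0 < p i) (hp1 : \sum_(i < m) p i = 1)
    (d : measure_display) (T : measurableType d) (P : probability T R)
    (b0 : T -> 'I_m) (latch : nat -> T -> nat) (blk : nat -> T -> 'I_m)
    (hG : hooking_process chi rho B p P b0 latch blk)
    (r : nat) (hr : (0 < r)%N) (k : 'I_r -> nat)
    (hk_incr : forall i j : 'I_r, (i < j)%N -> (k i < k j)%N)
    (hk_ess : forall i, essential B P b0 latch blk (k i))
    (hk_first : forall l, essential B P b0 latch blk l ->
       (exists i, k i = l) \/ (forall i, (k i < l)%N))
    (nu : 'rV[R]_r)
    (hnu : forall i, nu 0 i =
       1 / (lambda1 chi rho B p + weight chi rho (k i)) *
       (f_deg B p (k i) +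
        \sum_(j < r | (j < i)%N)
           weight chi rho (k j) * g_deg B p (k i - k j) * nu 0 j)) :
  exists S : 'M[R]_r, covariance_matrix S /\
  exists mu : probability (borel_rV r) R, is_mvnormal S mu /\
    cvg_in_distribution P
      (fun n w =>
         (Num.sqrt n%:R)^-1 *:
         (\row_(i < r) (nb_deg (hooking_network B b0 latch blk n w) (k i))%:R
          - (n%:R * lambda1 chi rho B p) *: nu))
      mu.
Proof.
have hdrift := V_urn_drift hchi hchirho hp hp1 hG hk_incr hk_ess hk_first hnu.
have hchain := net_markov_chain hchi hchirho hp hp1 hG.
(* N_i - n lambda1 nu_i = (N_i - W nu_i) + (W - n lambda1) nu_i *)
pose M : 'M[R]_(r, r.+1) := \matrix_(i, a)
  if unlift ord0 a is Some j then (i == j)%:R / scale chi rho k i else nu 0 i.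
have [Cov [hCov [mu [hmu lim]]]] := chain_clt hchain hdrift M.
exists Cov; split=> //; exists mu; split=> // h ch hM.
apply: cvg_trans (lim h (conj ch hM)); apply: near_eq_cvg; apply: nearW => n /=.
rewrite -(net_meanE hchi hchirho hp1 hG); apply: eq_Rintegral => w _; congr h.
rewrite /rescaled; congr (_ *: _); apply/rowP => i.
set G := hooking_network _ _ _ _ _ _.
rewrite !mxE big_ord_recl mxE unlift_none V0E (bigD1 i)//= big1 => [|j ji].
  rewrite addr0 mxE liftK eqxx VliftE div1r mulKf ?gt_eqF ?(scale_gt0 hchi hchirho hk_ess)//.
  by ring.
by rewrite mxE liftK eq_sym (negbTE ji) !mul0r.
Qed.
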